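(* For all relatively prime integers $p\ge 2$ and $p'\ge 2$, $F_{L(c_{p,p'},0)}(\tau)$ is a holomorphic modular form on $SL(2,\mathbb{Z})$ (possibly identically zero). Moreover, $F_{L(c_{p,p'},0)}(\tau)$ is identically $0$ if and only if, up to interchanging $p$ and $p'$, one has $(p,p')=(2\tilde{p}^2,3\tilde{p}'^2)$ for some positive integers $\tilde{p},\tilde{p}'$.
   Context: Let $q = e^{2\pi i\tau}$ with $\tau$ in the upper half-plane, and let $\eta(\tau)=q^{1/24}\prod_{n=1}^\infty (1-q^n)$ be the Dedekind eta-function. For relatively prime integers $p,p'\geq 2$ let $c_{p,p'}=1-\frac{6(p-p')^2}{pp'}$ and let $L(c_{p,p'},0)$ be the vertex operator algebra of the Virasoro minimal model $\mathcal{M}(p,p')$. The models $\mathcal{M}(p,p')$ and $\mathcal{M}(p',p)$ are the same. The graded dimensions (characters) $\mathrm{tr}\, q^{L(0)-c_{p,p'}/24}$ of its irreducible modules are, for $1\le r\le p-1$, $1\le s\le p'-1$, $$\mathrm{ch}_{p,p'}^{r,s}(q)=\frac{1}{\eta(\tau)}\sum_{n\in\mathbb{Z}}\left(q^{\frac{(2npp'+p'r-ps)^2}{4pp'}}-q^{\frac{(2npp'+p'r+ps)^2}{4pp'}}\right),$$ with $\mathrm{ch}_{p,p'}^{r,s}=\mathrm{ch}_{p,p'}^{p-r,p'-s}$; up to this identification there are $m=\frac{(p-1)(p'-1)}{2}$ characters, and they are linearly independent. Let $D = q\frac{d}{dq}$. For functions $f_1,\dots,f_m$, the Wronskian $W_{D}(f_1,\dots,f_m)$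 is the determinant of the $m\times m$ matrix whose $(j,i)$ entry is $D^{j-1}f_i$, $1\le j,i\le m$. Let $f_1,\dots,f_m$ be an ordered basis of the span of the characters $\mathrm{ch}_{p,p'}^{r,s}$. Put $W_{L(c_{p,p'},0)}=W_D(f_1,\dots,f_m)$ and $W'_{L(c_{p,p'},0)}=W_D(Df_1,\dots,Df_m)$ (the Wronskian of the derivatives of the basis elements; the prime does not denote the derivative of the Wronskian). Define $$F_{L(c_{p,p'},0)}(\tau)=\frac{W'_{L(c_{p,p'},0)}(\tau)}{W_{L(c_{p,p'},0)}(\tau)},$$ which does not depend on the choice of basis. *)

(* Defs.v *)
From HB Require Import structures.
From mathcomp Require Import all_boot all_order all_algebra.
From mathcomp Require Import all_classical all_reals all_analysis.
From mathcomp Require Import complex.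

Set Implicit Arguments.
Unset Strict Implicit.
Unset Printing Implicit Defensive.

Import Order.TTheory GRing.Theory Num.Theory numFieldNormedType.Exports.
Local Open Scope classical_set_scope.
Local Open Scope ring_scope.

(* [R[i]] itself carries no topology: the topological and normed structures of
   a numeric field are inferred from a carrier of the form
   [Num.ClosedField.sort _].  Hence this packed version, for which [derivable]
   and [derive1] are complex differentiability and the complex derivative. *)
Definition Cplx (R : realType) : numClosedFieldType := R[i]%C.

Section Defs.
Variable R : realType.
Local Notation C := (Cplx R).

Definition uhp : set C := [set tau : C | 0 < complex.Im tau].

Definition cexp (z : C) : C :=
  ((expR (complex.Re z) * cos (complex.Im z)) +i*
   (expR (complex.Re z) * sin (complex.Im z)))%C.

Definition two_pi_i : C := (0 +i* (2 * pi))%C.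

(* q ^ h, for q = e ^ (2 pi i tau) and h real; the branch is the one given by
   tau. *)
Definition qpow (h : R) (tau : C) : C := cexp (two_pi_i * (h%:C)%C * tau).

Definition eta (tau : C) : C :=
  qpow 24^-1 tau *
  limn (fun N : nat => \prod_(1 <= n < N.+1) (1 - qpow 1 tau ^+ n)).

(* The terms n >= 0 and n < 0 are summed as two ordinary series. *)
Definition sumZ (u : int -> C) : C :=
  limn (series (fun n : nat => u n%:Z)) +
  limn (series (fun n : nat => u (- n.+1%:Z))).

Definition minimal_char (p p' r s : nat) (tau : C) : C :=
  (eta tau)^-1 *
  sumZ (fun n : int =>
    qpow ((2 * n%:~R * p%:R * p'%:R + p'%:R * r%:R - p%:R * s%:R) ^+ 2
          / (4 * p%:R * p'%:R)) tau
    - qpow ((2 * n%:~R * p%:R * p'%:R + p'%:R * r%:R + p%:R * s%:R) ^+ 2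
          / (4 * p%:R * p'%:R)) tau).

(* All pairs (r, s) with 1 <= r <= p - 1 and 1 <= s <= p' - 1; every character
   is listed twice because of the symmetry (r, s) ~ (p - r, p' - s). *)
Definition minimal_chars (p p' : nat) (rs : 'I_p.-1 * 'I_p'.-1) : C -> C :=
  minimal_char p p' (val rs.1).+1 (val rs.2).+1.

(* Functions on the upper half-plane are represented by total functions
   [C -> C] whose values outside [uhp] are irrelevant. *)
Definition in_span (I : finType) (v : I -> C -> C) (g : C -> C) : Prop :=
  exists a : I -> C, forall tau, uhp tau -> g tau = \sum_i a i * v i tau.

Definition lin_indep (I : finType) (v : I -> C -> C) : Prop :=
  forall a : I -> C,
    (forall tau, uhp tau -> \sum_i a i * v i tau = 0) -> forall i, a i = 0.

Definition basis_of_span (I : finType) (v : I -> C -> C)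
    (m : nat) (f : 'I_m -> C -> C) : Prop :=
  [/\ lin_indep f,
      forall i, in_span v (f i) &
      forall i, in_span f (v i)].

(* q d/dq = (2 pi i)^-1 d/dtau. *)
Definition Dq (f : C -> C) (tau : C) : C := two_pi_i^-1 * derive1 f tau.

Definition wronskian (m : nat) (f : 'I_m -> C -> C) (tau : C) : C :=
  \det (\matrix_(j < m, i < m) iter j Dq (f i) tau).

Definition wronskian_quotient (m : nat) (f : 'I_m -> C -> C) (tau : C) : C :=
  wronskian (fun i => Dq (f i)) tau / wronskian f tau.

Definition holomorphic_on_uhp (f : C -> C) : Prop :=
  forall tau, uhp tau -> derivable f tau 1.

Definition holomorphic_at_infinity (f : C -> C) : Prop :=
  exists a : nat -> C, forall tau, uhp tau ->
    series (fun n : nat => a n * qpow 1 tau ^+ n) @ \oo --> f tau.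

Definition weakly_modular (k : int) (f : C -> C) : Prop :=
  forall a b c d : int, a * d - b * c = 1 -> forall tau, uhp tau ->
    f ((a%:~R * tau + b%:~R) / (c%:~R * tau + d%:~R)) =
    (c%:~R * tau + d%:~R) ^ k * f tau.

Definition modular_form_of_weight (k : int) (f : C -> C) : Prop :=
  [/\ holomorphic_on_uhp f, weakly_modular k f & holomorphic_at_infinity f].

Definition holomorphic_modular_form (f : C -> C) : Prop :=
  exists k : int, modular_form_of_weight k f.

End Defs.

(* Main.v *)
Require Import Defs.
From HB Require Import structures.
From mathcomp Require Import all_boot all_order all_algebra.
From mathcomp Require Import all_classical all_reals all_analysis.
From mathcomp Require Import complex.
From mathcomp Require Import perm ring lra zify.

(* The numerators of the characters are theta series whose coefficients run
   through the functions on Z/2pp' that are even and odd under the unit omega with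
   omega = 1 mod 2p' and omega = -1 mod 2p.  This space is stable under the finite
   Fourier transform, which by Poisson summation describes the theta series at
   -1/tau up to a factor gauss_factor(tau) whose square is proportional to tau.
   By the pentagonal number theorem eta is the case (p, p') = (2, 3), so that the
   factor cancels and the characters span a space stable under tau -> -1/tau.

   Let W be the Wronskian of the m characters and W' that of their derivatives.
   Then W and W' transform with weights m(m-1) and m(m+1) up to a common
   constant.  The leading exponents of the characters are distinct with sum
   m(m-1)/12, and the leading coefficient of W is a Vandermonde determinant; so
   (W / eta^(2m(m-1)))^2 is invariant, finite and nonzero at infinity, hence a
   nonzero constant.  Therefore W has no zeros, and W'/W is a form of weight 2m.

   As W has no zeros, W' vanishes identically iff the constant 1 is in the span of
   the characters, i.e. iff eta is one of the numerators.  Comparing the exponents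
   x^2/4pp' and n^2/24 then gives 6x^2 = pp', and oddness under omega excludes
   that 6 divides p or p'.  Conversely, for 6x^2 = pp' with p, p' as in the theorem,
   the coefficients of eta rescaled by x are odd under omega. *)

Set Implicit Arguments.
Unset Strict Implicit.
Unset Printing Implicit Defensive.

Import Order.TTheory GRing.Theory Num.Theory numFieldNormedType.Exports.
Local Open Scope classical_set_scope.
Local Open Scope ring_scope.

(** * Complex numbers and sequences *)

(** Functions of tau are carried by absolutely convergent series [q^h (a_0 + a_1 q + ...)], and
    analytic facts are read off from coefficient bounds: derivatives are taken termwise, the Cauchy
    estimate comes from averaging over finitely many translates of tau, and a contraction of bounds
    for invariant functions takes the place of the valence formula. Integration enters only through
    Riemann sums of a Gaussian, whose limit [gauss_int] is never evaluated. No multiplier is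
    evaluated either. The constants in the inversion formulas of eta and of W only have to be
    nonzero, and the sign left open by a square root disappears on squaring. The numerators of the
    characters live at level 2pp' and eta at level 12, so their inversion formulas contain
    [gauss_factor] at different multiples of tau. Comparing the two values takes the
    differentiability of [gauss_factor], which is obtained by solving the inversion formula of eta
    for it; a differential equation then gives its square. *)

Section Modulus.
Variable R : realType.
Local Notation C := (Cplx R).
Implicit Types (x y : R) (z w : C).

Definition rc (x : R) : C := (x%:C)%C.

Lemma rc_is_additive : additive rc.
Proof. by move=> x y; rewrite /rc; apply/eqP; rewrite eq_complex /= oppr0 addr0 !eqxx. Qed.

Lemma rc_is_multiplicative : multiplicative rc.
Proof.
by split=> // x y; apply/eqP; rewrite eq_complex /= !mul0r !mulr0 subr0 addr0 !eqxx.
Qed.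

HB.instance Definition _ := GRing.isAdditive.Build R C rc rc_is_additive.
HB.instance Definition _ := GRing.isMultiplicative.Build R C rc rc_is_multiplicative.

Definition re (z : C) : R := complex.Re z.
Definition im (z : C) : R := complex.Im z.
Definition ii : C := (0 +i* 1)%C.
(** The norm of the numeric field takes its values in C itself. A modulus with values in [R] makes
    estimates accessible to real arithmetic; [normC_nm] relates the two. *)
Definition nm (z : C) : R := Normc.normc z.

Lemma reD z w : re (z + w) = re z + re w. Proof. by case: z w => [? ?] [? ?]. Qed.
Lemma imD z w : im (z + w) = im z + im w. Proof. by case: z w => [? ?] [? ?]. Qed.
Lemma reN z : re (- z) = - re z. Proof. by case: z. Qed.
Lemma imN z : im (- z) = - im z. Proof. by case: z. Qed.
Lemma reM z w : re (z * w) = re z * re w - im z * im w.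
Proof. by case: z w => [? ?] [? ?]. Qed.
Lemma imM z w : im (z * w) = re z * im w + im z * re w.
Proof. by case: z w => [a b] [c d] /=; rewrite /im /re /=. Qed.
Lemma re_rc x : re (rc x) = x. Proof. by []. Qed.
Lemma im_rc x : im (rc x) = 0. Proof. by []. Qed.
Lemma re_ii : re ii = 0. Proof. by []. Qed.
Lemma im_ii : im ii = 1. Proof. by []. Qed.
Lemma re0 : re 0 = 0. Proof. by []. Qed.
Lemma im0 : im 0 = 0. Proof. by []. Qed.
Lemma re1 : re 1 = 1. Proof. by []. Qed.
Lemma im1 : im 1 = 0. Proof. by []. Qed.

Lemma ceqP z w : re z = re w -> im z = im w -> z = w.
Proof. by case: z w => [a b] [c d]; rewrite /re /im /= => -> ->. Qed.

Lemma reV z : re z^-1 = re z / (re z ^+ 2 + im z ^+ 2).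
Proof. by case: z. Qed.
Lemma imV z : im z^-1 = - im z / (re z ^+ 2 + im z ^+ 2).
Proof. by rewrite mulNr; case: z. Qed.

Lemma ii2 : ii * ii = -1.
Proof. by apply: ceqP; rewrite ?reM ?imM ?reN ?imN ?re1 ?im1 ?re_ii ?im_ii; ring. Qed.

Lemma cE z : z = rc (re z) + ii * rc (im z).
Proof.
by apply: ceqP; rewrite ?reD ?imD ?reM ?imM ?re_rc ?im_rc ?re_ii ?im_ii; ring.
Qed.

Lemma two_pi_iE : two_pi_i R = rc (2 * pi) * ii.
Proof. by apply: ceqP; rewrite ?reM ?imM ?re_rc ?im_rc ?re_ii ?im_ii /two_pi_i /re /im /=; ring. Qed.

Lemma two_pi_i_neq0 : two_pi_i R != 0.
Proof.
apply/eqP => /(congr1 im); rewrite two_pi_iE imM re_rc im_ii im_rc re_ii im0 mulr1 mulr0 addr0.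
by apply/eqP; rewrite mulf_neq0 ?pnatr_eq0 // gt_eqF // pi_gt0.
Qed.

Lemma nmE z : nm z = Num.sqrt (re z ^+ 2 + im z ^+ 2). Proof. by case: z. Qed.
Lemma nm_ge0 z : 0 <= nm z. Proof. by rewrite nmE sqrtr_ge0. Qed.
Hint Resolve nm_ge0 : core.
Lemma nm_sqr z : nm z ^+ 2 = re z ^+ 2 + im z ^+ 2.
Proof. by rewrite nmE sqr_sqrtr // addr_ge0 // sqr_ge0. Qed.
Lemma nmM z w : nm (z * w) = nm z * nm w. Proof. exact: Normc.normcM. Qed.
Lemma nmV z : nm z^-1 = (nm z)^-1. Proof. exact: Normc.normcV. Qed.
Lemma nmD z w : nm (z + w) <= nm z + nm w. Proof. exact: le_normcD. Qed.
Lemma nmN z : nm (- z) = nm z. Proof. exact: normcN. Qed.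
Lemma nm0 : nm 0 = 0. Proof. exact: Normc.normc0. Qed.
Lemma nm1 : nm 1 = 1. Proof. exact: Normc.normc1. Qed.
Lemma nm_eq0 z : (nm z == 0) = (z == 0).
Proof. by apply/eqP/eqP => [/Normc.eq0_normc//|->]; rewrite nm0. Qed.
Lemma nm_gt0 z : (0 < nm z) = (z != 0).
Proof. by rewrite lt_def nm_ge0 andbT nm_eq0. Qed.
Lemma nmBC z w : nm (z - w) = nm (w - z). Proof. by rewrite -nmN opprB. Qed.
Lemma nmB z w : nm (z - w) <= nm z + nm w. Proof. by rewrite -(nmN w) nmD. Qed.
Lemma nm_rc x : nm (rc x) = `|x|.
Proof. by rewrite nmE re_rc im_rc expr0n addr0 sqrtr_sqr. Qed.
Lemma nm_ii : nm ii = 1.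
Proof. by rewrite nmE re_ii im_ii expr0n add0r expr1n sqrtr1. Qed.
Lemma nmX z n : nm (z ^+ n) = nm z ^+ n.
Proof. by elim: n => [|n IH]; rewrite ?expr0 ?nm1 // !exprS nmM IH. Qed.
Lemma nm_sum I (s : seq I) (P : pred I) (F : I -> C) :
  nm (\sum_(i <- s | P i) F i) <= \sum_(i <- s | P i) nm (F i).
Proof.
elim/big_rec2: _ => [|i x y _ IH]; first by rewrite nm0.
by apply: (le_trans (nmD _ _)); rewrite lerD2l.
Qed.
Lemma nm_prod I (s : seq I) (P : pred I) (F : I -> C) :
  nm (\prod_(i <- s | P i) F i) = \prod_(i <- s | P i) nm (F i).
Proof. by elim/big_rec2: _ => [|i x y _ <-]; rewrite ?nm1 ?nmM. Qed.
Lemma re_le_nm z : `|re z| <= nm z.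
Proof. by rewrite nmE -sqrtr_sqr ler_sqrt ?lerDl ?addr_ge0 ?sqr_ge0. Qed.
Lemma im_le_nm z : `|im z| <= nm z.
Proof. by rewrite nmE -sqrtr_sqr ler_sqrt ?lerDr ?addr_ge0 ?sqr_ge0. Qed.
Lemma nm_le_reim z : nm z <= `|re z| + `|im z|.
Proof.
rewrite {1}(cE z); apply: (le_trans (nmD _ _)).
by rewrite nmM nm_ii mul1r !nm_rc.
Qed.
Lemma nm_nat n : nm n%:R = n%:R.
Proof. by rewrite -(rmorph_nat rc) nm_rc normr_nat. Qed.

Lemma nm_lt_small z : (forall e : R, 0 < e -> nm z <= e) -> z = 0.
Proof.
move=> h; apply/eqP; rewrite -nm_eq0; apply/eqP/le_anti; rewrite nm_ge0 andbT.
by apply/ler_addgt0Pr => e e0; rewrite add0r h.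
Qed.

(** Convergence in terms of the real modulus; [is_lim_limn] converts it to the [limn] used in the
    definitions of [eta] and [sumZ]. *)
Definition is_lim (u : nat -> C) (l : C) :=
  forall e : R, 0 < e -> exists N, forall n, (N <= n)%N -> nm (u n - l) < e.

Lemma normC_nm (z : C) : `|z| = rc (nm z).
Proof. by rewrite nmE; exact: normc_def. Qed.

Lemma gt0_rc (z : C) : 0 < z -> exists2 e, 0 < e & z = rc e.
Proof.
have -> : (0 < z) = (im z == 0) && (0 < re z) by exact: ltcE.
by move=> /andP[/eqP h1 h2]; exists (re z) => //; apply: ceqP.
Qed.

Lemma rc_lt x y : (rc x < rc y) = (x < y). Proof. exact: ltcR. Qed.
Lemma rc_le x y : (rc x <= rc y) = (x <= y). Proof. exact: lecR. Qed.

Lemma is_lim_cvg (u : nat -> C) (l : C) : is_lim u l -> (u @ \oo --> l)%classic.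
Proof.
move=> h; apply/cvgrPdist_lt => e /gt0_rc[d d0 ->].
have [N hN] := h _ d0; near=> n.
rewrite normC_nm rc_lt nmBC hN //; near: n; exact: nbhs_infty_ge.
Unshelve. all: by end_near.
Qed.

Lemma is_lim_limn (u : nat -> C) (l : C) : is_lim u l -> limn u = l.
Proof. by move/is_lim_cvg/cvg_lim; apply; exact: norm_hausdorff. Qed.

Lemma is_lim_uniq (u : nat -> C) l1 l2 : is_lim u l1 -> is_lim u l2 -> l1 = l2.
Proof. by move=> /is_lim_limn <- /is_lim_limn. Qed.

Lemma is_limD (u v : nat -> C) a b :
  is_lim u a -> is_lim v b -> is_lim (fun n => u n + v n) (a + b).
Proof.
move=> hu hv e e0; have e2 : 0 < e / 2 by rewrite divr_gt0.
have [N hN] := hu _ e2; have [M hM] := hv _ e2.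
exists (maxn N M) => n; rewrite geq_max => /andP[/hN h1 /hM h2].
have -> : u n + v n - (a + b) = (u n - a) + (v n - b) by ring.
by apply: (le_lt_trans (nmD _ _)); rewrite [e]splitr ltrD.
Qed.

Lemma is_lim_cst a : is_lim (fun=> a) a.
Proof. by move=> e e0; exists 0%N => n _; rewrite subrr nm0. Qed.

Lemma is_limM (u v : nat -> C) a b :
  is_lim u a -> is_lim v b -> is_lim (fun n => u n * v n) (a * b).
Proof.
move=> hu hv e e0.
pose K := nm a + nm b + 1.
have K1 : 1 <= K by rewrite /K lerDr addr_ge0.
have K0 : 0 < K by apply: lt_le_trans K1.
(* If both errors are below [d <= 1], the error of the product is at most
   [d * (1 + nm a + nm b) = d * K <= e / 2]. *)
pose d := Num.min 1 (e / (2 * K)).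
have d0 : 0 < d by rewrite lt_min ltr01 divr_gt0 // mulr_gt0.
have [N hN] := hu _ d0; have [M hM] := hv _ d0.
exists (maxn N M) => n; rewrite geq_max => /andP[/hN h1 /hM h2].
have -> : u n * v n - a * b = (u n - a) * (v n - b) + (u n - a) * b + a * (v n - b) by ring.
have d1 : d <= 1 by rewrite ge_min lexx.
have d2 : d <= e / (2 * K) by rewrite ge_min lexx orbT.
have h3 : nm (u n - a) * nm (v n - b) <= d * 1.
  by apply: ler_pM => //; apply/ltW => //; apply: lt_le_trans d1.
have h4 : nm (u n - a) * nm b <= d * nm b by rewrite ler_wpM2r // ltW.
have h5 : nm a * nm (v n - b) <= nm a * d by rewrite ler_wpM2l // ltW.
apply: (le_lt_trans (nmD _ _)); rewrite nmM.
apply: (le_lt_trans (lerD (nmD _ _) (lexx _))); rewrite !nmM.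
apply: (@le_lt_trans _ _ (d * K)); first by rewrite /K; lra.
apply: (@le_lt_trans _ _ (e / (2 * K) * K)); first by rewrite ler_wpM2r // ltW.
have -> : e / (2 * K) * K = e / 2 by field; rewrite gt_eqF.
by rewrite gtr_pMr // invf_lt1 // ltr1n.
Qed.

Lemma is_lim_sub (u : nat -> C) a (f : nat -> nat) :
  (forall n, (n <= f n)%N) -> is_lim u a -> is_lim (u \o f) a.
Proof.
move=> hf hu e e0; have [N hN] := hu _ e0; exists N => n hn.
by apply: hN; apply: leq_trans hn _.
Qed.

Lemma is_lim_ext (u v : nat -> C) a : u =1 v -> is_lim u a -> is_lim v a.
Proof. by move=> h hu e e0; have [N hN] := hu _ e0; exists N => n /hN; rewrite h. Qed.

Lemma is_lim_nm_le (u : nat -> C) a K :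
  (forall n, nm (u n) <= K) -> is_lim u a -> nm a <= K.
Proof.
move=> hK hu; apply/ler_addgt0Pr => e e0.
have [N /(_ _ (leqnn N)) hN] := hu _ e0.
have := nmD (a - u N) (u N); rewrite subrK nmBC.
have := hK N; lra.
Qed.

Lemma cauchy_is_lim (u : nat -> C) :
  (forall e : R, 0 < e -> exists N, forall n m, (N <= n)%N -> (N <= m)%N ->
     nm (u n - u m) < e) -> exists l, is_lim u l.
Proof.
move=> hu.
(* Completeness is inherited from [R]; [v] will be the real part and then the imaginary part of
   [u]. *)
have real_case (v : nat -> R) : (forall n m, `|v n - v m| <= nm (u n - u m)) ->
    exists l, forall e : R, 0 < e -> exists N, forall n, (N <= n)%N -> `|v n - l| < e.
  move=> hv.
  have : cvgn v.
    apply/cauchy_cvgP/cauchy_ballP => e e0; rewrite !near_map2.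
    have [N hN] := hu _ e0.
    exists ([set n | (N <= n)%N]%classic, [set n | (N <= n)%N]%classic) => /=.
      by split; exists N.
    move=> [n m] /= [hn hm].
    by rewrite /ball /=; apply: le_lt_trans (hv _ _) (hN _ _ hn hm).
  move=> /cvgrPdist_lt cv; exists (limn v) => e e0.
  have [N _ hN] := cv _ e0; exists N => n hn; rewrite distrC; exact: hN.
have [a ha] := real_case (fun n => re (u n)) (fun n m =>
  ltac:(rewrite -reN -reD; exact: re_le_nm)).
have [b hb] := real_case (fun n => im (u n)) (fun n m =>
  ltac:(rewrite -imN -imD; exact: im_le_nm)).
exists (rc a + ii * rc b) => e e0.
have e2 : 0 < e / 2 by rewrite divr_gt0.
have [N hN] := ha _ e2; have [M hM] := hb _ e2.
exists (maxn N M) => n; rewrite geq_max => /andP[/hN h1 /hM h2].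
apply: (le_lt_trans (nm_le_reim _)); rewrite [e]splitr.
have -> : re (u n - (rc a + ii * rc b)) = re (u n) - a.
  by rewrite !(reD, reN, reM, re_rc, im_rc, re_ii, im_ii); ring.
have -> : im (u n - (rc a + ii * rc b)) = im (u n) - b.
  by rewrite !(imD, imN, imM, re_rc, im_rc, re_ii, im_ii); ring.
exact: ltrD.
Qed.

End Modulus.
#[global] Hint Extern 0 (is_true (@Order.le _ _ _ (nm _))) => exact: nm_ge0 : core.

(** * The complex exponential and real powers of q *)

Section Exponential.
Variable R : realType.
Local Notation C := (Cplx R).
Implicit Types (x y h k : R) (z w tau : C).

Lemma re_cexp z : re (cexp z) = expR (re z) * cos (im z). Proof. by []. Qed.
Lemma im_cexp z : im (cexp z) = expR (re z) * sin (im z). Proof. by []. Qed.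

Lemma cexpD z w : cexp (z + w) = cexp z * cexp w.
Proof.
by apply: ceqP; rewrite ?reM ?imM !(re_cexp, im_cexp) reD imD expRD ?cosD ?sinD; ring.
Qed.

Lemma cexp0 : cexp 0 = 1 :> C.
Proof.
by apply: ceqP; rewrite !(re_cexp, im_cexp) re0 im0 expR0 ?cos0 ?sin0 ?re1 ?im1 mul1r.
Qed.

Lemma nm_cexp z : nm (cexp z) = expR (re z).
Proof.
rewrite nmE re_cexp im_cexp !exprMn -mulrDr cos2Dsin2 mulr1 sqrtr_sqr ger0_norm // expR_ge0.
Qed.

Lemma cexp_neq0 z : cexp z != 0.
Proof. by rewrite -nm_eq0 nm_cexp expR_eq0. Qed.

Lemma cexpN z : cexp (- z) = (cexp z)^-1.
Proof.
apply: (mulfI (cexp_neq0 z)); rewrite -cexpD subrr cexp0 mulfV //; exact: cexp_neq0.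
Qed.

Lemma cexpMn z n : cexp (z *+ n) = cexp z ^+ n.
Proof. by elim: n => [|n IH]; rewrite ?mulr0n ?cexp0 // mulrS cexpD exprS IH. Qed.

Lemma cexp_2pi : cexp (two_pi_i R) = 1.
Proof.
rewrite two_pi_iE; apply: ceqP; rewrite !(re_cexp, im_cexp) reM imM !(re_rc, im_rc, re_ii, im_ii) ?re1 ?im1.
  by rewrite !mulr0 mul0r subr0 expR0 mul1r mulr1 addr0 mulr_natl cos2pi.
by rewrite !mulr0 mul0r subr0 expR0 mul1r mulr1 addr0 mulr_natl sin2pi.
Qed.

Lemma cexp_2pi_int (n : int) : cexp (two_pi_i R * n%:~R) = 1.
Proof.
have pos (k : nat) : cexp (two_pi_i R * k%:R) = 1 by rewrite mulr_natr cexpMn cexp_2pi expr1n.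
case: n => n; first by rewrite -pmulrn pos.
by rewrite NegzE mulrNz mulrN cexpN -pmulrn pos invr1.
Qed.

(** Everything follows from [1 + x <= expR x]; for [x >= 0] it is applied to [- x] and gives
    [(1 - x) * expR x <= 1]. *)
Lemma expR_sub1_le x : `|expR x - 1| <= `|x| * expR `|x|.
Proof.
have [x0|x0] := leP 0 x.
  have := expR_ge1Dx (- x); rewrite expRN => h.
  have e0 := expR_gt0 x.
  have e1 : 1 <= expR x by rewrite -expR0 ler_expR.
  rewrite !ger0_norm ?subr_ge0 //.
  have : (1 - x) * expR x <= 1.
    by rewrite -ler_pdivlMr // div1r.
  by nra.
have h := expR_ge1Dx x.
have e1 : expR x <= 1 by rewrite -expR0 ler_expR ltW.
have e2 : 1 <= expR `|x| by rewrite -expR0 ler_expR.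
rewrite ler0_norm ?subr_le0 // (ltr0_norm x0); rewrite (ltr0_norm x0) in e2.
nra.
Qed.

Lemma expR_sub1x_le x : `|expR x - 1 - x| <= x ^+ 2 * expR `|x|.
Proof.
have h := expR_ge1Dx x.
rewrite ger0_norm; last lra.
have [x0|x0] := leP 0 x.
  have hx := expR_sub1_le x; rewrite !ger0_norm ?subr_ge0 in hx => //; last first.
    by rewrite -expR0 ler_expR.
  rewrite ger0_norm //.
  have h2 := expR_ge1Dx (- x); rewrite expRN in h2.
  have e0 := expR_gt0 x.
  have h3 : (1 - x) * expR x <= 1 by rewrite -ler_pdivlMr // div1r.
  have [x1|x1] := leP 1 x; first by nra.
  nra.
rewrite (ltr0_norm x0).
have h1 := expR_ge1Dx (- x); rewrite expRN in h1.
have e0 := expR_gt0 x.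
have h3 : (1 - x) * expR x <= 1 by rewrite -ler_pdivlMr // div1r.
have e2 : 1 <= expR (- x) by rewrite -expR0 ler_expR; lra.
have : expR x - 1 - x <= x ^+ 2 by nra.
nra.
Qed.

Lemma sin_mvt y : 0 <= y -> exists2 c, 0 <= c <= y & sin y = cos c * y.
Proof.
move=> y0'; have hd x : x \in `]0, y[%R -> is_derive x 1 (@sin R) (cos x).
  by move=> _; exact: is_derive_sin.
have hc : {within `[0, y]%classic, continuous (@sin R)}.
  by apply: continuous_subspaceT => z; exact: continuous_sin.
have [c] := MVT_segment y0' hd hc.
by rewrite in_itv /= sin0 !subr0 => h1 h2; exists c.
Qed.

Lemma sin_abs_le y : `|sin y| <= `|y|.
Proof.
wlog y0 : y / 0 <= y.
  move=> H; have [/H//|yn] := leP 0 y.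
  by rewrite -normrN -sinN -(normrN y); apply: H; lra.
have [c _ ->] := sin_mvt y0.
by rewrite normrM ler_piMl // cos_max.
Qed.

Lemma cos_sub1E y : cos y - 1 = - 2 * sin (y / 2) ^+ 2.
Proof.
have -> : cos y = cos ((y / 2) *+ 2) by rewrite -mulr_natr divfK // pnatr_eq0.
by rewrite cos_mulr2n -mulr_natr cos2sin2; ring.
Qed.

Lemma cos_sub1_le y : `|cos y - 1| <= y ^+ 2 / 2.
Proof.
rewrite cos_sub1E normrM normrN normrX (@ger0_norm _ 2) //.
have h : `|sin (y / 2)| ^+ 2 <= `|y / 2| ^+ 2 by rewrite lerXn2r ?nnegrE // sin_abs_le.
rewrite !real_normK ?num_real // in h *.
by rewrite [leRHS](_ : _ = 2 * (y / 2) ^+ 2); [lra | field].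
Qed.

Lemma cos_sub1_le1 y : `|cos y - 1| <= `|y|.
Proof.
rewrite cos_sub1E normrM normrN normrX (@ger0_norm _ 2) //.
have h : `|sin (y / 2)| <= `|y| / 2.
  by rewrite (le_trans (sin_abs_le _)) // normrM (@ger0_norm _ 2^-1).
have h1 := sin_max (y / 2).
have : 0 <= `|sin (y / 2)| by [].
nra.
Qed.

Lemma sin_subx_le y : `|sin y - y| <= y ^+ 2.
Proof.
wlog y0 : y / 0 <= y.
  move=> H; have [/H//|yn] := leP 0 y.
  have := H (- y); rewrite sinN -opprD normrN sqrrN; apply; lra.
have [c /andP[c0 c1] ->] := sin_mvt y0.
rewrite -{2}[y]mul1r -mulrBl normrM expr2 (ger0_norm y0) ler_wpM2r //.
by rewrite (le_trans (cos_sub1_le1 _)) // ger0_norm.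
Qed.

(** Jordan's inequality with the constant [cos 1 / 2]. Up to 1 the mean value theorem gives slope at
    least [cos 1]; beyond 1, [sin x >= sin 1 >= cos 1] and [x <= pi / 2 < 2]. It bounds the distance
    of a root of unity from 1 below. *)
Lemma sin_ge_linear : exists2 c : R, 0 < c & forall x, 0 <= x <= pi / 2 -> c * x <= sin x.
Proof.
have c1 := @cos1_gt0 R; exists (cos 1 / 2); first by rewrite divr_gt0.
have small x : 0 <= x <= 1 -> cos 1 * x <= sin x.
  move=> /andP[x0 x1]; have [c /andP[c0 cx] ->] := sin_mvt x0.
  rewrite ler_wpM2r // leNgt ltr_cos ?in_itv /=; first by rewrite -leNgt; lra.
    by rewrite ler01 (le_trans _ (@pi_ge2 R)) // ler1n.
  by rewrite c0 (le_trans cx) // (le_trans x1) // (le_trans _ (@pi_ge2 R)) // ler1n.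
move=> x /andP[x0 xp]; have [x1|x1] := leP x 1.
  by apply: le_trans (small x _); [nra | rewrite x0].
have p2 := @pihalf_lt2 R; have p1 := @pihalf_ge1 R.
apply: (@le_trans _ _ (sin 1)); last first.
  by rewrite leNgt ltr_sin ?in_itv /=; lra.
have := small 1; rewrite lexx ler01 mulr1 => /(_ isT); nra.
Qed.

(** This second-order remainder drives both the termwise differentiation of q-series and the
    estimates for Gaussian differences. *)
Lemma cexp_sub1z_le w : nm (cexp w - 1 - w) <= 4 * nm w ^+ 2 * expR (nm w).
Proof.
set x := re w; set y := im w; set n := nm w.
have hx : `|x| <= n := re_le_nm w.
have hy : `|y| <= n := im_le_nm w.
have n0 : 0 <= n := nm_ge0 w.
have E1 : 1 <= expR n by rewrite -expR0 ler_expR.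
have Ex : expR `|x| <= expR n by rewrite ler_expR.
have ex : expR x <= expR n by rewrite ler_expR (le_trans (ler_norm _)).
have e0 := expR_gt0 x.
have hx2 : x ^+ 2 <= n ^+ 2 by rewrite -real_normK ?num_real // lerXn2r ?nnegrE.
have hy2 : y ^+ 2 <= n ^+ 2 by rewrite -real_normK ?num_real // lerXn2r ?nnegrE.
have hre : `|re (cexp w - 1 - w)| <= n ^+ 2 * expR n + expR n * (n ^+ 2 / 2).
  have -> : re (cexp w - 1 - w) = (expR x - 1 - x) + expR x * (cos y - 1).
    by rewrite !(reD, reN, re_cexp, re1) -/x -/y; ring.
  apply: (le_trans (ler_normD _ _)); rewrite normrM (ger0_norm (expR_ge0 x)); apply: lerD.
    apply: (le_trans (expR_sub1x_le x)); apply: ler_pM => //; exact: sqr_ge0.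
  apply: ler_pM => //.
  by apply: (le_trans (cos_sub1_le y)); rewrite ler_pM2r ?invr_gt0.
have him : `|im (cexp w - 1 - w)| <= n * expR n * n + n ^+ 2 * expR n.
  have -> : im (cexp w - 1 - w) = (expR x - 1) * sin y + (sin y - y).
    by rewrite !(imD, imN, im_cexp, im1) -/x -/y; ring.
  apply: (le_trans (ler_normD _ _)); rewrite normrM; apply: lerD.
    apply: ler_pM => //; last exact: le_trans (sin_abs_le _) _.
    by apply: (le_trans (expR_sub1_le x)); apply: ler_pM => //; exact: expR_ge0.
  apply: (le_trans (sin_subx_le y)); rewrite -[y ^+ 2]mulr1.
  by apply: ler_pM => //; exact: sqr_ge0.
apply: (le_trans (nm_le_reim _)).
have : 0 <= n ^+ 2 * expR n by rewrite mulr_ge0 ?sqr_ge0 ?expR_ge0.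
nra.
Qed.

Lemma qpowE h tau : qpow h tau = cexp (two_pi_i R * rc h * tau). Proof. by []. Qed.

Lemma nm_qpow (h : R) (tau : C) : nm (qpow h tau) = expR (- (2 * pi * h * im tau)).
Proof.
rewrite qpowE nm_cexp two_pi_iE !(reM, imM, re_rc, im_rc, re_ii, im_ii); congr expR; ring.
Qed.

Lemma qpowD h k (tau : C) : qpow (h + k) tau = qpow h tau * qpow k tau.
Proof. by rewrite !qpowE rmorphD mulrDr mulrDl cexpD. Qed.

Lemma qpow0 (tau : C) : qpow 0 tau = 1.
Proof. by rewrite qpowE rmorph0 mulr0 mul0r cexp0. Qed.

Lemma qpow_neq0 h (tau : C) : qpow h tau != 0. Proof. exact: cexp_neq0. Qed.

Lemma qpowN h (tau : C) : qpow (- h) tau = (qpow h tau)^-1.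
Proof. by rewrite !qpowE rmorphN mulrN mulNr cexpN. Qed.

Lemma qpowMn h n (tau : C) : qpow (h * n%:R) tau = qpow h tau ^+ n.
Proof.
by rewrite !qpowE -cexpMn; congr cexp; rewrite rmorphM rmorph_nat -mulr_natr /=; ring.
Qed.

Lemma qpow_nat n (tau : C) : qpow n%:R tau = qpow 1 tau ^+ n.
Proof. by rewrite -qpowMn mul1r. Qed.

Lemma qpow_scale h (k : R) tau : qpow h (rc k * tau) = qpow (h * k) tau.
Proof. by rewrite !qpowE rmorphM; congr cexp; rewrite /=; ring. Qed.

Lemma qpow_shift h (x : R) tau : qpow h (tau + rc x) = qpow h tau * cexp (two_pi_i R * rc (h * x)).
Proof. by rewrite !qpowE -cexpD rmorphM; congr cexp; rewrite /=; ring. Qed.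

End Exponential.

(** * Unordered sums *)

Section Summation.
Variable R : realType.
Local Notation C := (Cplx R).

(* Finite subsets are represented by duplicate-free sequences. *)
Definition has_sum (T : eqType) (u : T -> C) (S : C) :=
  forall e : R, 0 < e -> exists2 s0 : seq T, uniq s0 &
    forall s, uniq s -> {subset s0 <= s} -> nm (\sum_(x <- s) u x - S) < e.

(** For nonnegative [b] this is convergence without a chosen order of summation, so that reindexing
    along an injection costs nothing. *)
Definition bounded_sums (T : eqType) (b : T -> R) (K : R) :=
  forall s : seq T, uniq s -> \sum_(x <- s) b x <= K.

Definition summ (T : eqType) (u : T -> C) :=
  exists K, bounded_sums (fun x => nm (u x)) K.

(** [xget] returns 0 when no sum exists; under [summ] the meaning is given by [tsumP]. *)
Definition tsum (T : eqType) (u : T -> C) : C := xget 0 (has_sum u).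

Lemma big_subseq (V : nmodType) (T : eqType) (u : T -> V) (s0 s : seq T) :
  uniq s0 -> uniq s -> {subset s0 <= s} ->
  \sum_(x <- s) u x = \sum_(x <- s0) u x + \sum_(x <- s | x \notin s0) u x.
Proof.
move=> u0 us sub; rewrite (bigID (fun x => x \in s0)) /=; congr (_ + _).
rewrite -big_filter; apply: perm_big; apply: uniq_perm => //; first exact: filter_uniq.
by move=> x; rewrite mem_filter; case: (boolP (x \in s0)) => //= /sub.
Qed.

Lemma bounded_sums_sub (T : eqType) (b : T -> R) K (P : pred T) (s : seq T) :
  bounded_sums b K -> uniq s -> \sum_(x <- s | P x) b x <= K.
Proof. by move=> hb us; rewrite -big_filter; apply: hb; exact: filter_uniq. Qed.

(** A finite set whose sum is within [e] of the supremum of all finite sums leaves less than [e] for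
    any finite set disjoint from it. *)
Lemma bounded_sums_tail (T : eqType) (b : T -> R) K : (forall x, 0 <= b x) ->
  bounded_sums b K -> forall e : R, 0 < e -> exists2 s0 : seq T, uniq s0 &
  forall s, uniq s -> (forall x, x \in s -> x \notin s0) -> \sum_(x <- s) b x < e.
Proof.
move=> b0 hK e e0.
pose A := [set y : R | exists2 s : seq T, uniq s & y = \sum_(x <- s) b x].
have hA : has_sup A.
  split; first by exists 0; exists [::] => //; rewrite big_nil.
  by exists K => y [s us ->]; exact: hK.
have [_ [s0 u0 ->] h0] := sup_adherent e0 hA.
exists s0 => // s us hs.
have : \sum_(x <- s ++ s0) b x <= sup A.
  apply: (ub_le_sup hA.2); exists (s ++ s0) => //.
  rewrite cat_uniq us u0 andbT /=; apply/hasPn => x xs0; apply/negP => xs.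
  by have := hs _ xs; rewrite xs0.
by rewrite big_cat /=; lra.
Qed.

Lemma has_sum_uniq (T : eqType) (u : T -> C) S1 S2 :
  has_sum u S1 -> has_sum u S2 -> S1 = S2.
Proof.
move=> h1 h2; apply/eqP; rewrite -subr_eq0; apply/eqP; apply: nm_lt_small => e e0.
have e2 : 0 < e / 2 by rewrite divr_gt0.
have [s1 u1 hs1] := h1 _ e2; have [s2 u2 hs2] := h2 _ e2.
pose s := undup (s1 ++ s2); have us : uniq s := undup_uniq _.
have i1 : {subset s1 <= s} by move=> x xs; rewrite mem_undup mem_cat xs.
have i2 : {subset s2 <= s} by move=> x xs; rewrite mem_undup mem_cat xs orbT.
have := hs1 _ us i1; have := hs2 _ us i2.
set X := \sum_(x <- s) u x => a1 a2.
have -> : S1 - S2 = (X - S2) - (X - S1) by ring.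
by apply: (le_trans (nmB _ _)); lra.
Qed.

(** The sets [t n], outside which all finite sums of moduli are below [1/(n+1)], give a Cauchy
    sequence of sums: [t n] and [t m] are both compared with their union. *)
Lemma summ_has_sum (T : eqType) (u : T -> C) : summ u -> exists S, has_sum u S.
Proof.
move=> [K hK].
have ht (n : nat) : {s0 : seq T | uniq s0 & forall s, uniq s ->
    (forall x, x \in s -> x \notin s0) -> \sum_(x <- s) nm (u x) < n.+1%:R^-1 :> R}.
  apply: cid2; apply: (bounded_sums_tail _ hK) => //; by rewrite invr_gt0.
pose t n := s2val (ht n); have ut n : uniq (t n) := s2valP (ht n).
have tt n : forall s, uniq s -> (forall x, x \in s -> x \notin t n) ->
   \sum_(x <- s) nm (u x) < n.+1%:R^-1 := s2valP' (ht n).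
have near n s : uniq s -> {subset t n <= s} ->
    nm (\sum_(x <- s) u x - \sum_(x <- t n) u x) < n.+1%:R^-1.
  move=> us sub; rewrite (big_subseq u (ut n) us sub) addrAC subrr add0r.
  apply: le_lt_trans (nm_sum _ _ _) _; rewrite -big_filter; apply: tt.
    exact: filter_uniq.
  by move=> x; rewrite mem_filter => /andP[].
have inv_small (e : R) : 0 < e -> exists N : nat, forall n, (N <= n)%N -> n.+1%:R^-1 < e.
  move=> e0; have [N hN] := ltr_add_invr (y := 0) (x := e) e0.
  exists N => n hn; apply: le_lt_trans (_ : N.+1%:R^-1 < e); last by rewrite -(add0r _^-1).
  by rewrite lef_pV2 ?posrE // ler_nat.
have [l hl] : exists l, is_lim (fun n => \sum_(x <- t n) u x) l.
  apply: cauchy_is_lim => e e0; have e2 : 0 < e / 2 by rewrite divr_gt0.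
  have [N hN] := inv_small _ e2; exists N => n m hn hm.
  pose s := undup (t n ++ t m); have us : uniq s := undup_uniq _.
  have h1 := near n s us; have h2 := near m s us.
  have -> : \sum_(x <- t n) u x - \sum_(x <- t m) u x =
    (\sum_(x <- s) u x - \sum_(x <- t m) u x) - (\sum_(x <- s) u x - \sum_(x <- t n) u x) by ring.
  apply: (le_lt_trans (nmB _ _)).
  have := hN _ hn; have := hN _ hm.
  have {}h1 := h1 (fun x xs => ltac:(by rewrite mem_undup mem_cat xs)).
  have {}h2 := h2 (fun x xs => ltac:(by rewrite mem_undup mem_cat xs orbT)).
  move: h1 h2; set a := nm _; set b := nm _ => h1 h2 h3 h4.
  apply: (lt_le_trans (ltrD (lt_trans h2 h3) (lt_trans h1 h4))); by rewrite -splitr.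
exists l => e e0; have e2 : 0 < e / 2 by rewrite divr_gt0.
have [N hN] := inv_small _ e2; have [M hM] := hl _ e2.
pose n := maxn N M; exists (t n) => // s us sub.
have := hN n (leq_maxl _ _); have := hM n (leq_maxr _ _); have := near _ _ us sub.
move=> h1 h2 h3.
have -> : \sum_(x <- s) u x - l = (\sum_(x <- s) u x - \sum_(x <- t n) u x) + (\sum_(x <- t n) u x - l) by ring.
apply: (le_lt_trans (nmD _ _)); rewrite [e]splitr; apply: ltrD => //.
exact: lt_trans h1 h3.
Qed.

Lemma tsumP (T : eqType) (u : T -> C) : summ u -> has_sum u (tsum u).
Proof. by move=> /summ_has_sum[S hS]; apply: (xgetPex 0); exists S. Qed.

Lemma has_sum_tsum (T : eqType) (u : T -> C) S : has_sum u S -> tsum u = S.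
Proof. by move=> h; apply: (has_sum_uniq _ h); apply: (xgetPex 0); exists S. Qed.

Lemma has_sum_ext (T : eqType) (u v : T -> C) S : u =1 v -> has_sum u S -> has_sum v S.
Proof. by move=> /funext ->. Qed.

Lemma has_sumD (T : eqType) (u v : T -> C) S1 S2 :
  has_sum u S1 -> has_sum v S2 -> has_sum (fun x => u x + v x) (S1 + S2).
Proof.
move=> h1 h2 e e0; have e2 : 0 < e / 2 by rewrite divr_gt0.
have [s1 u1 hs1] := h1 _ e2; have [s2 u2 hs2] := h2 _ e2.
exists (undup (s1 ++ s2)) => [|s us sub]; first exact: undup_uniq.
have i1 : {subset s1 <= s} by move=> x xs; apply: sub; rewrite mem_undup mem_cat xs.
have i2 : {subset s2 <= s} by move=> x xs; apply: sub; rewrite mem_undup mem_cat xs orbT.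
rewrite big_split /= opprD addrACA; apply: (le_lt_trans (nmD _ _)).
by have := hs1 _ us i1; have := hs2 _ us i2; lra.
Qed.

Lemma has_sumZ (T : eqType) (c : C) (u : T -> C) S :
  has_sum u S -> has_sum (fun x => c * u x) (c * S).
Proof.
move=> h e e0; have c0 : 0 < nm c + 1 by rewrite ltr_wpDl ?ltr01.
have [s1 u1 hs1] := h (e / (nm c + 1)) (divr_gt0 e0 c0).
exists s1 => // s us sub; rewrite -mulr_sumr -mulrBr nmM.
have := hs1 _ us sub; rewrite ltr_pdivlMr // => h1.
by have := nm_ge0 (\sum_(x <- s) u x - S); have := nm_ge0 c; nra.
Qed.

Lemma has_sum0 (T : eqType) : has_sum (fun=> 0 : C) 0 (T := T).
Proof. by move=> e e0; exists [::] => // s _ _; rewrite big1 // subrr nm0. Qed.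

Lemma has_sum_big (T : eqType) I (r : seq I) (P : pred I) (u : I -> T -> C) S :
  (forall i, P i -> has_sum (u i) (S i)) ->
  has_sum (fun x => \sum_(i <- r | P i) u i x) (\sum_(i <- r | P i) S i).
Proof.
move=> h; elim: r => [|i r IH].
  by rewrite big_nil; apply: has_sum_ext (has_sum0 T) => x; rewrite big_nil.
rewrite big_cons; case: ifP => Pi.
  by apply: has_sum_ext (has_sumD (h _ Pi) IH) => x; rewrite big_cons Pi.
by apply: has_sum_ext IH => x; rewrite big_cons Pi.
Qed.

Lemma has_sum_finite (T : eqType) (u : T -> C) (s0 : seq T) :
  uniq s0 -> (forall x, x \notin s0 -> u x = 0) -> has_sum u (\sum_(x <- s0) u x).
Proof.
move=> u0 h e e0; exists s0 => // s us sub.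
by rewrite (big_subseq u u0 us sub) addrAC subrr add0r big1 ?nm0 // => x /h.
Qed.

Lemma has_sum_le (T : eqType) (u : T -> C) S K :
  has_sum u S -> bounded_sums (fun x => nm (u x)) K -> nm S <= K.
Proof.
move=> hu hK; apply/ler_addgt0Pr => e e0.
have [s us /(_ s us) hs] := hu _ e0.
have := nmD (S - \sum_(x <- s) u x) (\sum_(x <- s) u x); rewrite subrK nmBC.
have := hs (fun x h => h); have := hK _ us; have := nm_sum s predT u; lra.
Qed.

Lemma bounded_sums_le (T : eqType) (b c : T -> R) K :
  (forall x, b x <= c x) -> bounded_sums c K -> bounded_sums b K.
Proof. by move=> h hc s us; apply: le_trans (hc _ us); exact: ler_sum. Qed.

Lemma bounded_sumsD (T : eqType) (b c : T -> R) K L :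
  bounded_sums b K -> bounded_sums c L -> bounded_sums (fun x => b x + c x) (K + L).
Proof. by move=> hb hc s us; rewrite big_split lerD ?hb ?hc. Qed.

Lemma bounded_sumsZ (T : eqType) (a : R) (b : T -> R) K :
  0 <= a -> bounded_sums b K -> bounded_sums (fun x => a * b x) (a * K).
Proof. by move=> a0 hb s us; rewrite -mulr_sumr ler_wpM2l // hb. Qed.

Lemma summ_le (T : eqType) (u : T -> C) (b : T -> R) K :
  (forall x, nm (u x) <= b x) -> bounded_sums b K -> summ u.
Proof. by move=> h hb; exists K; apply: bounded_sums_le hb. Qed.

Lemma summ_ext (T : eqType) (u v : T -> C) : u =1 v -> summ u -> summ v.
Proof. by move=> /funext ->. Qed.

Lemma summD (T : eqType) (u v : T -> C) : summ u -> summ v -> summ (fun x => u x + v x).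
Proof.
move=> [K hK] [L hL]; exists (K + L); apply: bounded_sums_le (bounded_sumsD hK hL).
by move=> x; exact: nmD.
Qed.

Lemma summZ (T : eqType) (c : C) (u : T -> C) : summ u -> summ (fun x => c * u x).
Proof.
move=> [K hK]; exists (nm c * K); apply: bounded_sums_le (bounded_sumsZ (nm_ge0 c) hK).
by move=> x; rewrite nmM.
Qed.

Lemma summ_bounded_mul (T : eqType) (c u : T -> C) B :
  (forall x, nm (c x) <= B) -> summ u -> summ (fun x => c x * u x).
Proof.
move=> hc [K hK]; exists (Num.max 0 B * K).
have hB : 0 <= Num.max 0 B by rewrite le_max lexx.
apply: bounded_sums_le (bounded_sumsZ hB hK) => x.
rewrite nmM; apply: ler_wpM2r => //; apply: le_trans (hc x) _.
by rewrite le_max lexx orbT.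
Qed.

Lemma summ_restrict (T : eqType) (u : T -> C) (P : pred T) :
  summ u -> summ (fun x => if P x then u x else 0).
Proof.
move=> [K hK]; exists K; apply: bounded_sums_le hK => x.
by case: ifP => _; rewrite ?nm0 ?lexx.
Qed.

(** The sequence [s'] is fixed before the family and its value type, so that one lemma serves real
    bounds and complex sums. *)
Lemma preim_seq (T T' : eqType) (f : T' -> T) (s : seq T) : injective f -> uniq s ->
  exists2 s' : seq T', uniq s' &
    (forall y, (f y \in s) = (y \in s')) /\
    (forall V : nmodType, forall u : T -> V, (forall x, (forall y, x <> f y) -> u x = 0) ->
       \sum_(x <- s) u x = \sum_(y <- s') u (f y)).
Proof.
move=> finj; elim: s => [_|x s IH /= /andP[xs us]].
  by exists [::] => //; split=> // V u _; rewrite !big_nil.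
have [s' us' [mem_s' sum_s']] := IH us.
have [[y xy]|nx] := pselect (exists y, x = f y).
  exists (y :: s') => /=; first by rewrite us' andbT -mem_s' -xy.
  split=> [z|V u hu]; first by rewrite !inE xy (inj_eq finj) mem_s'.
  by rewrite !big_cons xy sum_s'.
exists s' => //; split=> [z|V u hu].
  rewrite inE mem_s'; case: eqP => // zx; by case: nx; exists z.
rewrite big_cons sum_s' // hu ?add0r // => y xy; by case: nx; exists y.
Qed.

Lemma summ_inj (T T' : eqType) (f : T' -> T) (u : T -> C) :
  injective f -> summ u -> summ (u \o f).
Proof.
move=> finj [K hK]; exists K => s us.
have := hK (map f s); rewrite map_inj_uniq // => /(_ us).
by rewrite big_map.
Qed.

Lemma bounded_sums_extend (T T' : eqType) (f : T' -> T) (b : T -> R) K :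
  injective f -> (forall x, (forall y, x <> f y) -> b x = 0) ->
  bounded_sums (b \o f) K -> bounded_sums b K.
Proof.
move=> finj hb hK s us; have [s' us' [_ ->]] := preim_seq finj us; last exact: hb.
exact: hK.
Qed.

Lemma has_sum_extend (T T' : eqType) (f : T' -> T) (u : T -> C) S :
  injective f -> (forall x, (forall y, x <> f y) -> u x = 0) ->
  has_sum (u \o f) S -> has_sum u S.
Proof.
move=> finj hu hS e e0; have [s0 us0 hs0] := hS _ e0.
exists (map f s0); first by rewrite map_inj_uniq.
move=> s us sub; have [s' us' [mem_s' ->]] := preim_seq finj us; last exact: hu.
by apply: hs0 => // y ys; rewrite -mem_s'; apply: sub; apply: map_f.
Qed.

Lemma has_sum_comp (T T' : eqType) (f : T' -> T) (u : T -> C) S :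
  injective f -> (forall x, (forall y, x <> f y) -> u x = 0) -> summ u ->
  has_sum u S -> has_sum (u \o f) S.
Proof.
move=> finj hu su hS; have [S' hS'] := summ_has_sum (summ_inj finj su).
by rewrite (has_sum_uniq hS (has_sum_extend finj hu hS')).
Qed.

(** The union of the finite sets belonging to the members of [js] approximates all these sums at
    once; [s0] lets the caller force further points into it. *)
Lemma has_sum_family (T J : eqType) (u : J -> T -> C) (v : J -> C) (js : seq J) (s0 : seq T) :
  (forall j, has_sum (u j) (v j)) -> forall e : R, 0 < e -> exists2 t, uniq t &
  {subset s0 <= t} /\ forall j, j \in js -> nm (\sum_(x <- t) u j x - v j) < e.
Proof.
move=> h e e0.
suff [t ut ht] : exists2 t : seq T, uniq t & forall s, uniq s -> {subset t <= s} ->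
    forall j, j \in js -> nm (\sum_(x <- s) u j x - v j) < e.
  exists (undup (s0 ++ t)); first exact: undup_uniq.
  split=> [x xs|]; first by rewrite mem_undup mem_cat xs.
  apply: ht => [|x xt]; first exact: undup_uniq.
  by rewrite mem_undup mem_cat xt orbT.
elim: js => [|j js [t ut ht]]; first by exists [::].
have [t1 ut1 ht1] := h j _ e0.
exists (undup (t1 ++ t)) => [|s us sub k]; first exact: undup_uniq.
rewrite inE => /orP[/eqP ->|kjs].
  by apply: ht1 => // x xt; apply: sub; rewrite mem_undup mem_cat xt.
by apply: ht => // x xt; apply: sub; rewrite mem_undup mem_cat xt orbT.
Qed.

Lemma sum_fibers (V : nmodType) (T J : eqType) (f : T -> J) (u : T -> V) (t : seq T) (js : seq J) :
  uniq js -> \sum_(j <- js) \sum_(x <- t) (if f x == j then u x else 0) =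
  \sum_(x <- t | f x \in js) u x.
Proof.
move=> ujs; rewrite exchange_big /= [RHS]big_mkcond /=; apply: eq_bigr => x _.
rewrite -big_mkcond /= -big_filter.
case: ifP => fx; last first.
  rewrite big_seq_cond big_pred0 // => j; rewrite mem_filter andbT.
  by apply/negP => /andP[/eqP <-]; rewrite fx.
rewrite (perm_big [:: f x]) ?big_seq1 //; apply: uniq_perm => //; first exact: filter_uniq.
move=> j; rewrite mem_filter inE eq_sym; case: eqP => // ->; by rewrite fx.
Qed.

Lemma divn_succ_le (a : R) n : 0 <= a -> a / n.+1%:R * n%:R <= a.
Proof. by move=> a0; rewrite mulrAC ler_pdivrMr // ler_wpM2l // ler_nat. Qed.

Lemma bounded_sums_fibers (T J : eqType) (f : T -> J) (u : T -> C) (v : J -> C) K :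
  bounded_sums (fun x => nm (u x)) K ->
  (forall j, has_sum (fun x => if f x == j then u x else 0) (v j)) ->
  bounded_sums (fun j => nm (v j)) K.
Proof.
move=> hK hv js ujs; apply/ler_addgt0Pr => e e0.
(* The allowance [e] is shared among the members of [js]; the successor covers the empty
   sequence. *)
pose e' := e / (size js).+1%:R; have e'0 : 0 < e' by rewrite divr_gt0.
have [t ut [_ ht]] := has_sum_family js [::] hv e'0.
have h1 j : j \in js -> nm (v j) <= nm (\sum_(x <- t) if f x == j then u x else 0) + e'.
  move=> /ht /ltW h; set X := \sum_(x <- t) _ in h *.
  have -> : v j = X - (X - v j) by ring.
  by apply: (le_trans (nmB _ _)); rewrite lerD2l.
apply: (@le_trans _ _ (\sum_(j <- js)
   (\sum_(x <- t) (if f x == j then nm (u x) else 0) + e'))).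
  rewrite big_seq [leRHS]big_seq; apply: ler_sum => j /h1 h.
  apply: (le_trans h); rewrite lerD2r; apply: (le_trans (nm_sum _ _ _)).
  by apply: ler_sum => x _; case: ifP => _; rewrite ?nm0 lexx.
rewrite big_split /= sum_fibers //; apply: lerD.
  exact: bounded_sums_sub.
rewrite big_const_seq count_predT iter_addr addr0 /e' -[_ *+ _]mulr_natr.
exact/divn_succ_le/ltW.
Qed.

(** Fubini along the fibres of [f]. Product sums, Cauchy products, splitting by residues and
    regrouping an integer series by its exponents are all instances. *)
Lemma has_sum_fibers (T J : eqType) (f : T -> J) (u : T -> C) (v : J -> C) S :
  (forall j, has_sum (fun x => if f x == j then u x else 0) (v j)) ->
  has_sum u S -> has_sum v S.
Proof.
move=> hv hS e e0; have e3 : 0 < e / 3 by rewrite divr_gt0.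
have [s0 us0 hs0] := hS _ e3.
exists (undup (map f s0)) => [|js ujs sub]; first exact: undup_uniq.
pose e' := e / 3 / (size js).+1%:R; have e'0 : 0 < e' by rewrite divr_gt0.
have [t ut [s2t ht]] := has_sum_family js s0 hv e'0.
have h1 : nm (\sum_(j <- js) v j - \sum_(x <- t | f x \in js) u x) <= e / 3.
  rewrite -(sum_fibers f u t ujs) -sumrB; apply: (le_trans (nm_sum _ _ _)).
  apply: (@le_trans _ _ (\sum_(j <- js) e')).
    by rewrite big_seq [leRHS]big_seq; apply: ler_sum => j /ht /ltW; rewrite nmBC.
  rewrite big_const_seq count_predT iter_addr addr0 /e' -[_ *+ _]mulr_natr.
  exact/divn_succ_le/ltW.
have h2 : nm (\sum_(x <- t | f x \in js) u x - S) < e / 3.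
  rewrite -big_filter; apply: hs0; first exact: filter_uniq.
  move=> x xs; by rewrite mem_filter s2t // sub // mem_undup map_f.
rewrite -[X in nm (X - S)](subrK (\sum_(x <- t | f x \in js) u x)) -addrA.
apply: (le_lt_trans (nmD _ _)); apply: lt_le_trans (ler_ltD h1 h2) _.
by rewrite -mulr2n -mulrnAl ler_pdivrMr // -mulr_natr ler_pM2l // ler_nat.
Qed.

Lemma bounded_sums_prod (T1 T2 : eqType) (b1 : T1 -> R) (b2 : T2 -> R) K1 K2 :
  (forall x, 0 <= b1 x) -> (forall x, 0 <= b2 x) ->
  bounded_sums b1 K1 -> bounded_sums b2 K2 ->
  bounded_sums (fun x => b1 x.1 * b2 x.2) (K1 * K2).
Proof.
move=> p1 p2 h1 h2 s us.
pose s1 := undup (map fst s); pose s2 := undup (map snd s).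
have K10 : 0 <= K1 by have := h1 [::] isT; rewrite big_nil.
apply: (@le_trans _ _ (\sum_(x <- [seq (x, y) | x <- s1, y <- s2]) b1 x.1 * b2 x.2)).
  rewrite (@big_subseq _ _ _ s [seq (x, y) | x <- s1, y <- s2]) //.
  - by rewrite lerDl sumr_ge0 // => x _; rewrite mulr_ge0.
  - by apply: allpairs_uniq; [exact: undup_uniq | exact: undup_uniq | move=> [? ?] [? ?]].
  - move=> [x y] xy; apply/allpairsP; exists (x, y); rewrite !mem_undup; split=> //.
      by apply/mapP; exists (x, y).
    by apply/mapP; exists (x, y).
rewrite big_allpairs /=.
under eq_bigr => x _ do rewrite -mulr_sumr.
rewrite -mulr_suml; apply: ler_pM; rewrite ?sumr_ge0 //.
  by apply: h1; exact: undup_uniq.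
by apply: h2; exact: undup_uniq.
Qed.

Lemma summ_prod (T1 T2 : eqType) (u : T1 -> C) (v : T2 -> C) :
  summ u -> summ v -> summ (fun x => u x.1 * v x.2).
Proof.
move=> [K hK] [L hL]; exists (K * L).
apply: bounded_sums_le (bounded_sums_prod _ _ hK hL) => [x|x|x]; rewrite ?nmM //.
Qed.

Lemma has_sum_prod (T1 T2 : eqType) (u : T1 -> C) (v : T2 -> C) S1 S2 :
  summ u -> summ v -> has_sum u S1 -> has_sum v S2 ->
  has_sum (fun x => u x.1 * v x.2) (S1 * S2).
Proof.
move=> su sv h1 h2; have suv := summ_prod su sv.
have [S hS] := summ_has_sum suv.
suff h : forall x, has_sum (fun z => if z.1 == x then u z.1 * v z.2 else 0) (u x * S2).
  have := has_sum_fibers h hS; have := has_sumZ S2 h1.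
  rewrite mulrC => /(has_sum_ext (fun x => mulrC S2 (u x))) a b.
  by rewrite (has_sum_uniq a b).
move=> x; apply: (@has_sum_extend _ _ (fun y => (x, y))) => [y z []//|[a b] h|].
  by rewrite /=; case: eqP => // ax; case: (h b); rewrite ax.
by apply: has_sum_ext (has_sumZ (u x) h2) => y; rewrite /= eqxx.
Qed.

(** Dominated convergence. Each of the two tails costs [e / 8] twice, once for replacing [tsum] by a
    finite sum and once for the dominated remainder; the finite part [s0] may use [e / 2]. *)
Lemma tannery (T : eqType) (u : nat -> T -> C) (w : T -> C) (b : T -> R) K :
  bounded_sums b K -> (forall n x, nm (u n x) <= b x) ->
  (forall x, is_lim (fun n => u n x) (w x)) ->
  is_lim (fun n => tsum (u n)) (tsum w).
Proof.
move=> hK hu hw e e0; have e8 : 0 < e / 8 by rewrite divr_gt0.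
have b0 x : 0 <= b x := le_trans (nm_ge0 _) (hu 0%N x).
have hwb x : nm (w x) <= b x := is_lim_nm_le (fun n => hu n x) (hw x).
have sw : summ w := summ_le hwb hK.
have su n : summ (u n) := summ_le (hu n) hK.
have [s0 us0 hs0] := bounded_sums_tail b0 hK e8.
have tail (v : T -> C) : (forall x, nm (v x) <= b x) ->
    nm (tsum v - \sum_(x <- s0) v x) <= e / 8 + e / 8.
  move=> hv; have [s us hs] := tsumP (summ_le hv hK) e8.
  pose t := undup (s0 ++ s); have ut : uniq t := undup_uniq _.
  have s0t : {subset s0 <= t} by move=> x xs; rewrite mem_undup mem_cat xs.
  have st : {subset s <= t} by move=> x xs; rewrite mem_undup mem_cat xs orbT.
  rewrite -[tsum v](subrK (\sum_(x <- t) v x)) -addrA.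
  apply: (le_trans (nmD _ _)); apply: lerD; first by rewrite nmBC ltW ?hs.
  rewrite (big_subseq v us0 ut s0t) addrAC subrr add0r.
  apply: (le_trans (nm_sum _ _ _)); apply: (le_trans (ler_sum _ (fun x _ => hv x))).
  rewrite -big_filter ltW // hs0 ?filter_uniq // => x.
  by rewrite mem_filter => /andP[].
have [N hN] : exists N, forall n, (N <= n)%N ->
    nm (\sum_(x <- s0) u n x - \sum_(x <- s0) w x) < e / 2.
  have : is_lim (fun n => \sum_(x <- s0) u n x) (\sum_(x <- s0) w x).
    elim: (s0) => [|x s IH].
      by rewrite big_nil; apply: is_lim_ext (is_lim_cst 0) => n; rewrite big_nil.
    rewrite big_cons; apply: is_lim_ext (is_limD (hw x) IH) => n.
    by rewrite big_cons.
  by apply; rewrite divr_gt0.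
exists N => n /hN h.
have := tail _ (hu n); have := tail _ hwb; move: h.
set a := tsum (u n); set a' := \sum_(x <- s0) u n x.
set c := tsum w; set c' := \sum_(x <- s0) w x => h h1 h2.
have -> : a - c = (a - a') + (a' - c') - (c - c') by ring.
apply: (le_lt_trans (nmB _ _)); apply: (le_lt_trans (lerD (nmD _ _) (lexx _))).
have h3 : e / 8 + e / 8 + e / 2 + (e / 8 + e / 8) = e by field.
by rewrite -[ltRHS]h3; apply: ltr_leD => //; apply: ler_ltD.
Qed.

Lemma bounded_sums_nat (b : nat -> R) K : (forall n, 0 <= b n) ->
  (forall n, \sum_(0 <= k < n) b k <= K) -> bounded_sums b K.
Proof.
move=> b0 hK s us; pose n := (\max_(x <- s) x).+1.
apply: le_trans (hK n); rewrite (@big_subseq _ _ b s (index_iota 0 n)) ?iota_uniq //.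
  by rewrite lerDl sumr_ge0.
by move=> x xs; rewrite mem_index_iota /= ltnS (leq_bigmax_seq x).
Qed.

Lemma has_sum_series (u : nat -> C) S :
  has_sum u S -> is_lim (fun n => \sum_(0 <= k < n) u k) S.
Proof.
move=> h e e0; have [s us hs] := h _ e0; exists (\max_(x <- s) x).+1 => n hn.
apply: hs; first exact: iota_uniq.
by move=> x xs; rewrite mem_index_iota /=; apply: leq_trans hn; rewrite ltnS (leq_bigmax_seq x).
Qed.

Lemma negz_inj : injective Negz. Proof. by move=> x y []. Qed.
Lemma posz_inj : injective Posz. Proof. by move=> x y []. Qed.

Lemma bounded_sums_int (b : int -> R) K L :
  bounded_sums (fun n : nat => b n%:Z) K -> bounded_sums (fun n : nat => b (Negz n)) L ->
  bounded_sums b (K + L).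
Proof.
move=> hK hL.
pose b1 z := if z is Posz n then b z else 0; pose b2 z := if z is Negz n then b z else 0.
have -> : b = (fun z => b1 z + b2 z).
  by apply/funext => -[] n; rewrite /b1 /b2 ?addr0 ?add0r.
apply: bounded_sumsD.
  by apply: (bounded_sums_extend posz_inj) hK => -[] n // h; have := h n.
by apply: (bounded_sums_extend negz_inj) hL => -[] n // h; have := h n.
Qed.

(** The two one-sided series of [sumZ] are the restrictions to [Posz] and [Negz], since [Negz n] is
    [- n.+1]. *)
Lemma has_sum_sumZ (u : int -> C) S : summ u -> has_sum u S -> sumZ u = S.
Proof.
move=> su hS.
pose u1 z := if z is Posz n then u z else 0; pose u2 z := if z is Negz n then u z else 0.
have [S1 h1] := summ_has_sum (summ_inj posz_inj su).
have [S2 h2] := summ_has_sum (summ_inj negz_inj su).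
have h1' : has_sum u1 S1.
  by apply: (@has_sum_extend _ _ _ u1 _ posz_inj) h1 => -[] n // h; have := h n.
have h2' : has_sum u2 S2.
  by apply: (@has_sum_extend _ _ _ u2 _ negz_inj) h2 => -[] n // h; have := h n.
have h : has_sum u (S1 + S2).
  by apply: has_sum_ext (has_sumD h1' h2') => -[] n; rewrite /u1 /u2 ?addr0 ?add0r.
rewrite (has_sum_uniq hS h) /sumZ; congr (_ + _); apply: is_lim_limn.
  exact: has_sum_series h1.
apply: is_lim_ext (has_sum_series h2) => n.
by apply: eq_bigr => k _; rewrite /= NegzE.
Qed.

End Summation.

(** * Points of the unit circle and sums of roots of unity *)

Section RootsOfUnity.
Variable R : realType.
Local Notation C := (Cplx R).

Definition ez (x : R) : C := cexp (two_pi_i R * rc x).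

Lemma ezD x y : ez (x + y) = ez x * ez y.
Proof. by rewrite /ez rmorphD mulrDr cexpD. Qed.

Lemma ez0 : ez 0 = 1. Proof. by rewrite /ez rmorph0 mulr0 cexp0. Qed.

Lemma ezN x : ez (- x) = (ez x)^-1. Proof. by rewrite /ez rmorphN mulrN cexpN. Qed.

Lemma ez_int (n : int) : ez n%:~R = 1.
Proof. by rewrite /ez rmorph_int cexp_2pi_int. Qed.

Lemma ezMn x n : ez (x * n%:R) = ez x ^+ n.
Proof. by rewrite /ez -cexpMn rmorphM rmorph_nat -mulr_natr; congr cexp; ring. Qed.

Lemma nm_ez x : nm (ez x) = 1.
Proof.
rewrite /ez nm_cexp two_pi_iE !(reM, imM, re_rc, im_rc, re_ii, im_ii) -[RHS]expR0.
by congr expR; ring.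
Qed.

Lemma ez_neq0 x : ez x != 0. Proof. exact: cexp_neq0. Qed.

Lemma nm_ez_sub1 x : nm (ez x - 1) ^+ 2 = 4 * sin (pi * x) ^+ 2.
Proof.
have rE : re (ez x) = cos ((pi * x) *+ 2).
  rewrite /ez re_cexp two_pi_iE !(reM, imM, re_rc, im_rc, re_ii, im_ii).
  rewrite (_ : _ - _ = 0); last ring.
  by rewrite expR0 mul1r -mulr_natr; congr cos; ring.
have := nm_ez x; move/(congr1 (fun t => t ^+ 2)); rewrite !nm_sqr expr1n.
rewrite !(reD, imD, reN, imN, re1, im1) oppr0 addr0 => h.
have -> : im (ez x) ^+ 2 = 1 - re (ez x) ^+ 2 by rewrite -h addrC addKr.
by rewrite rE cos_mulr2n cos2sin2 -mulr_natr; ring.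
Qed.

Lemma ez_neq1 x : 0 < x < 1 -> ez x != 1.
Proof.
move=> /andP[x0 x1]; rewrite -subr_eq0 -nm_eq0; apply/eqP => h.
have := nm_ez_sub1 x; rewrite h expr0n /= => /esym/eqP.
rewrite mulf_eq0 pnatr_eq0 /= expf_eq0 /= gt_eqF // sin_gt0_pi //.
by rewrite mulr_gt0 ?pi_gt0 //= gtr_pMr ?pi_gt0.
Qed.

Lemma ez_frac_neq1 (M : nat) (k : int) : (0 < M)%N -> ~~ (M %| k)%Z -> ez (k%:~R / M%:R) != 1.
Proof.
move=> M0 Mk; have M0z : M%:Z != 0 by rewrite eqz_nat -lt0n.
have M0r : 0 < M%:R :> R by rewrite ltr0n.
have -> : k%:~R / M%:R = (k %/ M)%Z%:~R + (k %% M)%Z%:~R / M%:R :> R.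
  rewrite {1}(divz_eq k M) rmorphD rmorphM /= mulrDl mulfK //.
  by rewrite gt_eqF.
rewrite ezD ez_int mul1r; apply: ez_neq1.
rewrite divr_gt0 //=; last first.
  rewrite ltr0z lt_def modz_ge0 // andbT; apply: contra Mk => /eqP h.
  by apply/dvdz_mod0P.
by rewrite ltr_pdivrMr // mul1r -[M%:R]/(M%:Z%:~R) ltr_int ltz_pmod.
Qed.

Lemma ez_root_sum (M : nat) (k : int) : (0 < M)%N ->
  \sum_(j < M) ez (k%:~R * j%:R / M%:R) = if (M %| k)%Z then M%:R else 0.
Proof.
move=> M0; have M0r : M%:R != 0 :> R by rewrite pnatr_eq0 -lt0n.
have E (j : nat) : ez (k%:~R * j%:R / M%:R) = ez (k%:~R / M%:R) ^+ j.
  by rewrite -ezMn; congr ez; ring.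
under eq_bigr => j _ do rewrite E.
case: ifP => [/dvdzP[l ->]|/negbT h].
  rewrite rmorphM /= mulfK // ez_int.
  by under eq_bigr => j _ do rewrite expr1n; rewrite sumr_const card_ord.
have z1 := ez_frac_neq1 M0 h.
apply: (mulfI (_ : ez (k%:~R / M%:R) - 1 != 0)); first by rewrite subr_eq0.
by rewrite -subrX1 -ezMn divfK // ez_int subrr mulr0.
Qed.

Lemma nm_ez_avg (M : nat) (x : R) : (0 < M)%N ->
  nm (M%:R^-1 * \sum_(j < M) ez (x * j%:R / M%:R)) <= 1.
Proof.
move=> M0; rewrite nmM nmV nm_nat mulrC ler_pdivrMr ?ltr0n // mul1r.
apply: (le_trans (nm_sum _ _ _)).
under eq_bigr => j _ do rewrite nm_ez.
by rewrite sumr_const card_ord.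
Qed.

End RootsOfUnity.

(** * Complex derivatives *)

Section DeriveChain.
Variable K : numFieldType.

Lemma is_derive_comp (f g : K -> K) (t a b : K) :
  is_derive t 1 f a -> is_derive (f t) 1 g b -> is_derive t 1 (g \o f) (b * a).
Proof.
move=> h1 h2.
have df : derivable f t 1 by exact: (@ex_derive _ _ _ _ _ _ _ h1).
have dg : derivable g (f t) 1 by exact: (@ex_derive _ _ _ _ _ _ _ h2).
have d1 : differentiable f t by apply/derivable1_diffP.
have d2 : differentiable g (f t) by apply/derivable1_diffP.
have dgf : derivable (g \o f) t 1 by apply/derivable1_diffP/differentiable_comp.
apply: is_derive_eq; first exact: derivableP.
rewrite deriveE; last exact: differentiable_comp.
rewrite (diff_comp d1 d2) [LHS]/=.
have e1 : ('d f t : K -> K) 1 = a.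
  by rewrite -deriveE //; exact: (@derive_val _ _ _ _ _ _ _ h1).
apply: etrans (congr1 ('d g (f t) : K -> K) e1) _.
have <- : 'D_1 g (f t) = b by exact: (@derive_val _ _ _ _ _ _ _ h2).
by rewrite deriveE // -[a in LHS]mulr1 linearZ mulrC.
Qed.

Lemma growth_rateE (h x d t : K) (f : K -> K) : h != 0 ->
  d - h^-1 *: (f (h *: 1 + t) - x) = - (h^-1 * (f (t + h) - x - h * d)).
Proof.
move=> h0; rewrite /GRing.scale /= mulr1 [t + h]addrC.
by rewrite [in RHS]mulrBr mulKf // opprB.
Qed.

(** The difference quotient with its denominator cleared, so that [h = 0] is harmless. The field is
    generic because derivatives are taken both over C and, along segments, over [R]. *)
Definition tangent_bound (f : K -> K) (t d : K) := forall e : K, 0 < e ->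
  exists2 del : K, 0 < del & forall h, `|h| < del -> `|f (t + h) - f t - h * d| <= e * `|h|.

Lemma is_derive_bound (f : K -> K) (t d : K) : tangent_bound f t d -> is_derive t 1 f d.
Proof.
move=> hf.
have lim : (fun h : K => h^-1 *: (f (h *: 1 + t) - f t)) @ 0^' --> d.
  apply/cvgrPdist_lt => e e0.
  have e2 : 0 < e / 2 by rewrite divr_gt0.
  have [del del0 hd] := hf _ e2.
  near=> h.
  have h0 : h != 0 by near: h; exact: nbhs_dnbhs_neq.
  have hdel : `|h| < del by near: h; exact: dnbhs0_lt.
  rewrite growth_rateE // normrN normrM normfV mulrC ltr_pdivrMr ?normr_gt0 //.
  apply: le_lt_trans (hd _ hdel) _; rewrite ltr_pM2r ?normr_gt0 //.
  by rewrite ltr_pdivrMr // ltr_pMr // ltr1n.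
split; first by apply/cvg_ex; exists d.
by apply: cvg_lim lim; exact: norm_hausdorff.
Unshelve. all: by end_near.
Qed.

Lemma bound_is_derive (f : K -> K) (t d : K) : is_derive t 1 f d -> tangent_bound f t d.
Proof.
move=> h e e0.
have df : derivable f t 1 by exact: (@ex_derive _ _ _ _ _ _ _ h).
have : (fun h : K => h^-1 *: (f (h *: 1 + t) - f t)) @ 0^' --> d.
  by rewrite -(@derive_val _ _ _ _ _ _ _ h); exact: df.
move/cvgrPdist_lt => /(_ e e0); rewrite near_withinE => /nbhs_normP[del /= del0 hdel].
exists del => // k hk; have [->|k0] := eqVneq k 0.
  by rewrite addr0 subrr mul0r subr0 normr0 mulr0.
have := hdel k; rewrite /= sub0r normrN => /(_ hk k0).
rewrite growth_rateE // normrN normrM normfV mulrC ltr_pdivrMr ?normr_gt0 //.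
exact: ltW.
Qed.

End DeriveChain.

Section Derivative.
Variable R : realType.
Local Notation C := (Cplx R).
Implicit Types (f g : C -> C) (t d : C).

Definition has_d f t d := forall e : R, 0 < e -> exists2 del : R, 0 < del &
  forall h, nm h < del -> nm (f (t + h) - f t - h * d) <= e * nm h.

Definition cd f t d := is_derive t (1 : C) f d.

Lemma has_d_cd f t d : has_d f t d -> cd f t d.
Proof.
move=> hf; apply: is_derive_bound => e /gt0_rc[e' e0 ->].
have [del del0 hd] := hf _ e0; exists (rc del); first by rewrite -(rmorph0 (@rc R)) rc_lt.
by move=> h; rewrite !normC_nm rc_lt -rmorphM rc_le => /hd.
Qed.

Lemma cd_has_d f t d : cd f t d -> has_d f t d.
Proof.
move=> /bound_is_derive hf e e0.
have re0' : 0 < rc e by rewrite -(rmorph0 (@rc R)) rc_lt.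
have [_ /gt0_rc[del del0 ->] hd] := hf _ re0'; exists del => // h hh.
by rewrite -rc_le rmorphM /= -!normC_nm; apply: hd; rewrite normC_nm rc_lt.
Qed.

Lemma has_d_quad f t d (K del : R) : 0 < del ->
  (forall h, nm h < del -> nm (f (t + h) - f t - h * d) <= K * nm h ^+ 2) -> has_d f t d.
Proof.
move=> del0 hf e e0.
have K0 : 0 < `|K| + 1 by rewrite ltr_wpDl.
exists (Num.min del (e / (`|K| + 1))); first by rewrite lt_min del0 divr_gt0.
move=> h; rewrite lt_min => /andP[/hf h1]; rewrite ltr_pdivlMr // => h2.
apply: (le_trans h1); rewrite expr2 mulrA ler_wpM2r //.
apply: le_trans (ltW h2); rewrite mulrC ler_wpM2l //.
by rewrite (le_trans (ler_norm K)) // lerDl.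
Qed.

Lemma cd_Dq f t d : cd f t d -> Dq f t = (two_pi_i R)^-1 * d.
Proof. by move=> h; rewrite /Dq derive1E (@derive_val _ _ _ _ _ _ _ h). Qed.

Lemma cd_derivable f t d : cd f t d -> derivable f t 1.
Proof. by move=> h; exact: (@ex_derive _ _ _ _ _ _ _ h). Qed.

Lemma derivable_cd f t : derivable f t 1 -> cd f t (two_pi_i R * Dq f t).
Proof.
move=> h; rewrite /Dq mulrA mulfV ?two_pi_i_neq0 // mul1r derive1E.
exact: derivableP.
Qed.

Lemma cd_uniq f t d e : cd f t d -> cd f t e -> d = e.
Proof.
move=> h1 h2; have := cd_Dq h1; rewrite (cd_Dq h2).
by move/(mulfI (invr_neq0 (two_pi_i_neq0 R))).
Qed.

Lemma cd_cst a t : cd (fun=> a) t 0. Proof. exact: is_derive_cst. Qed.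
Lemma cd_id t : cd id t 1. Proof. exact: is_derive_id. Qed.
Lemma cdD f g t a b : cd f t a -> cd g t b -> cd (fun z => f z + g z) t (a + b).
Proof. exact: is_deriveD. Qed.
Lemma cdN f t a : cd f t a -> cd (fun z => - f z) t (- a).
Proof. exact: is_deriveN. Qed.
Lemma cdM f g t a b : cd f t a -> cd g t b -> cd (fun z => f z * g z) t (a * g t + f t * b).
Proof.
move=> h1 h2; apply: is_derive_eq; first exact: (@is_deriveM _ _ f g t 1 a b h1 h2).
by rewrite /GRing.scale /= addrC; congr (_ + _); rewrite mulrC.
Qed.
Lemma cdZ c f t a : cd f t a -> cd (fun z => c * f z) t (c * a).
Proof. by move=> h; have := cdM (cd_cst c t) h; rewrite mul0r add0r. Qed.
Lemma cd_sum I (r : seq I) (P : pred I) (f : I -> C -> C) t (d : I -> C) :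
  (forall i, P i -> cd (f i) t (d i)) ->
  cd (fun z => \sum_(i <- r | P i) f i z) t (\sum_(i <- r | P i) d i).
Proof.
move=> h; elim: r => [|i r IH].
  rewrite big_nil (_ : (fun _ => _) = fun=> 0); first exact: cd_cst.
  by apply/funext => z; rewrite big_nil.
rewrite big_cons; case: ifP => Pi; last first.
  by rewrite (_ : (fun _ => _) = fun z => \sum_(j <- r | P j) f j z) //;
    apply/funext => z; rewrite big_cons Pi.
rewrite (_ : (fun _ => _) = fun z => f i z + \sum_(j <- r | P j) f j z).
  exact: cdD (h _ Pi) IH.
by apply/funext => z; rewrite big_cons Pi.
Qed.
Lemma cd_comp f g t a b : cd f t a -> cd g (f t) b -> cd (g \o f) t (b * a).
Proof.
exact: is_derive_comp.
Qed.
Lemma cdV f t a : f t != 0 -> cd f t a -> cd (fun z => (f z)^-1) t (- (f t) ^- 2 * a).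
Proof.
move=> f0 h; have df := cd_derivable h.
apply: is_derive_eq; first by apply: derivableP; exact: derivableV.
rewrite (deriveV f0 df); congr (_ *: _).
exact: (@derive_val _ _ _ _ _ _ _ h).
Qed.
Lemma cdX f t a n : cd f t a -> cd (fun z => f z ^+ n.+1) t (n.+1%:R * f t ^+ n * a).
Proof.
move=> h; elim: n => [|n IH].
  by rewrite expr0 mul1r mul1r.
rewrite (_ : (fun _ => _) = fun z => f z * f z ^+ n.+1).
  apply: is_derive_eq; first exact: (cdM h IH).
  by rewrite -[in RHS]natr1 exprS; ring.
by apply/funext => z; rewrite exprS.
Qed.

Lemma uhpE (t : C) : uhp t = (0 < im t) :> Prop. Proof. by []. Qed.

Lemma uhp_near t : uhp t -> \forall z \near t, uhp z.
Proof.
move=> h; apply/nbhs_normP; exists (rc (im t)) => /=.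
  by rewrite -(rmorph0 (@rc R)) rc_lt.
move=> z /=; rewrite normC_nm rc_lt => hz.
have := im_le_nm (t - z); rewrite imD imN => h2.
have {}h2 : `|im t - im z| < im t by apply: le_lt_trans hz.
by rewrite uhpE; move: h2; rewrite ltr_norml => /andP[]; lra.
Qed.

(** The half-plane is open, so agreement on it is agreement near [t]; the values elsewhere are
    arbitrary. *)
Lemma cd_ext_uhp f g t d : uhp t -> (forall z, uhp z -> f z = g z) -> cd g t d -> cd f t d.
Proof.
move=> ht h; apply: near_eq_is_derive.
by near=> z; rewrite h //; near: z; exact: uhp_near.
Unshelve. all: by end_near.
Qed.

(* The derivative of f along the segment from s to t vanishes, so the mean value
   theorem applies to the real and imaginary parts of f on that segment. *)
Lemma cd0_constant f : (forall z, uhp z -> cd f z 0) ->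
  forall s t, uhp s -> uhp t -> f s = f t.
Proof.
move=> hf s t hs ht.
pose p (x : R) := s + rc x * (t - s).
have hp (x : R) : 0 <= x <= 1 -> uhp (p x).
  move=> /andP[x0 x1]; rewrite uhpE /p !(imD, imM, imN, re_rc, im_rc).
  have -> : im s + (x * (im t - im s) + 0 * re (t - s)) = (1 - x) * im s + x * im t by ring.
  move: hs ht; rewrite !uhpE => hs ht.
  have [x2|x2] := leP x (1/2); first by rewrite ltr_wpDr // ?mulr_ge0 ?mulr_gt0 //; lra.
  by rewrite ltr_wpDl // ?mulr_ge0 ?mulr_gt0 //; lra.
have key (L : C -> R) : (forall z w, L (z - w) = L z - L w) -> (forall z, `|L z| <= nm z) ->
    L (f (p 0)) = L (f (p 1)).
  move=> LB Lnm.
  have hd (x : R) : 0 <= x <= 1 -> is_derive x (1 : R) (fun y => L (f (p y))) 0.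
    move=> hx; apply: is_derive_bound => e e0.
    have W0 : 0 < nm (t - s) + 1 by rewrite ltr_wpDl.
    have e1 : 0 < e / (nm (t - s) + 1) by rewrite divr_gt0.
    have [del del0 hdel] := cd_has_d (hf _ (hp _ hx)) e1.
    exists (del / (nm (t - s) + 1)); first by rewrite divr_gt0.
    move=> h; rewrite ltr_pdivlMr // => hh.
    rewrite mulr0 subr0 -LB.
    have pE : p (x + h) = p x + rc h * (t - s) by rewrite /p rmorphD /=; ring.
    have nh : nm (rc h * (t - s)) <= `|h| * (nm (t - s) + 1).
      by rewrite nmM nm_rc ler_wpM2l // lerDl.
    have := hdel _ (le_lt_trans nh hh); rewrite mulr0 subr0 -pE => h1.
    apply: le_trans (Lnm _) _; apply: le_trans h1 _.
    rewrite mulrAC ler_pdivrMr // -mulrA ler_wpM2l //; exact: ltW.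
  have hc : {within `[0, 1], continuous (fun y => L (f (p y)))}.
    apply: derivable_within_continuous => x; rewrite in_itv /= => /hd h.
    exact: (@ex_derive _ _ _ _ _ _ _ h).
  have hd' (x : R) : x \in `]0, 1[%R -> is_derive x (1 : R) (fun y => L (f (p y))) 0.
    by rewrite in_itv /= => /andP[/ltW a /ltW b]; apply: hd; rewrite a b.
  have [c _] := MVT_segment (@ler01 R) hd' hc.
  by rewrite mul0r => /eqP; rewrite subr_eq0 => /eqP.
have p0 : p 0 = s by rewrite /p rmorph0 mul0r addr0.
have p1 : p 1 = t by rewrite /p rmorph1 mul1r addrC subrK.
rewrite -p0 -p1; apply: ceqP; apply: key => [z w|z].
- by rewrite reD reN.
- exact: re_le_nm.
- by rewrite imD imN.
- exact: im_le_nm.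
Qed.

End Derivative.

(** * Series in powers of q *)

Section QSeries.
Variable R : realType.
Local Notation C := (Cplx R).
Implicit Types (a b : nat -> C) (h k : R) (t : C) (f g : C -> C).

Lemma le_of_eq (x y : R) : x = y -> x <= y. Proof. by move=> ->. Qed.

Lemma bounded_sums_finite (T : eqType) (b : T -> R) (s0 : seq T) : uniq s0 ->
  (forall x, 0 <= b x) -> (forall x, x \notin s0 -> b x = 0) ->
  bounded_sums b (\sum_(x <- s0) b x).
Proof.
move=> us0 b0 h s us; rewrite (bigID (fun x => x \in s0)) /= [X in _ + X]big1 ?addr0; last first.
  by move=> x /h.
rewrite -big_filter (@big_subseq _ _ b [seq x <- s | x \in s0] s0) //.
- by rewrite lerDl sumr_ge0.
- exact: filter_uniq.
- by move=> x; rewrite mem_filter => /andP[].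
Qed.

(** Absolute convergence of the power series with coefficients [a] in the open unit disc. *)
Definition disk_summable a := forall r : R, 0 < r < 1 ->
  exists K, bounded_sums (fun n => nm (a n) * r ^+ n) K.

Definition qs_sum h a f :=
  forall t, uhp t -> has_sum (fun n : nat => a n * qpow (h + n%:R) t) (f t).

(* f(tau) = q^h (c + a_1 q + a_2 q^2 + ...) on the upper half-plane. *)
Definition isQS h (c : C) f := exists a, [/\ disk_summable a, a 0%N = c & qs_sum h a f].

Definition qabs t : R := expR (- (2 * pi * im t)).

Lemma qabs_itv t : uhp t -> 0 < qabs t < 1.
Proof.
rewrite uhpE => ht; rewrite expR_gt0 expR_lt1 oppr_lt0.
by rewrite !mulr_gt0 ?pi_gt0.
Qed.

Lemma nm_qpow_nat h (n : nat) t : nm (qpow (h + n%:R) t) = nm (qpow h t) * qabs t ^+ n.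
Proof.
rewrite !nm_qpow -expRM_natr -expRD; congr expR; ring.
Qed.

Lemma disk_summable_qs h a t : uhp t -> disk_summable a ->
  summ (fun n : nat => a n * qpow (h + n%:R) t).
Proof.
move=> ht ha; have [K hK] := ha _ (qabs_itv ht).
apply: (summ_le _ (bounded_sumsZ (nm_ge0 (qpow h t)) hK)) => n.
by rewrite nmM nm_qpow_nat mulrCA.
Qed.

Lemma disk_summableD a b : disk_summable a -> disk_summable b ->
  disk_summable (fun n => a n + b n).
Proof.
move=> ha hb r hr; have [K hK] := ha _ hr; have [L hL] := hb _ hr.
exists (K + L); apply: bounded_sums_le (bounded_sumsD hK hL) => n /=.
have r0 : 0 <= r by case/andP: hr => /ltW.
by rewrite -mulrDl ler_wpM2r ?exprn_ge0 ?nmD.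
Qed.

Lemma disk_summableZ (c : C) a : disk_summable a -> disk_summable (fun n => c * a n).
Proof.
move=> ha r hr; have [K hK] := ha _ hr.
by exists (nm c * K); apply: bounded_sums_le (bounded_sumsZ (nm_ge0 c) hK) => n /=; rewrite nmM mulrA.
Qed.

(** Each of the [n] terms of [1 + t + ... + t^(n-1)] is at least [t^n], and their sum is at most
    [1/(1-t)]. *)
Lemma nat_expr_le (t : R) n : 0 <= t < 1 -> n%:R * t ^+ n <= (1 - t)^-1.
Proof.
move=> /andP[t0 t1]; have t10 : 0 < 1 - t by rewrite subr_gt0.
apply: (@le_trans _ _ (\sum_(k < n) t ^+ k)).
  rewrite mulr_natl -[n in X in _ *+ X]card_ord -sumr_const; apply: ler_sum => k _.
  by apply: ler_wiXn2l; [| exact: ltW | exact: ltnW (ltn_ord k)].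
have := subrX1 t n => E.
rewrite -[leRHS]mul1r ler_pdivlMr //.
have -> : (\sum_(k < n) t ^+ k) * (1 - t) = 1 - t ^+ n by rewrite -[RHS]opprB E; ring.
by rewrite lerBlDr lerDl exprn_ge0.
Qed.

Lemma disk_summable_nat a : disk_summable a -> disk_summable (fun n => n%:R * a n).
Proof.
move=> ha r /andP[r0 r1].
(* With [s] strictly between [r] and 1, the factor [n] is absorbed by [(r / s)^n] and the rest
   converges at radius [s]. *)
pose s := (1 + r) / 2; have s1 : 0 < s < 1 by rewrite /s; apply/andP; split; lra.
have s0 : 0 < s by case/andP: s1.
have [K hK] := ha _ s1.
pose B := (1 - r / s)^-1.
have rs : 0 <= r / s < 1.
  by rewrite divr_ge0 ?ltW //= ltr_pdivrMr // mul1r /s; lra.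
have B0 : 0 <= B by rewrite invr_ge0 subr_ge0 ltW //; case/andP: rs.
exists (B * K); apply: bounded_sums_le (bounded_sumsZ B0 hK) => n /=.
rewrite nmM nm_nat -mulrA mulrCA [leRHS]mulrCA ler_wpM2l //.
have -> : r ^+ n = (r / s) ^+ n * s ^+ n by rewrite -exprMn divfK // gt_eqF.
rewrite mulrA; apply: ler_wpM2r; first by rewrite exprn_ge0 // ltW.
exact: nat_expr_le.
Qed.

Lemma isQS_ext h c f g : (forall t, uhp t -> f t = g t) -> isQS h c g -> isQS h c f.
Proof.
move=> fg [a [ha a0 hs]]; exists a; split=> // t ht; rewrite fg //; exact: hs.
Qed.

Lemma isQS_eq h h' c c' f : h = h' -> c = c' -> isQS h c f -> isQS h' c' f.
Proof. by move=> -> ->. Qed.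

Lemma isQSD h c d f g : isQS h c f -> isQS h d g -> isQS h (c + d) (fun t => f t + g t).
Proof.
move=> [a [ha <- hf]] [b [hb <- hg]]; exists (fun n => a n + b n); split=> //.
  exact: disk_summableD.
by move=> t ht; apply: has_sum_ext (has_sumD (hf t ht) (hg t ht)) => n; rewrite mulrDl.
Qed.

Lemma isQSZ h c d f : isQS h c f -> isQS h (d * c) (fun t => d * f t).
Proof.
move=> [a [ha <- hf]]; exists (fun n => d * a n); split=> //.
  exact: disk_summableZ.
by move=> t ht; apply: has_sum_ext (has_sumZ d (hf t ht)) => n; rewrite mulrA.
Qed.

Lemma isQS_qpow h : isQS h 1 (qpow h).
Proof.
exists (fun n => if n == 0%N then 1 else 0); split=> // [r hr|t ht].
  eexists; apply: (@bounded_sums_finite _ _ [:: 0%N]) => // [n|n].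
    by rewrite mulr_ge0 // exprn_ge0 //; case/andP: hr => /ltW.
  by rewrite inE => /negPf ->; rewrite nm0 mul0r.
have -> : qpow h t = \sum_(n <- [:: 0%N]) (if n == 0%N then 1 else 0) * qpow (h + n%:R) t.
  by rewrite big_seq1 /= mul1r addr0.
by apply: has_sum_finite => // n; rewrite inE => /negPf ->; rewrite mul0r.
Qed.

Lemma isQS_cst (c : C) : isQS 0 c (fun=> c).
Proof.
have := isQSZ c (isQS_qpow 0); rewrite mulr1; apply: isQS_ext => t _.
by rewrite qpow0 mulr1.
Qed.

Lemma isQS0 h : isQS h 0 (fun=> 0).
Proof.
have := isQSZ 0 (isQS_qpow h); rewrite mulr1; apply: isQS_ext => t _.
by rewrite mul0r.
Qed.

Definition conv a b (n : nat) : C := \sum_(0 <= k < n.+1) a k * b (n - k)%N.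

Lemma has_sum_conv_fiber (u v : nat -> C) (n : nat) :
  has_sum (fun x : nat * nat => if (x.1 + x.2 == n)%N then u x.1 * v x.2 else 0)
   (conv u v n).
Proof.
pose s := [seq (l, (n - l)%N) | l <- index_iota 0 n.+1].
have us : uniq s.
  by rewrite map_inj_in_uniq ?iota_uniq // => x y _ _ [].
have -> : conv u v n = \sum_(x <- s) (if (x.1 + x.2 == n)%N then u x.1 * v x.2 else 0).
  rewrite /conv big_map big_seq [RHS]big_seq; apply: eq_bigr => k.
  by rewrite mem_index_iota /= ltnS => kn; rewrite subnKC // eqxx.
apply: has_sum_finite => // -[x y] /=; case: eqP => // xy /negP[].
apply/mapP; exists x; first by rewrite mem_index_iota /= ltnS -xy leq_addr.
by rewrite -xy addKn.
Qed.

Lemma bounded_sums_conv a b (r K L : R) : 0 <= r ->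
  bounded_sums (fun n => nm (a n) * r ^+ n) K ->
  bounded_sums (fun n => nm (b n) * r ^+ n) L ->
  bounded_sums (fun n => nm (conv a b n) * r ^+ n) (K * L).
Proof.
move=> r0 hK hL.
pose u n := a n * rc (r ^+ n); pose v n := b n * rc (r ^+ n).
have nE (w : nat -> C) n : nm (w n * rc (r ^+ n)) = nm (w n) * r ^+ n.
  by rewrite nmM nm_rc ger0_norm ?exprn_ge0.
have hu : bounded_sums (fun n => nm (u n)) K.
  by apply: bounded_sums_le hK => n; rewrite /u nE.
have hv : bounded_sums (fun n => nm (v n)) L.
  by apply: bounded_sums_le hL => n; rewrite /v nE.
have huv : bounded_sums (fun x : nat * nat => nm (u x.1 * v x.2)) (K * L).
  apply: bounded_sums_le (bounded_sums_prod _ _ hu hv) => [x|x|x] //.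
  by rewrite nmM.
apply: bounded_sums_le (bounded_sums_fibers huv (has_sum_conv_fiber u v)) => n.
suff -> : conv u v n = conv a b n * rc (r ^+ n) by rewrite nE.
rewrite /conv mulr_suml big_seq [RHS]big_seq; apply: eq_bigr => k.
rewrite mem_index_iota /= ltnS => kn.
have E : r ^+ n = r ^+ k * r ^+ (n - k) by rewrite -exprD subnKC.
by rewrite E rmorphM /= /u /v; ring.
Qed.

Lemma disk_summable_conv a b : disk_summable a -> disk_summable b -> disk_summable (conv a b).
Proof.
move=> ha hb r hr; have [K hK] := ha _ hr; have [L hL] := hb _ hr.
by exists (K * L); apply: bounded_sums_conv => //; case/andP: hr => /ltW.
Qed.

Lemma qs_sumM h k a b f g : disk_summable a -> disk_summable b ->
  qs_sum h a f -> qs_sum k b g -> qs_sum (h + k) (conv a b) (fun t => f t * g t).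
Proof.
move=> ha hb hf hg t ht.
have sa := disk_summable_qs h ht ha; have sb := disk_summable_qs k ht hb.
have h1 := has_sum_prod sa sb (hf t ht) (hg t ht).
pose u (n : nat) := a n * qpow (h + n%:R) t; pose v (n : nat) := b n * qpow (k + n%:R) t.
apply: has_sum_ext (has_sum_fibers (has_sum_conv_fiber u v) h1) => n.
rewrite /conv mulr_suml big_seq [RHS]big_seq; apply: eq_bigr => l.
rewrite mem_index_iota /= ltnS => ln.
have -> : h + k + n%:R = (h + l%:R) + (k + (n - l)%:R).
  by rewrite -[in LHS](subnKC ln) natrD; ring.
by rewrite (qpowD (h + l%:R)) /u /v; ring.
Qed.

Lemma isQSM h k c d f g : isQS h c f -> isQS k d g -> isQS (h + k) (c * d) (fun t => f t * g t).
Proof.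
move=> [a [ha <- hf]] [b [hb <- hg]]; exists (conv a b); split.
- exact: disk_summable_conv.
- by rewrite /conv big_nat1.
- exact: qs_sumM.
Qed.

Lemma isQS_sum h I (r : seq I) (P : pred I) (c : I -> C) (f : I -> C -> C) :
  (forall i, P i -> isQS h (c i) (f i)) ->
  isQS h (\sum_(i <- r | P i) c i) (fun t => \sum_(i <- r | P i) f i t).
Proof.
move=> H; elim: r => [|i r IH].
  by rewrite big_nil; apply: isQS_ext (isQS0 h) => t _; rewrite big_nil.
rewrite big_cons; case: ifP => Pi.
  by apply: isQS_ext (isQSD (H _ Pi) IH) => t _; rewrite big_cons Pi.
by apply: isQS_ext IH => t _; rewrite big_cons Pi.
Qed.

Lemma isQS_prod I (r : seq I) (P : pred I) (h : I -> R) (c : I -> C) (f : I -> C -> C) :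
  (forall i, P i -> isQS (h i) (c i) (f i)) ->
  isQS (\sum_(i <- r | P i) h i) (\prod_(i <- r | P i) c i)
    (fun t => \prod_(i <- r | P i) f i t).
Proof.
move=> H; elim: r => [|i r IH].
  by rewrite !big_nil; apply: isQS_ext (isQS_cst 1) => t _; rewrite big_nil.
rewrite !big_cons; case: ifP => Pi.
  by apply: isQS_ext (isQSM (H _ Pi) IH) => t _; rewrite big_cons Pi.
by apply: isQS_ext IH => t _; rewrite big_cons Pi.
Qed.

Lemma isQSX h c f n : isQS h c f -> isQS (h *+ n) (c ^+ n) (fun t => f t ^+ n).
Proof.
move=> hf; elim: n => [|n IH]; first exact: isQS_cst.
by rewrite mulrS exprS; apply: isQS_ext (isQSM hf IH) => t _; rewrite exprS.
Qed.

(** Termwise differentiation. The remainder of the n-th term is [a n q^(h+n) (cexp w - 1 - w)] and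
    is quadratic in the increment. For an increment below [im t / 2] the growth of [cexp w] uses up
    at most half of the decay of [q^n], up to a factor depending on [h] only, and leaves a series
    that converges at radius [r = expR (- (pi * y))]. *)
Lemma isQS_cd h c f : isQS h c f -> exists2 g : C -> C, isQS h (rc h * c) g &
  forall t, uhp t -> cd f t (two_pi_i R * g t).
Proof.
move=> [a [ha <- hf]].
pose lam (n : nat) : R := h + n%:R.
have hla b : disk_summable b -> disk_summable (fun n => rc (lam n) * b n).
  move=> hb; have := disk_summableD (disk_summableZ (rc h) hb) (disk_summable_nat hb).
  congr disk_summable; apply/funext => n.
  by rewrite /lam rmorphD rmorph_nat /= mulrDl.
have ha1 := hla _ ha; have ha2 := hla _ ha1.
pose a1 n := rc (lam n) * a n.
pose g t := tsum (fun n : nat => a1 n * qpow (h + n%:R) t).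
have hg : qs_sum h a1 g by move=> t ht; apply: tsumP; exact: disk_summable_qs.
exists g; first by exists a1; split=> //; rewrite /a1 /lam addr0.
move=> t ht; apply: has_d_cd.
pose y := im t; have y0 : 0 < y by [].
pose r := expR (- (pi * y)).
have r01 : 0 < r < 1.
  by rewrite expR_gt0 expR_lt1 oppr_lt0 mulr_gt0 ?pi_gt0.
have [K hK] := ha2 _ r01.
pose B := 4 * (2 * pi) ^+ 2 * (nm (qpow h t) * expR (pi * y * `|h|)).
apply: (@has_d_quad _ _ _ _ (B * K) (y / 2)); first by rewrite divr_gt0.
move=> d hd.
have htd : uhp (t + d).
  rewrite uhpE imD -/y; have := im_le_nm d; rewrite ler_norml => /andP[h1 _]; lra.
pose w n := two_pi_i R * rc (lam n) * d.
have S1 := hf _ htd; have S2 := hf _ ht; have S3 := hg _ ht.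
have S4 := has_sumD (has_sumD S1 (has_sumZ (-1) S2)) (has_sumZ (- (d * two_pi_i R)) S3).
have -> : f (t + d) - f t - d * (two_pi_i R * g t) =
    f (t + d) + -1 * f t + - (d * two_pi_i R) * g t by ring.
have tE n : a n * qpow (h + n%:R) (t + d) + -1 * (a n * qpow (h + n%:R) t) +
   - (d * two_pi_i R) * (a1 n * qpow (h + n%:R) t) =
   a n * qpow (h + n%:R) t * (cexp (w n) - 1 - w n).
  have -> : qpow (h + n%:R) (t + d) = qpow (h + n%:R) t * cexp (w n).
    by rewrite !qpowE -cexpD; congr cexp; rewrite /w /lam; ring.
  by rewrite /a1 /w; ring.
have := has_sum_ext tE S4; move/has_sum_le; apply.
have B0 : 0 <= B * nm d ^+ 2.
  have p0 := @pi_ge0 R; apply: mulr_ge0; last exact: sqr_ge0.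
  apply: mulr_ge0; last by rewrite mulr_ge0 ?expR_ge0.
  by rewrite mulr_ge0 ?sqr_ge0.
rewrite mulrAC; apply: bounded_sums_le (bounded_sumsZ B0 hK) => n /=.
have nw : nm (w n) = 2 * pi * `|lam n| * nm d.
  rewrite /w !nmM two_pi_iE nmM nm_ii mulr1 !nm_rc ger0_norm //.
  by rewrite mulr_ge0 ?pi_ge0.
have hE : expR (nm (w n)) <= expR (pi * y * `|h|) * expR (pi * y) ^+ n.
  rewrite -expRM_natr -expRD ler_expR nw.
  have h1 : `|lam n| <= `|h| + n%:R.
    by apply: (le_trans (ler_normD _ _)); rewrite normr_nat.
  have h2 := ltW hd; have h3 := @pi_ge0 R; have h4 := nm_ge0 d.
  have h5 : `|lam n| * nm d <= (`|h| + n%:R) * (y / 2) by apply: ler_pM.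
  have -> : 2 * pi * `|lam n| * nm d = 2 * pi * (`|lam n| * nm d) by ring.
  apply: (@le_trans _ _ (2 * pi * ((`|h| + n%:R) * (y / 2)))); last by apply: le_of_eq; field.
  by rewrite ler_wpM2l // mulr_ge0.
have rE : qabs t ^+ n * expR (pi * y) ^+ n = r ^+ n.
  by rewrite -exprMn /qabs -expRD /r; congr (expR _ ^+ _); rewrite -/y; ring.
rewrite !nmM nm_qpow_nat !nm_rc.
apply: (@le_trans _ _ (nm (a n) * (nm (qpow h t) * qabs t ^+ n) *
   (4 * nm (w n) ^+ 2 * (expR (pi * y * `|h|) * expR (pi * y) ^+ n)))).
  rewrite ler_wpM2l ?mulr_ge0 ?exprn_ge0 ?expR_ge0 //.
  apply: (le_trans (cexp_sub1z_le _)); rewrite ler_wpM2l // mulr_ge0 // exprn_ge0 //.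
by rewrite -rE nw /B; apply: le_of_eq; ring.
Qed.

Lemma isQS_Dq h c f : isQS h c f -> isQS h (rc h * c) (Dq f).
Proof.
move=> /isQS_cd[g hg hd]; apply: isQS_ext hg => t ht.
by rewrite (cd_Dq (hd _ ht)) mulrA mulVf ?mul1r // two_pi_i_neq0.
Qed.

Lemma isQS_derivable h c f t : isQS h c f -> uhp t -> cd f t (two_pi_i R * Dq f t).
Proof.
move=> /isQS_cd[g hg hd] ht; have := hd _ ht; rewrite (cd_Dq (hd _ ht)).
by rewrite !mulrA mulfV ?mul1r // two_pi_i_neq0.
Qed.

Lemma isQS_iter_Dq h c f j : isQS h c f -> isQS h (rc h ^+ j * c) (iter j (@Dq R) f).
Proof.
move=> hf; elim: j => [|j IH]; first by rewrite expr0 mul1r.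
by rewrite iterS exprS -mulrA; apply: isQS_Dq.
Qed.

Lemma nm_qpow1 t : nm (qpow 1 t) = qabs t.
Proof. by rewrite nm_qpow mulr1. Qed.

Lemma uhp_shift t (x : R) : uhp t -> uhp (t + rc x).
Proof. by rewrite !uhpE imD im_rc addr0. Qed.

Lemma isQS_shift h c f t : isQS h c f -> uhp t -> f (t + 1) = ez h * f t.
Proof.
move=> [a [ha _ hf]] ht.
have ht1 : uhp (t + 1) by rewrite -(rmorph1 (@rc R)); exact: uhp_shift.
apply: (has_sum_uniq (hf _ ht1)).
apply: has_sum_ext (has_sumZ (ez h) (hf _ ht)) => n.
rewrite -[t + 1]/(t + 1) -(rmorph1 (@rc R)) qpow_shift mulr1 -/(ez _) ezD.
by rewrite -[n%:R]/(n%:Z%:~R) ez_int; ring.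
Qed.

(* Averaging f over the translates by j/M isolates the coefficients whose index
   is congruent to n modulo M. *)
Lemma cauchy_estimate a f (y B : R) : disk_summable a -> qs_sum 0 a f -> 0 < y ->
  (forall t, im t = y -> nm (f t) <= B) ->
  forall n, nm (a n) * expR (- (2 * pi * y)) ^+ n <= B.
Proof.
move=> ha hf y0 hB n.
pose t : C := ii R * rc y.
have ty : im t = y by rewrite imM re_ii im_ii re_rc im_rc; ring.
have ht : uhp t by rewrite uhpE ty.
have -> : expR (- (2 * pi * y)) = qabs t by rewrite /qabs ty.
pose avg (M : nat) (l : nat) : C := M.+1%:R^-1 * \sum_(j < M.+1) ez ((l%:R - n%:R) * j%:R / M.+1%:R).
pose u M (l : nat) : C := a l * qpow (0 + l%:R) t * avg M l.
pose w (l : nat) : C := if l == n then a n * qpow (0 + n%:R) t else 0.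
have tw : tsum w = a n * qpow (0 + n%:R) t.
  apply: has_sum_tsum.
  have -> : a n * qpow (0 + n%:R) t = \sum_(l <- [:: n]) w l by rewrite big_seq1 /w eqxx.
  by apply: has_sum_finite => // l; rewrite inE /w => /negPf ->.
have [K hK] := disk_summable_qs 0 ht ha.
have lim : is_lim (fun M => tsum (u M)) (tsum w).
  apply: (tannery hK) => [M l|l].
    rewrite /u nmM -[leRHS]mulr1 ler_wpM2l //.
    exact: nm_ez_avg.
  have [ln|ln] := eqVneq l n.
    rewrite /w ln eqxx; apply: is_lim_ext (is_lim_cst _) => M.
    rewrite /u /avg subrr; under eq_bigr => j _ do rewrite !mul0r ez0.
    by rewrite sumr_const card_ord mulVf ?mulr1 // pnatr_eq0.
  (* Once [M >= l + n], the nonzero number [l - n] is smaller in absolute value than [M + 1], so its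
     average over the roots of unity is exactly 0. *)
  rewrite /w (negPf ln) => e e0; exists (l + n)%N => M hM.
  rewrite subr0 /u /avg.
  have := @ez_root_sum R M.+1 (l%:Z - n%:Z) isT.
  rewrite rmorphB /= => ->.
  rewrite ifF ?mulr0 ?nm0 //; apply/negP => /dvdzP[z hz].
  have : (`|l%:Z - n%:Z| < M.+1)%N by lia.
  have : (`|l%:Z - n%:Z| = `|z| * M.+1)%N by rewrite hz abszM.
  have : (`|z| != 0)%N.
    by rewrite absz_eq0; apply: contra_neq ln => z0; move: hz; rewrite z0 mul0r; lia.
  nia.
rewrite -[qabs t ^+ n]mul1r -nm1 -(qpow0 t) -nm_qpow_nat -nmM -tw.
apply: (is_lim_nm_le _ lim) => M.
have hsum : has_sum (u M) (M.+1%:R^-1 * \sum_(j < M.+1)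
    ez (- n%:R * j%:R / M.+1%:R) * f (t + rc (j%:R / M.+1%:R))).
  have h1 (j : 'I_M.+1) : has_sum (fun l : nat => ez (- n%:R * j%:R / M.+1%:R) *
       (a l * qpow (0 + l%:R) (t + rc (j%:R / M.+1%:R))))
       (ez (- n%:R * j%:R / M.+1%:R) * f (t + rc (j%:R / M.+1%:R))).
    by apply: has_sumZ; apply: hf; exact: uhp_shift.
  have := has_sumZ M.+1%:R^-1 (@has_sum_big _ _ _ (index_enum _) predT _ _ (fun j _ => h1 j)).
  apply: has_sum_ext => l; rewrite /u /avg [RHS]mulrCA; congr (_ * _).
  rewrite [RHS]mulr_sumr; apply: eq_bigr => j _.
  rewrite qpow_shift -/(ez _).
  have -> : (l%:R - n%:R) * j%:R / M.+1%:R =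
     - n%:R * j%:R / M.+1%:R + (0 + l%:R) * (j%:R / M.+1%:R) :> R by ring.
  by rewrite ezD; ring.
rewrite (has_sum_tsum hsum) nmM nmV nm_nat mulrC ler_pdivrMr ?ltr0n //.
apply: (le_trans (nm_sum _ _ _)).
apply: (@le_trans _ _ (\sum_(j < M.+1) B)).
  apply: ler_sum => j _; rewrite nmM nm_ez mul1r; apply: hB.
  by rewrite imD im_rc addr0.
by rewrite sumr_const card_ord mulr_natr.
Qed.

(** The Cauchy estimate at height 1 with the bound 0. *)
Lemma qs_coef_eq0 a f : disk_summable a -> qs_sum 0 a f ->
  (forall t, uhp t -> f t = 0) -> forall n, a n = 0.
Proof.
move=> ha hf h0 n.
have := @cauchy_estimate a f 1 0 ha hf ltr01.
have hB t : im t = 1 -> nm (f t) <= 0 by move=> ht; rewrite h0 ?nm0 // uhpE ht.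
move=> /(_ hB n); rewrite pmulr_lle0 ?exprn_gt0 ?expR_gt0 // => h.
by apply/eqP; rewrite -nm_eq0 eq_le h nm_ge0.
Qed.

End QSeries.

(** * The eta-function *)

(* Shanks' finite form of Euler's pentagonal number theorem. *)
Section Shanks.
Variables (A : comRingType) (q : A).

Definition euler_tail (s n : nat) : A := \prod_(s <= k < n) (1 - q ^+ k.+1).
Definition tri (s : nat) := 'C(s.+1, 2).
Definition shanks_sum (n : nat) : A :=
  \sum_(0 <= s < n.+1) (-1) ^+ s * euler_tail s n * q ^+ (s * n + tri s).

Lemma triS s : tri s.+1 = (tri s + s.+1)%N.
Proof. by rewrite /tri binS bin1. Qed.

Lemma euler_tail_id n : euler_tail n n = 1.
Proof. by rewrite /euler_tail big_geq. Qed.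

Lemma euler_tailSr s n : (s <= n)%N -> euler_tail s n.+1 = euler_tail s n * (1 - q ^+ n.+1).
Proof. by move=> sn; rewrite /euler_tail big_nat_recr. Qed.

Lemma euler_tailSl s n : (s < n)%N -> euler_tail s n = (1 - q ^+ s.+1) * euler_tail s.+1 n.
Proof. by move=> sn; rewrite /euler_tail big_ltn. Qed.

Lemma tri2 s : (tri s * 2 = s.+1 * s)%N.
Proof. by elim: s => [|s IH] //; rewrite triS mulnDl IH; lia. Qed.

Lemma shanks_sumS n : shanks_sum n.+1 = shanks_sum n +
  (-1) ^+ n.+1 * (q ^+ (n.+1 * n + tri n.+1) + q ^+ (n.+1 * n.+1 + tri n.+1)).
Proof.
(* For [s <= n], passing from [n] to [n + 1] changes the s-th summand by [g s.+1 - g s]. As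
   [g 0 = 0], only [g n.+1] survives; the new summand [s = n + 1] supplies the other power of
   [q]. *)
pose g s : A := if s is s'.+1 then (-1) ^+ s * euler_tail s' n * q ^+ (s * n + tri s) else 0.
rewrite {1}/shanks_sum big_nat_recr //= euler_tail_id mulr1.
rewrite [RHS](_ : _ = shanks_sum n + (-1) ^+ n.+1 * q ^+ (n.+1 * n + tri n.+1)
  + (-1) ^+ n.+1 * q ^+ (n.+1 * n.+1 + tri n.+1)); last by ring.
congr (_ + _).
have -> : (-1) ^+ n.+1 * q ^+ (n.+1 * n + tri n.+1) = \sum_(0 <= s < n.+1) (g s.+1 - g s).
  by rewrite telescope_sumr // subr0 /g euler_tail_id mulr1.
rewrite /shanks_sum -big_split /=; apply: eq_big_nat => s /andP[_ sn].
rewrite euler_tailSr // mulnS.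
case: s sn => [|s] sn.
  rewrite /g !mul0n mul1n /tri /= !add0n !expr0 expr1.
  have -> : 'C(2, 2) = 1%N by [].
  by rewrite addn1 subr0; ring.
rewrite /g (euler_tailSl (sn : (s < n)%N)) !triS !mulSn.
set a := (s * n)%N; set E := euler_tail _ _; set T := tri s.
rewrite (_ : (s.+1 + (n + a) + (T + s.+1) = (n + a + (T + s.+1)) + s.+1)%N); last lia.
rewrite (_ : (n + (n + a) + (T + s.+1 + s.+2) = (n + a + (T + s.+1)) + (n.+1 + s.+1))%N); last lia.
rewrite (exprD q _ s.+1) (exprD q _ (n.+1 + s.+1)) (exprD q n.+1) !(exprS (-1)).
by ring.
Qed.

(** The summand [s = 0] is the truncated Euler product. It is set apart because the other summands
    contain [q^(s n)] and disappear in the limit. *)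
Lemma shanksE n : euler_tail 0 n + \sum_(1 <= s < n.+1) (-1) ^+ s * euler_tail s n * q ^+ (s * n + tri s)
 = 1 + \sum_(0 <= s < n) (-1) ^+ s.+1 * (q ^+ (s.+1 * s + tri s.+1) + q ^+ (s.+1 * s.+1 + tri s.+1)).
Proof.
have -> : euler_tail 0 n + \sum_(1 <= s < n.+1) (-1) ^+ s * euler_tail s n * q ^+ (s * n + tri s)
   = shanks_sum n.
  by rewrite /shanks_sum [RHS]big_ltn // expr0 mul1r mul0n add0n /tri /= expr0 mulr1.
elim: n => [|n IH].
  by rewrite /shanks_sum big_nat1 big_geq // addr0 euler_tail_id !mul1r mul0n /tri /= expr0.
by rewrite shanks_sumS IH big_nat_recr //= addrA.
Qed.

End Shanks.

Section Eta.
Variable R : realType.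
Local Notation C := (Cplx R).
Implicit Types (t : C).

Definition euler (t : C) : nat -> C := euler_tail (qpow 1 t) 0.

Local Notation eta := (@Defs.eta R).

Lemma etaE t : eta t = qpow 24^-1 t * limn (euler t).
Proof.
rewrite /eta; have -> // : euler t = (fun N => \prod_(1 <= n < N.+1) (1 - qpow 1 t ^+ n)).
by apply/funext => N; rewrite /euler /euler_tail big_add1.
Qed.

Lemma expr_sum_le (r : R) s n : 0 < r < 1 -> \sum_(s <= k < n) r ^+ k.+1 <= (1 - r)^-1.
Proof.
move=> /andP[r0 r1]; have r10 : 0 < 1 - r by rewrite subr_gt0.
apply: (@le_trans _ _ (\sum_(0 <= k < n) r ^+ k)).
  have [sn|sn] := leqP n s; first by rewrite big_geq // sumr_ge0 // => k _; rewrite exprn_ge0 // ltW.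
  rewrite (@big_cat_nat _ _ _ s 0 n) // 1?ltnW //= -[leLHS]add0r lerD //.
    by rewrite sumr_ge0 // => k _; rewrite exprn_ge0 // ltW.
  by apply: ler_sum => k _; rewrite exprS ler_piMl ?exprn_ge0 // ltW.
rewrite big_mkord -[leRHS]mul1r ler_pdivlMr //.
have -> : (\sum_(k < n) r ^+ k) * (1 - r) = 1 - r ^+ n.
  by have := subrX1 r n => E; rewrite -[RHS]opprB E; ring.
by rewrite lerBlDr lerDl exprn_ge0 // ltW.
Qed.

Lemma nm_euler_tail t s n : uhp t ->
  nm (euler_tail (qpow 1 t) s n) <= expR ((1 - qabs t)^-1).
Proof.
move=> ht; rewrite /euler_tail nm_prod.
apply: (@le_trans _ _ (\prod_(s <= k < n) expR (qabs t ^+ k.+1))).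
  apply: ler_prod => k _; rewrite nm_ge0 /=.
  apply: (le_trans (nmB _ _)); rewrite nm1 nmX nm_qpow1; exact: expR_ge1Dx.
by rewrite -expR_sum ler_expR; apply: expr_sum_le; exact: qabs_itv.
Qed.

(** The pentagonal exponent with the square completed: [1/24 + n(3n+1)/2 = (6n+1)^2/24]. *)
Definition pent_term t (n : int) : C := (-1) ^+ `|n|%N * qpow ((6 * n%:~R + 1) ^+ 2 / 24) t.

Lemma pent_pos t (n : nat) :
  pent_term t n = qpow 24^-1 t * ((-1) ^+ n * qpow 1 t ^+ (n * n + tri n)).
Proof.
rewrite /pent_term.
have -> : (6 * n%:~R + 1) ^+ 2 / 24 = 24^-1 + (n * n + tri n)%:R :> R.
  have h2 : (tri n)%:R = (n%:R + 1) * n%:R / 2 :> R.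
    by rewrite natr1 -natrM -tri2 natrM mulfK.
  by rewrite natrD natrM h2 -pmulrn; field.
by rewrite qpowD qpow_nat mulrCA.
Qed.

Lemma pent_neg t (n : nat) :
  pent_term t (Negz n) = qpow 24^-1 t * ((-1) ^+ n.+1 * qpow 1 t ^+ (n.+1 * n + tri n.+1)).
Proof.
rewrite /pent_term.
have -> : (6 * (Negz n)%:~R + 1) ^+ 2 / 24 = 24^-1 + (n.+1 * n + tri n.+1)%:R :> R.
  have h2 : (tri n.+1)%:R = (n%:R + 2) * (n%:R + 1) / 2 :> R.
    by rewrite natr1 -natrD -natrM addn2 -tri2 natrM mulfK.
  by rewrite NegzE natrD natrM h2 mulrNz -pmulrn -natr1; field.
by rewrite qpowD qpow_nat mulrCA.
Qed.

Lemma bounded_sums_geom (r : R) : 0 < r < 1 -> bounded_sums (fun n : nat => r ^+ n) (1 - r)^-1.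
Proof.
move=> /andP[r0 r1]; have r10 : 0 < 1 - r by rewrite subr_gt0.
apply: bounded_sums_nat => n; first by rewrite exprn_ge0 // ltW.
rewrite big_mkord -[leRHS]mul1r ler_pdivlMr //.
have -> : (\sum_(k < n) r ^+ k) * (1 - r) = 1 - r ^+ n.
  by have := subrX1 r n => E; rewrite -[RHS]opprB E; ring.
by rewrite lerBlDr lerDl exprn_ge0 // ltW.
Qed.

Lemma expr_small (r e : R) : 0 < r < 1 -> 0 < e -> exists N, forall n, (N <= n)%N -> r ^+ n < e.
Proof.
move=> r01 e0; have [r0 r1] := andP r01.
have K0 : 0 < (1 - r)^-1 by rewrite invr_gt0 subr_gt0.
pose N := (Num.bound ((1 - r)^-1 / e)).+1; exists N => n hn.
have hb : (1 - r)^-1 / e < n%:R.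
  apply: (lt_le_trans (archi_boundP _)); first by rewrite ltW // divr_gt0.
  by rewrite ler_nat (leq_trans _ hn).
have n0 : 0 < n%:R :> R by rewrite ltr0n (leq_trans _ hn).
have h : n%:R * r ^+ n <= (1 - r)^-1 by apply: nat_expr_le; rewrite r1 ltW.
rewrite ltr_pdivrMr // in hb.
by rewrite -(ltr_pM2l n0); apply: le_lt_trans h _.
Qed.

Lemma tri_ge s : (s <= tri s)%N.
Proof. by elim: s => [|s IH] //; rewrite triS; lia. Qed.

Lemma summ_pent t : uhp t -> summ (pent_term t).
Proof.
move=> ht; have r01 := qabs_itv ht; have [r0 r1] := andP r01.
pose c := nm (qpow 24^-1 t).
have hb := bounded_sumsZ (nm_ge0 (qpow 24^-1 t)) (bounded_sums_geom r01).
exists (c * (1 - qabs t)^-1 + c * (1 - qabs t)^-1).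
apply: bounded_sums_int; apply: bounded_sums_le hb => n.
  rewrite pent_pos !nmM !nmX nmN nm1 expr1n mul1r nm_qpow1 ler_wpM2l //.
  by apply: ler_wiXn2l; [exact: ltW|exact: ltW|have := tri_ge n; lia].
rewrite pent_neg !nmM !nmX nmN nm1 expr1n mul1r nm_qpow1 ler_wpM2l //.
by apply: ler_wiXn2l; [exact: ltW|exact: ltW|have := tri_ge n.+1; lia].
Qed.

Lemma pent_partial_sum t n : qpow 24^-1 t * (euler t n +
    \sum_(1 <= s < n.+1) (-1) ^+ s * euler_tail (qpow 1 t) s n * qpow 1 t ^+ (s * n + tri s)) =
  \sum_(0 <= k < n.+1) pent_term t k + \sum_(0 <= k < n) pent_term t (Negz k).
Proof.
rewrite shanksE mulrDr mulr1 [in RHS]big_ltn // -addrA pent_pos.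
have -> : (0 * 0 + tri 0)%N = 0%N by [].
rewrite !expr0 !mulr1; congr (_ + _).
rewrite big_add1 /= -big_split /= mulr_sumr; apply: eq_bigr => k _.
rewrite pent_pos pent_neg; ring.
Qed.

(** By [pent_partial_sum] the truncated product differs from a partial sum of the pentagonal series
    by [E n]. Since [s n + tri s >= n + s] for [s >= 1], this error is at most a constant times
    [qabs t ^+ n]. *)
Lemma euler_is_lim t : uhp t -> is_lim (fun n => qpow 24^-1 t * euler t n) (tsum (pent_term t)).
Proof.
move=> ht; have r01 := qabs_itv ht; have [r0 r1] := andP r01.
have su := summ_pent ht.
have [S1 h1] := summ_has_sum (summ_inj posz_inj su).
have [S2 h2] := summ_has_sum (summ_inj negz_inj su).
have lim1 : is_lim (fun n => \sum_(0 <= k < n.+1) pent_term t k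
   + \sum_(0 <= k < n) pent_term t (Negz k)) (S1 + S2).
  apply: is_limD; last exact: has_sum_series h2.
  exact: (is_lim_sub leqnSn (has_sum_series h1)).
have -> : tsum (pent_term t) = S1 + S2.
  have := has_sum_sumZ su (tsumP su) => <-; rewrite /sumZ; congr (_ + _); apply: is_lim_limn.
    exact: has_sum_series h1.
  apply: is_lim_ext (has_sum_series h2) => n.
  by apply: eq_bigr => k _; rewrite /= NegzE.
pose E n := \sum_(1 <= s < n.+1) (-1) ^+ s * euler_tail (qpow 1 t) s n * qpow 1 t ^+ (s * n + tri s).
have lim2 : is_lim (fun n => - qpow 24^-1 t * E n) 0.
  rewrite -(mulr0 (- qpow 24^-1 t)); apply: is_limM; first exact: is_lim_cst.
  move=> e e0; pose B := expR ((1 - qabs t)^-1) * (1 - qabs t)^-1.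
  have B0 : 0 < B by rewrite mulr_gt0 ?expR_gt0 // invr_gt0 subr_gt0.
  have [N hN] := expr_small r01 (divr_gt0 e0 B0); exists N => n /hN.
  rewrite ltr_pdivlMr // subr0 => h; apply: le_lt_trans h.
  apply: (le_trans (nm_sum _ _ _)).
  apply: (@le_trans _ _ (\sum_(1 <= s < n.+1) expR ((1 - qabs t)^-1) * (qabs t ^+ n * qabs t ^+ s))).
    rewrite big_nat [leRHS]big_nat; apply: ler_sum => s /andP[s1 _].
    rewrite !nmM !nmX nmN nm1 expr1n mul1r nm_qpow1.
    apply: ler_pM => //; first by rewrite exprn_ge0 // ltW.
      exact: nm_euler_tail.
    rewrite -exprD; apply: ler_wiXn2l; [exact: ltW|exact: ltW|].
    have := tri_ge s; nia.
  rewrite -mulr_sumr -mulr_sumr mulrCA /B ler_wpM2l ?exprn_ge0 ?(ltW r0) //.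
  rewrite ler_wpM2l ?expR_ge0 // big_add1.
  exact: expr_sum_le.
have := is_limD lim1 lim2; rewrite addr0; apply: is_lim_ext => n.
rewrite -pent_partial_sum /E; ring.
Qed.

Lemma eta_has_sum t : uhp t -> has_sum (pent_term t) (eta t).
Proof.
move=> ht; have := tsumP (summ_pent ht).
suff -> : tsum (pent_term t) = eta t by [].
have h := is_limM (is_lim_cst (qpow 24^-1 t)^-1) (euler_is_lim ht).
rewrite etaE (is_lim_limn (l := (qpow 24^-1 t)^-1 * tsum (pent_term t))).
  by rewrite mulVKf // qpow_neq0.
apply: is_lim_ext h => n; rewrite mulKf //; exact: qpow_neq0.
Qed.

(* [part N n] counts the partitions of n into parts at most N; its generating
   function is the inverse of the truncated Euler product. *)
Fixpoint part (N n : nat) : nat :=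
  if N is N'.+1 then \sum_(0 <= k < n.+1) part N' k * (N %| n - k)%N else (n == 0%N).

Definition partc N n : C := (part N n)%:R.
(** The coefficients of [1 / (1 - q^m)]. *)
Definition geomc (m n : nat) : C := (m %| n)%:R.

Lemma partcS N n : partc N.+1 n = conv (partc N) (geomc N.+1) n.
Proof.
rewrite /partc /= /conv natr_sum; apply: eq_bigr => k _.
by rewrite natrM.
Qed.

Lemma partc00 : partc 0 0 = 1. Proof. by rewrite /partc /= mulr1n. Qed.

Lemma part_mono N n : (part N n <= part N.+1 n)%N.
Proof. by rewrite /= big_nat_recr //= subnn dvdn0 muln1 leq_addl. Qed.

Lemma part_stab N n : (n <= N)%N -> part N n = part n n.
Proof.
move=> nN; rewrite -(subnK nN); elim: (N - n)%N => [|d IH] //.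
rewrite addSn /= big_nat_recr //= subnn dvdn0 muln1 IH big1_seq ?add0n // => k.
rewrite mem_index_iota /= => kn; rewrite gtnNdvd ?muln0 //; lia.
Qed.

Lemma part_le N n : (part N n <= part n n)%N.
Proof.
have [nN|nN] := leqP n N; first by rewrite part_stab.
have h d : (part N n <= part (d + N) n)%N.
  by elim: d => [|d IH] //; exact: leq_trans IH (part_mono _ _).
by have := h (n - N)%N; rewrite subnK // ltnW.
Qed.

Lemma geomc_extend (V : nmodType) (m : nat) (u : nat -> V) n :
  (forall y, n <> (m.+1 * y)%N) -> (m.+1 %| n)%N = false.
Proof. by move=> h; apply/negP => /dvdnP[y]; rewrite mulnC; exact: h. Qed.

Lemma mulSn_inj m : injective (fun y : nat => m.+1 * y)%N.
Proof. by move=> x y /eqP; rewrite eqn_pmul2l // => /eqP. Qed.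

Lemma bounded_sums_geomc m (r : R) : 0 < r < 1 ->
  bounded_sums (fun n => nm (geomc m.+1 n) * r ^+ n) (1 - r ^+ m.+1)^-1.
Proof.
move=> /andP[r0 r1].
apply: (bounded_sums_extend (@mulSn_inj m)) => [n h|].
  by rewrite /geomc (geomc_extend (fun=> 0%N)) // nm0 mul0r.
have := @bounded_sums_geom (r ^+ m.+1); rewrite exprn_gt0 //= exprn_ilt1 ?ltW // => /(_ isT).
by apply: bounded_sums_le => n /=; rewrite /geomc dvdn_mulr // nm1 mul1r exprM.
Qed.

Lemma has_sum_geom (z : C) : nm z < 1 -> has_sum (fun n : nat => z ^+ n) (1 - z)^-1.
Proof.
move=> z1; have z0 : 1 - z != 0.
  by rewrite subr_eq0; apply: contraTneq z1 => <-; rewrite nm1 ltxx.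
have [->|zn0] := eqVneq z 0.
  have -> : (1 - 0 : C)^-1 = \sum_(n <- [:: 0%N]) 0 ^+ n by rewrite big_seq1 expr0 subr0 invr1.
  by apply: has_sum_finite => // n; rewrite inE => /negPf h; rewrite expr0n h.
have sz : summ (fun n : nat => z ^+ n).
  exists (1 - nm z)^-1; apply: bounded_sums_le (bounded_sums_geom _) => [n|]; first by rewrite nmX.
  by rewrite nm_gt0 zn0.
have [S hS] := summ_has_sum sz; rewrite (_ : (1 - z)^-1 = S) //.
have l1 : is_lim (fun n => (1 - z) * \sum_(0 <= k < n) z ^+ k) ((1 - z) * S).
  by apply: is_limM; [exact: is_lim_cst | exact: has_sum_series].
have l2 : is_lim (fun n => (1 - z) * \sum_(0 <= k < n) z ^+ k) 1.
  move=> e e0; have z01 : 0 < nm z < 1 by rewrite nm_gt0 zn0.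
  have [N hN] := expr_small z01 e0; exists N => n /hN.
  rewrite big_mkord; have := subrX1 z n => E.
  have -> : (1 - z) * \sum_(k < n) z ^+ k - 1 = - z ^+ n by rewrite -[in RHS](subrK 1 (z ^+ n)) E; ring.
  by rewrite nmN nmX.
apply: (mulfI z0); rewrite mulfV //; exact: is_lim_uniq l2 l1.
Qed.

Lemma qs_sum_geomc m t : uhp t ->
  has_sum (fun n => geomc m.+1 n * qpow (0 + n%:R) t) (1 - qpow 1 t ^+ m.+1)^-1.
Proof.
move=> ht; have [q0 q1] := andP (qabs_itv ht).
apply: (has_sum_extend (@mulSn_inj m)) => [n h|].
  by rewrite /geomc (geomc_extend (fun=> 0%N)) // mul0r.
have : nm (qpow 1 t ^+ m.+1) < 1 by rewrite nmX nm_qpow1 exprn_ilt1 // ltW.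
move/has_sum_geom; apply: has_sum_ext => n.
by rewrite /= /geomc dvdn_mulr // mul1r add0r qpow_nat exprM.
Qed.

Lemma euler_neq0 t N : uhp t -> euler t N != 0.
Proof.
move=> ht; have [q0 q1] := andP (qabs_itv ht).
rewrite /euler /euler_tail prodf_seq_neq0; apply/allP => k _ /=.
rewrite subr_eq0; apply/eqP => /(congr1 (@nm R)); rewrite nm1 nmX nm_qpow1 => h.
by have := exprn_ilt1 k.+1 (ltW q0) q1; rewrite -h ltxx.
Qed.

Lemma bounded_sums_partc N (r : R) : 0 < r < 1 ->
  bounded_sums (fun n => nm (partc N n) * r ^+ n) (\prod_(0 <= k < N) (1 - r ^+ k.+1)^-1).
Proof.
move=> r01; have r0 : 0 <= r by case/andP: r01 => /ltW.
elim: N => [|N IH].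
  rewrite big_geq //.
  have h := @bounded_sums_finite _ _ (fun n : nat => nm (partc 0 n) * r ^+ n) [:: 0%N] isT.
  have E : \sum_(x <- [:: 0%N]) nm (partc 0 x) * r ^+ x = 1 by rewrite big_seq1 partc00 nm1 mul1r.
  rewrite -[X in bounded_sums _ X]E; apply: h => [n|n].
    by rewrite mulr_ge0 // exprn_ge0.
  by rewrite inE /partc /= => /negPf ->; rewrite nm0 mul0r.
rewrite big_nat_recr //=.
apply: bounded_sums_le (bounded_sums_conv r0 IH (bounded_sums_geomc N r01)) => n.
by rewrite partcS.
Qed.

(** On finitely many indices [part n n] is [part M n], with [M] the largest of them, and is bounded
    by the finite product. From [1/(1-x) = 1 + x/(1-x) <= exp(x/(1-x))] this product has a bound
    independent of [M]. *)
Lemma partition_bound (r : R) : 0 < r < 1 ->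
  bounded_sums (fun n => nm (partc n n) * r ^+ n) (expR ((1 - r)^-1 * (1 - r)^-1)).
Proof.
move=> r01; have [r0 r1] := andP r01 => s us.
have r10 : 0 < 1 - r by rewrite subr_gt0.
pose M := \max_(n <- s) n.
have -> : \sum_(n <- s) nm (partc n n) * r ^+ n = \sum_(n <- s) nm (partc M n) * r ^+ n.
  rewrite big_seq [RHS]big_seq; apply: eq_bigr => n ns.
  by rewrite /partc (@part_stab M n) // leq_bigmax_seq.
apply: (le_trans (bounded_sums_partc M r01 us)).
apply: (@le_trans _ _ (\prod_(0 <= k < M) expR (r ^+ k.+1 * (1 - r)^-1))).
  apply: ler_prod => k _.
  have rk : r ^+ k.+1 <= r by rewrite exprS ler_piMr ?exprn_ile1 ?ltW.
  have rk0 : 0 < r ^+ k.+1 by rewrite exprn_gt0.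
  have rk1 : 0 < 1 - r ^+ k.+1 by lra.
  rewrite invr_ge0 ltW //=.
  apply: (@le_trans _ _ (expR (r ^+ k.+1 / (1 - r ^+ k.+1)))).
    rewrite [leLHS](_ : _ = 1 + r ^+ k.+1 / (1 - r ^+ k.+1)); last first.
      by field; rewrite gt_eqF.
    exact: expR_ge1Dx.
  rewrite ler_expR; apply: ler_wpM2l; first exact: ltW.
  by rewrite lef_pV2 ?posrE //; lra.
rewrite -expR_sum ler_expR -mulr_suml; apply: ler_wpM2r; first by rewrite invr_ge0 ltW.
exact: expr_sum_le.
Qed.

(** Dominated convergence: [part N n] is at most [part n n] and equals it from [N = n] on. *)
Lemma euler_inv_lim t : uhp t ->
  is_lim (fun N => (euler t N)^-1) (tsum (fun n : nat => partc n n * qpow (0 + n%:R) t)).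
Proof.
move=> ht.
have hN N : has_sum (fun n => partc N n * qpow (0 + n%:R) t) (euler t N)^-1.
  suff h : qs_sum 0 (partc N) (fun t => (euler t N)^-1) /\ disk_summable (partc N) by exact: h.1.
  elim: N => [|N [IH1 IH2]].
    split=> [t' ht'|r hr]; last by eexists; exact: bounded_sums_partc.
    have -> : (euler t' 0)^-1 = \sum_(n <- [:: 0%N]) partc 0 n * qpow (0 + n%:R) t'.
      by rewrite big_seq1 partc00 /euler euler_tail_id invr1 addr0 qpow0 mulr1.
    by apply: has_sum_finite => // n; rewrite inE /partc /= => /negPf ->; rewrite mul0r.
  split; last by move=> r hr; eexists; exact: bounded_sums_partc.
  move=> t' ht'.
  have hg : disk_summable (geomc N.+1) by move=> r hr; eexists; exact: bounded_sums_geomc.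
  have := @qs_sumM _ _ _ _ _ _ (fun t => (1 - qpow 1 t ^+ N.+1)^-1) IH2 hg IH1
     (fun t ht => @qs_sum_geomc N t ht) t' ht'.
  rewrite addr0 /euler euler_tailSr // invfM.
  by apply: has_sum_ext => n; rewrite partcS.
have := hN; move=> h.
apply: (is_lim_ext (fun N => has_sum_tsum (h N))).
pose u N (n : nat) := partc N n * qpow (0 + n%:R) t.
apply: (@tannery _ _ u _ _ _ (partition_bound (qabs_itv ht))) => [N n|n].
  rewrite /u nmM nm_qpow_nat qpow0 nm1 mul1r ler_wpM2r ?exprn_ge0 ?expR_ge0 //.
  by rewrite /partc !nm_nat ler_nat part_le.
by move=> e e0; exists n => N hnN; rewrite /u /partc (part_stab hnN) subrr nm0.
Qed.

(** The reason why eta has no zeros: nonzero truncated products could still tend to 0, but here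
    their inverses converge as well. *)
Lemma eta_mul_partition t : uhp t ->
  eta t * (qpow (- 24^-1) t * tsum (fun n : nat => partc n n * qpow (0 + n%:R) t)) = 1.
Proof.
move=> ht.
have l1 := is_limM (euler_is_lim ht) (euler_inv_lim ht).
have l2 : is_lim (fun n => qpow 24^-1 t * euler t n * (euler t n)^-1) (qpow 24^-1 t).
  by apply: is_lim_ext (is_lim_cst _) => n; rewrite mulfK // euler_neq0.
have := is_lim_uniq l1 l2; rewrite (has_sum_tsum (eta_has_sum ht)) => h.
by rewrite mulrCA h qpowN mulVf // qpow_neq0.
Qed.

Lemma eta_neq0 t : uhp t -> eta t != 0.
Proof.
move=> /eta_mul_partition h; apply/eqP => h0; move: h.
by rewrite h0 mul0r => /esym/eqP; rewrite oner_eq0.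
Qed.

Lemma isQS_eta_inv : isQS (- 24^-1) 1 (fun t => (eta t)^-1).
Proof.
have ds : disk_summable (fun n => partc n n) by move=> r hr; eexists; exact: partition_bound.
exists (fun n => partc n n); split; [exact: ds | exact: partc00 | move=> t ht].
have -> : (eta t)^-1 = qpow (- 24^-1) t * tsum (fun n : nat => partc n n * qpow (0 + n%:R) t).
  by apply: (mulfI (eta_neq0 ht)); rewrite mulfV ?eta_neq0 // eta_mul_partition.
have := has_sumZ (qpow (- 24^-1) t) (tsumP (disk_summable_qs 0 ht ds)).
by apply: has_sum_ext => n; rewrite add0r qpowD; ring.
Qed.

(** A q-series is at hand for [1 / eta], so eta is differentiated as the inverse of that
    function. *)
Lemma eta_derivable t : uhp t -> exists d, cd eta t d.
Proof.
move=> ht; have h0 := isQS_derivable isQS_eta_inv ht.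
have h := @cdV R (fun t => (eta t)^-1) t _ (invr_neq0 (eta_neq0 ht)) h0; eexists.
by apply: (cd_ext_uhp ht _ h) => z _; rewrite invrK.
Qed.

End Eta.

(** * Sums over the integers by residue classes *)

Section Residues.
Variable R : realType.
Local Notation C := (Cplx R).

Lemma has_sum_fin (T : finType) (u : T -> C) S : has_sum u S -> S = \sum_x u x.
Proof.
move=> h; apply: (has_sum_uniq h); rewrite -big_enum.
by apply: has_sum_finite => [|x]; rewrite ?enum_uniq // mem_enum.
Qed.

Lemma has_sum_residues (M : nat) (u : int -> C) (v : 'I_M.+1 -> C) S :
  has_sum u S -> (forall j : 'I_M.+1, has_sum (fun l : int => u (l * M.+1%:Z + j%:Z)) (v j)) ->
  S = \sum_j v j.
Proof.
move=> hS hv; pose f (n : int) : 'I_M.+1 := inord `|(n %% M.+1%:Z)%Z|.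
apply: has_sum_fin; apply: (has_sum_fibers (f := f)) hS => j.
have finj : injective (fun l : int => l * M.+1%:Z + j%:Z).
  by move=> x y /addIr /mulIf; apply.
have fj (l : int) : f (l * M.+1%:Z + j%:Z) = j.
  by apply/val_inj; rewrite /f /= modzMDl modz_small ?inordK ?absz_nat //= ltz_nat ltn_ord.
apply: (has_sum_extend finj) => [n h|]; last first.
  by apply: has_sum_ext (hv j) => l; rewrite /= fj eqxx.
case: eqP => // hfn; case: (h (n %/ M.+1%:Z)%Z); rewrite {1}(divz_eq n M.+1%:Z).
congr (_ + _); rewrite -hfn /f inordK.
  by rewrite gez0_abs // modz_ge0.
by rewrite -ltz_nat gez0_abs ?modz_ge0 // ltz_pmod.
Qed.

Lemma has_sum_shift (u : int -> C) S (m : int) : has_sum u S -> has_sum (fun n => u (n + m)) S.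
Proof.
move=> h; apply: (@has_sum_extend _ _ _ (fun n => n - m)) => [|n hn|].
- exact: addIr.
- by case: (hn (n + m)); rewrite addrK.
- by apply: has_sum_ext h => n; rewrite /= subrK.
Qed.

Lemma has_sum_opp (u : int -> C) S : has_sum u S -> has_sum (fun n => u (- n)) S.
Proof.
move=> h; apply: (@has_sum_extend _ _ _ (fun n : int => - n)) => [|n hn|].
- exact: oppr_inj.
- by case: (hn (- n)); rewrite opprK.
- by apply: has_sum_ext h => n; rewrite /= opprK.
Qed.

End Residues.

(** * Poisson summation for Gaussians *)

Section GaussianBounds.
Variable R : realType.
Local Notation C := (Cplx R).

(** A common majorant for the Gaussian estimates, with Riemann sums bounded independently of the
    mesh by [sum_decay]. *)
Definition decay (x : R) : R := ((1 + `|x|) ^+ 2)^-1.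

Lemma decay_gt0 x : 0 < decay x.
Proof. by rewrite invr_gt0 exprn_gt0 // ltr_wpDr. Qed.

(** [h/(a+h)^2 <= 1/a - 1/(a+h)] telescopes, so each half-line contributes at most 1, and the node 0
    adds [h <= 1]. *)
Lemma sum_decay (h : R) : 0 < h <= 1 -> bounded_sums (fun n : int => h * decay (n%:~R * h)) 3.
Proof.
move=> /andP[h0 h1].
have pos n : \sum_(0 <= k < n) h * decay (k.+1%:R * h) <= 1 - (1 + n%:R * h)^-1.
  elim: n => [|n IH]; first by rewrite big_geq // mul0r addr0 invr1 subrr.
  rewrite big_nat_recr //=; apply: (le_trans (lerD IH (lexx _))).
  rewrite /decay ger0_norm ?mulr_ge0 ?(ltW h0) //.
  set a := 1 + n%:R * h; have a0 : 0 < a by rewrite ltr_wpDr // mulr_ge0 // ltW.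
  have -> : 1 + n.+1%:R * h = a + h by rewrite /a -natr1; ring.
  have ah0 : 0 < a + h by rewrite addr_gt0.
  have : h / (a + h) ^+ 2 <= h / (a * (a + h)).
    rewrite ler_pM2l // lef_pV2 ?posrE ?exprn_gt0 ?mulr_gt0 // expr2 ler_pM2r //.
    by rewrite lerDl ltW.
  have -> : h / (a * (a + h)) = a^-1 - (a + h)^-1 by field; rewrite !gt_eqF.
  lra.
have d0 (x : R) : 0 <= h * decay x by rewrite mulr_ge0 ?ltW // decay_gt0.
have -> : 3 = 2 + 1 :> R by ring.
apply: bounded_sums_int; apply: bounded_sums_nat => // n.
  case: n => [|n]; first by rewrite big_geq.
  rewrite big_ltn // big_add1 /= mul0r {1}/decay normr0 addr0 expr1n invr1 mulr1.
  have := pos n; have : 0 <= (1 + n%:R * h)^-1 by rewrite invr_ge0 addr_ge0 // mulr_ge0 // ltW.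
  by under eq_bigr do rewrite -pmulrn; lra.
rewrite (eq_bigr (fun k => h * decay (k.+1%:R * h))) => [|k _].
  have := pos n; have : 0 <= (1 + n%:R * h)^-1 by rewrite invr_ge0 addr_ge0 // mulr_ge0 // ltW.
  lra.
by rewrite NegzE mulrNz mulNr /decay normrN.
Qed.

(** From [(1+u)^4 <= 4! exp(1+u)], after which the linear terms of the exponent are absorbed by
    completing the square. *)
Lemma gauss_decay (b g : R) : 0 < b -> exists2 K, 0 < K &
  forall s : R, (1 + `|s|) ^+ 2 * expR (- (b * s ^+ 2) + g * `|s|) <= K * decay s.
Proof.
move=> b0; pose K := 24 * expR (1 + (g + 1) ^+ 2 / (4 * b)).
exists K => [|s]; first by rewrite mulr_gt0 ?expR_gt0.
set u := `|s|; have u0 : 0 <= u := normr_ge0 s.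
have -> : s ^+ 2 = u ^+ 2 by rewrite real_normK ?num_real.
rewrite /decay -/u ler_pdivlMr ?exprn_gt0 ?ltr_wpDr //.
rewrite mulrAC -exprD /=.
have h4 : (1 + u) ^+ 4 <= 24 * expR (1 + u).
  have := @expR_ge1Dxn R (1 + u) 3; rewrite addr_ge0 // => /(_ isT).
  have -> : (4`!)%:R = 24 :> R by [].
  lra.
apply: (@le_trans _ _ (24 * expR (1 + u) * expR (- (b * u ^+ 2) + g * u))).
  by rewrite ler_wpM2r // expR_ge0.
rewrite -mulrA -expRD /K ler_pM2l // ler_expR.
have -> : 1 + u + (- (b * u ^+ 2) + g * u) =
   1 + (g + 1) ^+ 2 / (4 * b) - b * (u - (g + 1) / (2 * b)) ^+ 2 by field; rewrite gt_eqF.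
by rewrite lerBlDr lerDl mulr_ge0 ?sqr_ge0 // ltW.
Qed.

Variable al : C.
Hypothesis al0 : 0 < re al.

Definition gau (z : C) : C := cexp (- (al * (z * z))).
Definition gau' (z : C) : C := - (2 * al * z) * gau z.
Definition gau_err (z d : C) : C := gau (z + d) - gau z - d * gau' z.

Lemma gauD z d : gau (z + d) = gau z * cexp (- (2 * al * z * d + al * (d * d))).
Proof. by rewrite /gau -cexpD; suff -> : - (al * ((z + d) * (z + d))) = - (al * (z * z)) + - (2 * al * z * d + al * (d * d)) by []; ring. Qed.

(** The value and the second-order Taylor error have the same summable majorant, uniformly for base
    points [w] with [nm w <= Y]; this uniformity allows the line of summation to be moved. *)
Lemma gau_bounds (Y : R) : 0 <= Y -> exists2 K, 0 < K & forall (w : C) (s : R), nm w <= Y ->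
  nm (gau (w + rc s)) <= K * decay s /\
  (forall d, nm d <= 1 -> nm (gau_err (w + rc s) d) <= nm d ^+ 2 * (K * decay s)).
Proof.
move=> Y0; set A := nm al; set b := re al.
have A0 : 0 <= A := nm_ge0 al.
pose g := 2 * A * Y + 2 * A.
have [K1 K10 hK] := gauss_decay g al0.
pose c := expR (A * Y ^+ 2 + A * (2 * Y + 1)) * (4 * A ^+ 2 * (2 * Y + 2) ^+ 2 + A + 1).
have c0 : 0 < c.
  rewrite mulr_gt0 ?expR_gt0 // ltr_wpDl // addr_ge0 // !mulr_ge0 ?sqr_ge0 //; lra.
exists (c * K1) => [|w s wY]; first by rewrite mulr_gt0.
set u := `|s|; have u0 : 0 <= u := normr_ge0 s.
set x := w + rc s.
have nx : nm x <= Y + u.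
  by apply: (le_trans (nmD _ _)); rewrite nm_rc lerD.
(* For increments of modulus at most 1 the exponent [v] below satisfies [nm v <= A * nm d * m]. *)
pose m := 2 * Y + 2 * u + 1.
have m0 : 0 <= m by rewrite /m; lra.
have hg : nm (gau x) <= expR (A * Y ^+ 2 - b * s ^+ 2 + 2 * A * Y * u).
  rewrite nm_cexp ler_expR reN.
  have -> : re (al * (x * x)) = re (al * (w * w)) + 2 * s * re (al * w) + b * s ^+ 2.
    by rewrite /x !(reM, imM, reD, imD, re_rc, im_rc) /b; ring.
  have h1 : `|re (al * (w * w))| <= A * Y ^+ 2.
    apply: (le_trans (re_le_nm _)); rewrite !nmM ler_wpM2l // expr2 ler_pM //.
  have h2 : `|2 * s * re (al * w)| <= 2 * u * (A * Y).
    rewrite !normrM (@ger0_norm _ 2) // ler_wpM2l ?mulr_ge0 //.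
    by apply: (le_trans (re_le_nm _)); rewrite nmM ler_wpM2l.
  move: h1 h2; rewrite !ler_norml => /andP[h1 _] /andP[h2 _]; lra.
pose G := (1 + u) ^+ 2 * expR (- (b * s ^+ 2) + g * u).
have one_u : 1 <= (1 + u) ^+ 2 by rewrite expr_ge1 // ?addr_ge0 //; lra.
have hgm : nm (gau x) * expR (A * m) <= expR (A * Y ^+ 2 + A * (2 * Y + 1)) * expR (- (b * s ^+ 2) + g * u).
  apply: (@le_trans _ _ (expR (A * Y ^+ 2 - b * s ^+ 2 + 2 * A * Y * u) * expR (A * m))).
    by rewrite ler_wpM2r // expR_ge0.
  by rewrite -!expRD ler_expR; apply: le_of_eq; rewrite /m /g; ring.
have m1 : 1 <= expR (A * m) by rewrite -expR0 ler_expR mulr_ge0.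
have E0 := expR_gt0 (A * Y ^+ 2 + A * (2 * Y + 1)).
have F0 := expR_gt0 (- (b * s ^+ 2) + g * u).
have key (t : R) : 0 <= t -> t <= (4 * A ^+ 2 * (2 * Y + 2) ^+ 2 + A + 1) * (1 + u) ^+ 2 ->
    nm (gau x) * expR (A * m) * t <= c * K1 * decay s.
  move=> t0 ht; rewrite -[leRHS]mulrA; apply: (@le_trans _ _ (c * G)); last by rewrite ler_wpM2l ?(ltW c0) //; exact: hK.
  apply: (le_trans (ler_pM (mulr_ge0 (nm_ge0 _) (expR_ge0 _)) t0 hgm ht)).
  by apply: le_of_eq; rewrite /c /G; ring.
have q0 : 0 <= 4 * A ^+ 2 * (2 * Y + 2) ^+ 2 by rewrite !mulr_ge0 ?sqr_ge0 //; lra.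
split.
  apply: (@le_trans _ _ (nm (gau x) * expR (A * m) * 1)).
    by rewrite mulr1 ler_peMr.
  apply: key => //; apply: (@le_trans _ _ (1 * (1 + u) ^+ 2)); first by rewrite mul1r.
  rewrite ler_wpM2r ?sqr_ge0 //; lra.
move=> d d1; set e := nm d; have e0 : 0 <= e := nm_ge0 d.
pose v := - (2 * al * x * d + al * (d * d)).
have -> : gau_err x d = gau x * (cexp v - 1 - v) - gau x * (al * (d * d)).
  by rewrite /gau_err gauD -/v /gau' /v; ring.
have nv : nm v <= A * e * m.
  rewrite /v nmN; apply: (le_trans (nmD _ _)); rewrite !nmM -/A -/e nm_nat /m.
  have : A * e * nm x <= A * e * (Y + u) by rewrite ler_wpM2l ?mulr_ge0.
  have : A * (e * e) <= A * e * 1 by rewrite mulrA ler_wpM2l ?mulr_ge0.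
  lra.
have nv1 : nm v <= A * m.
  apply: (le_trans nv); rewrite ler_wpM2r // ler_piMr //.
have h1 : nm (cexp v - 1 - v) <= 4 * (A * e * m) ^+ 2 * expR (A * m).
  apply: (le_trans (cexp_sub1z_le _)); apply: ler_pM; rewrite ?expR_ge0 ?mulr_ge0 ?sqr_ge0 ?ler_expR //.
  rewrite ler_wpM2l // lerXn2r ?nnegrE // mulr_ge0 // mulr_ge0 //.
apply: (le_trans (nmB _ _)); rewrite !nmM -/A -/e.
apply: (@le_trans _ _ (e ^+ 2 * (nm (gau x) * expR (A * m) * (4 * A ^+ 2 * m ^+ 2 + A)))).
  have h2 : nm (gau x) * nm (cexp v - 1 - v) <= nm (gau x) * (4 * (A * e * m) ^+ 2 * expR (A * m)).
    by rewrite ler_wpM2l.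
  have h3 : nm (gau x) * (A * (e * e)) <= nm (gau x) * (A * (e * e)) * expR (A * m).
    by rewrite ler_peMr // !mulr_ge0.
  apply: (le_trans (lerD h2 h3)); apply: le_of_eq; ring.
rewrite ler_wpM2l ?sqr_ge0 //; apply: key.
  by rewrite addr_ge0 // !mulr_ge0 ?sqr_ge0.
have hm : m ^+ 2 <= (2 * Y + 2) ^+ 2 * (1 + u) ^+ 2.
  rewrite -exprMn lerXn2r ?nnegrE ?mulr_ge0 ?addr_ge0 ?mulr_ge0 // /m; nra.
have : 4 * A ^+ 2 * m ^+ 2 <= 4 * A ^+ 2 * ((2 * Y + 2) ^+ 2 * (1 + u) ^+ 2).
  by rewrite ler_wpM2l // mulr_ge0 ?sqr_ge0.
nra.
Qed.

End GaussianBounds.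

Section Poisson.
Variable R : realType.
Local Notation C := (Cplx R).
Variable al : C.
Hypothesis al0 : 0 < re al.
Local Notation gau := (gau al).
Local Notation gau' := (gau' al).
Local Notation gau_err := (gau_err al).

Definition mesh (h : R) (w : C) (n : int) : C := gau (w + rc (n%:~R * h)).
(** A Riemann sum for the integral of [gau] along the horizontal line through [w]. That the integral
    is the same for all [w] will come from [rsum_lipschitz] instead of a contour argument. *)
Definition rsum (h : R) (w : C) : C := rc h * tsum (mesh h w).

Lemma bounded_decay (h K : R) : 0 < h <= 1 -> 0 <= K ->
  bounded_sums (fun n : int => K * decay (n%:~R * h)) (3 * K / h).
Proof.
move=> hh K0; have [h0 h1] := andP hh.
have Kh : 0 <= K / h by rewrite divr_ge0 // ltW.
have -> : 3 * K / h = K / h * 3 by ring.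
apply: bounded_sums_le (bounded_sumsZ Kh (sum_decay hh)) => n.
by apply: le_of_eq; field; rewrite gt_eqF.
Qed.

Lemma summ_mesh h w : 0 < h <= 1 -> summ (mesh h w).
Proof.
move=> hh; have [K K0 hK] := gau_bounds al0 (nm_ge0 w).
by apply: (summ_le _ (bounded_decay hh (ltW K0))) => n; have [] := hK w (n%:~R * h) (lexx _).
Qed.

(** Translation by the mesh permutes the nodes and leaves the sum unchanged. Applied to the
    first-order expansion, this shows that the Riemann sum of [gau'] is O(h), as the integral of a
    derivative vanishes; the change under a general [d] is then a quadratic error plus O(h) times
    [nm d]. *)
Lemma rsum_variation (Y : R) : 0 <= Y -> exists2 K : R, 0 < K &
  (forall h w, 0 < h <= 1 -> nm w <= Y -> nm (rsum h w) <= K) /\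
  (forall h w d, 0 < h <= 1 -> nm w <= Y -> nm d <= 1 ->
    nm (rsum h (w + d) - rsum h w) <= K * (nm d ^+ 2 + nm d * h)).
Proof.
move=> Y0; have [K K0 hK] := gau_bounds al0 Y0.
exists (3 * K) => [|]; first by rewrite mulr_gt0.
split=> [h w hh wY|h w d hh wY d1].
  have [h0 h1] := andP hh.
  rewrite /rsum nmM nm_rc ger0_norm ?(ltW h0) // mulrC -ler_pdivlMr //.
  apply: (has_sum_le (tsumP (summ_mesh w hh))).
  by apply: bounded_sums_le (bounded_decay hh (ltW K0)) => n; have [] := hK w (n%:~R * h) wY.
have [h0 h1] := andP hh.
pose err d (n : int) := gau_err (w + rc (n%:~R * h)) d.
have hE d' : nm d' <= 1 -> bounded_sums (fun n => nm (err d' n)) (nm d' ^+ 2 * (3 * K / h)).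
  move=> d1'; apply: bounded_sums_le (bounded_sumsZ (sqr_ge0 _) (bounded_decay hh (ltW K0))) => n.
  by have [_] := hK w (n%:~R * h) wY; apply.
have sE d' : nm d' <= 1 -> summ (err d') by move=> /hE; exists (nm d' ^+ 2 * (3 * K / h)).
have sm := summ_mesh w hh.
pose D n := gau' (w + rc (n%:~R * h)).
have dE d' n : mesh h (w + d') n - mesh h w n = err d' n + d' * D n.
  by rewrite /err /gau_err /mesh /D addrAC subrK.
have nrc : nm (rc h) <= 1 by rewrite nm_rc ger0_norm // ltW.
have sD : summ D.
  have s1 := summD (summD (summ_mesh (w + rc h) hh) (summZ (-1) sm)) (summZ (-1) (sE _ nrc)).
  have := summZ (rc h)^-1 s1; apply: summ_ext => n.
  have := dE (rc h) n; set a := mesh h _ n; set b := mesh h w n => E.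
  have -> : a + -1 * b + -1 * err (rc h) n = rc h * D n by rewrite mulN1r E; ring.
  by rewrite mulKf // fmorph_eq0 gt_eqF.
have diffE d' : nm d' <= 1 ->
    tsum (mesh h (w + d')) - tsum (mesh h w) = tsum (err d') + d' * tsum D.
  move=> d1'.
  have h2 := has_sumD (tsumP (sE _ d1')) (has_sumZ d' (tsumP sD)).
  have h3 := has_sumD (tsumP (summ_mesh (w + d') hh)) (has_sumZ (-1) (tsumP sm)).
  rewrite -mulN1r; apply: has_sum_uniq h3 _; apply: has_sum_ext h2 => n.
  by rewrite -dE mulN1r.
have shift0 : tsum (mesh h (w + rc h)) = tsum (mesh h w).
  apply: has_sum_tsum; apply: has_sum_ext (has_sum_shift 1 (tsumP sm)) => n.
  by rewrite /mesh -addrA -rmorphD; congr (gau (w + rc _)); rewrite rmorphD /=; ring.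
have nD : nm (tsum D) <= 3 * K.
  have := diffE _ nrc; rewrite shift0 subrr => /esym/eqP.
  rewrite addr_eq0 => /eqP /(congr1 (@nm R)); rewrite nmN nmM nm_rc ger0_norm ?(ltW h0) // => E.
  have := has_sum_le (tsumP (sE _ nrc)) (hE _ nrc).
  rewrite E nm_rc ger0_norm ?(ltW h0) // => E2.
  rewrite -(ler_pM2l h0); apply: le_trans E2 _; apply: le_of_eq; field.
  by rewrite gt_eqF.
rewrite /rsum -mulrBr diffE // nmM nm_rc ger0_norm ?(ltW h0) //.
have h2 := has_sum_le (tsumP (sE _ d1)) (hE _ d1).
have h3 : nm d * nm (tsum D) <= nm d * (3 * K) by rewrite ler_wpM2l.
apply: (@le_trans _ _ (h * (nm d ^+ 2 * (3 * K / h) + nm d * (3 * K)))).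
  rewrite ler_wpM2l ?(ltW h0) //; apply: (le_trans (nmD _ _)); rewrite nmM.
  exact: lerD.
by apply: le_of_eq; field; rewrite gt_eqF.
Qed.

(** The segment from [w] to [w'] is divided into [L + 1] equal steps. The quadratic errors add up to
    [K e^2 / (L + 1)], which tends to 0, and only the term with the factor [h] remains. *)
Lemma rsum_lipschitz (Y : R) : 0 <= Y -> exists2 K : R, 0 < K &
  forall h w w', 0 < h <= 1 -> nm w <= Y -> nm w' <= Y ->
    nm (rsum h w' - rsum h w) <= K * nm (w' - w) * h.
Proof.
move=> Y0; have [K K0 [_ hK]] := rsum_variation Y0; exists K => // h w w' hh wY wY'.
have [h0 h1] := andP hh.
set D := w' - w; set e := nm D; have e0 : 0 <= e := nm_ge0 D.
have step (L : nat) : e <= L.+1%:R ->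
    nm (rsum h w' - rsum h w) <= K * e * h + K * e ^+ 2 / L.+1%:R.
  move=> hL; have L0 : 0 < L.+1%:R :> R by rewrite ltr0n.
  pose d := D / L.+1%:R.
  have nd : nm d = e / L.+1%:R by rewrite nmM nmV nm_nat.
  have d1 : nm d <= 1 by rewrite nd ler_pdivrMr // mul1r.
  have hk (k : nat) : (k <= L.+1)%N -> nm (rsum h (w + k%:R * d) - rsum h w) <=
      k%:R * (K * (nm d ^+ 2 + nm d * h)).
    elim: k => [|k IH] kL; first by rewrite !mul0r addr0 subrr nm0.
    have kd : nm (w + k%:R * d) <= Y.
      have -> : w + k%:R * d = (1 - k%:R / L.+1%:R) * w + k%:R / L.+1%:R * w'.
        by rewrite /d /D; ring.
      have k0 : 0 <= k%:R / L.+1%:R :> R by rewrite divr_ge0.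
      have k1 : k%:R / L.+1%:R <= 1 :> R by rewrite ler_pdivrMr // mul1r ler_nat ltnW.
      have -> : 1 - k%:R / L.+1%:R = @rc R (1 - k%:R / L.+1%:R).
        by rewrite rmorphB rmorph1 rmorphM fmorphV !rmorph_nat.
      have -> : k%:R / L.+1%:R * w' = @rc R (k%:R / L.+1%:R) * w'.
        by rewrite rmorphM fmorphV !rmorph_nat.
      apply: (le_trans (nmD _ _)); rewrite !nmM !nm_rc !ger0_norm ?subr_ge0 //.
      set q := k%:R / L.+1%:R in k0 k1 *.
      have : (1 - q) * nm w <= (1 - q) * Y by rewrite ler_wpM2l ?subr_ge0.
      have : q * nm w' <= q * Y by rewrite ler_wpM2l.
      lra.
    have -> : w + k.+1%:R * d = w + k%:R * d + d by rewrite -natr1; ring.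
    have := hK h _ _ hh kd d1; have := IH (ltnW kL).
    set a := rsum h (w + k%:R * d + d); set b := rsum h (w + k%:R * d); set c := rsum h w.
    move=> i1 i2; have -> : a - c = (a - b) + (b - c) by ring.
    apply: (le_trans (nmD _ _)); apply: (le_trans (lerD i2 i1)).
    by apply: le_of_eq; rewrite -natr1; ring.
  have := hk L.+1 (leqnn _).
  have -> : w + L.+1%:R * d = w'.
    by rewrite /d mulrCA mulfV ?mulr1 ?pnatr_eq0 // /D addrC subrK.
  move=> H; apply: (le_trans H); rewrite nd; apply: le_of_eq; field.
  by rewrite gt_eqF.
apply/ler_addgt0Pr => eps eps0.
pose L := Num.bound (e + K * e ^+ 2 / eps).
have B0 : 0 <= K * e ^+ 2 / eps by rewrite divr_ge0 ?mulr_ge0 ?(ltW K0) ?(ltW eps0) // sqr_ge0.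
have hb : e + K * e ^+ 2 / eps < L.+1%:R.
  by apply: (lt_trans (archi_boundP _)); rewrite ?addr_ge0 // ltr_nat.
have L0 : 0 < L.+1%:R :> R by rewrite ltr0n.
apply: (le_trans (step L _)); first by apply: ltW; apply: le_lt_trans hb; rewrite lerDl.
rewrite lerD2l ler_pdivrMr // [eps * _]mulrC -ler_pdivrMr //.
by apply: ltW; apply: le_lt_trans hb; rewrite lerDr.
Qed.

(** The nodes of the finer mesh, sorted by residue modulo [M + 1], are translates of the nodes of
    mesh [h]. *)
Lemma rsum_refine h (M : nat) w : 0 < h <= 1 ->
  rsum (h / M.+1%:R) w = M.+1%:R^-1 * \sum_(j < M.+1) rsum h (w + rc (j%:R * (h / M.+1%:R))).
Proof.
move=> hh; have [h0 h1] := andP hh.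
have M0 : 0 < M.+1%:R :> R by rewrite ltr0n.
have hM : 0 < h / M.+1%:R <= 1.
  rewrite divr_gt0 //= ler_pdivrMr // mul1r (le_trans h1) // ler1n //.
rewrite /rsum -mulr_sumr.
have := has_sum_residues (tsumP (summ_mesh w hM)) (v := fun j : 'I_M.+1 => tsum (mesh h (w + rc (j%:R * (h / M.+1%:R))))).
move=> -> => [|j].
  by rewrite rmorphM fmorphV rmorph_nat; ring.
apply: has_sum_ext (tsumP (summ_mesh _ hh)) => l.
rewrite /mesh -addrA -rmorphD; congr (gau (w + rc _)).
rewrite rmorphD rmorphM /= -pmulrn; field.
by rewrite addrC natr1 gt_eqF.
Qed.

Definition inv_mesh (M : nat) : R := M.+1%:R^-1.

Lemma inv_mesh_itv M : 0 < inv_mesh M <= 1.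
Proof. by rewrite invr_gt0 ltr0n /= invf_le1 ?ltr0n // ler1n. Qed.

(* The integral of gau over the real line, as a limit of Riemann sums. *)
Definition gauss_int : C := limn (fun M => rsum (inv_mesh M) 0).

(** Two meshes are compared with their common refinement, which averages translates by at most 1;
    this makes the sums at [w = 0] a Cauchy sequence. The Lipschitz bound then gives the same limit
    for every complex [w], which is the shift of contour used after completing the square. *)
Lemma rsum_lim w : is_lim (fun M => rsum (inv_mesh M) w) gauss_int.
Proof.
have [K K0 hK] := rsum_lipschitz (@ler01 R).
have inv_small (e : R) : 0 < e -> exists N : nat, forall n, (N <= n)%N -> inv_mesh n < e.
  move=> e0; have [N hN] := ltr_add_invr (y := 0) (x := e) e0.
  exists N => n hn; apply: le_lt_trans (_ : N.+1%:R^-1 < e); last by rewrite -(add0r _^-1).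
  by rewrite lef_pV2 ?posrE // ler_nat.
have refine M M' : nm (rsum (inv_mesh M) 0 - rsum (inv_mesh (M.+1 * M'.+1).-1) 0) <= K * inv_mesh M.
  have -> : inv_mesh (M.+1 * M'.+1).-1 = inv_mesh M / M'.+1%:R.
    by rewrite /inv_mesh prednK // natrM invfM.
  have i0 := inv_mesh_itv M; have [i1 i2] := andP i0.
  rewrite rsum_refine //.
  have -> : rsum (inv_mesh M) 0 = M'.+1%:R^-1 * \sum_(j < M'.+1) rsum (inv_mesh M) 0.
    by rewrite sumr_const card_ord -[rsum _ _ *+ _]mulr_natl mulKf // pnatr_eq0.
  rewrite -mulrBr -sumrB nmM nmV nm_nat mulrC ler_pdivrMr ?ltr0n //.
  apply: (le_trans (nm_sum _ _ _)).
  apply: (@le_trans _ _ (\sum_(j < M'.+1) (K * inv_mesh M))); last by rewrite sumr_const card_ord mulr_natr.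
  apply: ler_sum => j _; rewrite nmBC.
  have jb : nm (rc (j%:R * (inv_mesh M / M'.+1%:R))) <= 1.
    have q0 : 0 <= inv_mesh M / M'.+1%:R by rewrite divr_ge0 // ltW.
    rewrite nm_rc ger0_norm; last by rewrite mulr_ge0.
    rewrite mulrCA.
    apply: mulr_ile1; rewrite ?divr_ge0 ?(ltW i1) // ler_pdivrMr ?ltr0n // mul1r ler_nat.
    exact: ltnW (ltn_ord j).
  have := hK _ 0 _ i0 _ jb; rewrite nm0 ler01 add0r subr0 => /(_ isT) h.
  apply: (le_trans h); rewrite ler_wpM2r ?(ltW i1) //.
  by rewrite ler_piMr // ltW.
have [I hI] : exists I, is_lim (fun M => rsum (inv_mesh M) 0) I.
  apply: cauchy_is_lim => e e0.
  have [N hN] := inv_small (e / 2 / K) (divr_gt0 (divr_gt0 e0 (ltr0n R 2)) K0).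
  exists N => n m hn hm.
  have hn' := hN _ hn; have hm' := hN _ hm.
  rewrite ltr_pdivlMr // mulrC in hn'; rewrite ltr_pdivlMr // mulrC in hm'.
  have r1 := refine n m; have r2 := refine m n; rewrite mulnC in r2.
  set c := rsum (inv_mesh (n.+1 * m.+1).-1) 0 in r1 r2.
  set a := rsum (inv_mesh n) 0 in r1 *; set b := rsum (inv_mesh m) 0 in r2 *.
  have -> : a - b = (a - c) - (b - c) by ring.
  apply: (le_lt_trans (nmB _ _)); rewrite [e]splitr.
  by apply: ltrD; [apply: le_lt_trans hn' | apply: le_lt_trans hm'].
rewrite /gauss_int (is_lim_limn hI).
have [K' K'0 hK'] := rsum_lipschitz (nm_ge0 w).
have dlim : is_lim (fun M => rsum (inv_mesh M) w - rsum (inv_mesh M) 0) 0.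
  move=> e e0; have B0 : 0 < K' * nm w + 1 by rewrite ltr_wpDl // mulr_ge0 // ltW.
  have [N hN] := inv_small (e / (K' * nm w + 1)) (divr_gt0 e0 B0).
  exists N => M /hN; rewrite ltr_pdivlMr // subr0 => h.
  have := hK' _ 0 w (inv_mesh_itv M); rewrite nm0 nm_ge0 lexx subr0 => /(_ isT isT) h2.
  apply: le_lt_trans h2 _; apply: le_lt_trans h.
  by rewrite mulrC ler_wpM2l ?lerDl //; have /andP[/ltW] := inv_mesh_itv M.
have := is_limD dlim hI; rewrite add0r; apply: is_lim_ext => M; by rewrite subrK.
Qed.

(* Riemann sum, of mesh 1/(M+1), of the k-th Fourier coefficient of
   sum_n gau(z + n). *)
Definition gauss_coef (z : C) (M : nat) (k : int) : C :=
  rc (inv_mesh M) * tsum (fun n => mesh (inv_mesh M) z n * ez (- (k%:~R * (n%:~R * inv_mesh M)))).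

Lemma summ_mesh_ez h w (k : R) : 0 < h <= 1 ->
  summ (fun n => mesh h w n * ez (- (k * (n%:~R * h)))).
Proof.
move=> hh; have [K hK] := summ_mesh w hh; exists K.
by apply: bounded_sums_le hK => n; rewrite nmM nm_ez mulr1.
Qed.

Lemma al_neq0 : al != 0.
Proof. by apply/eqP => h; move: al0; rewrite h ltxx. Qed.

(* Completing the square. *)
Lemma gauss_coefE x M k : gauss_coef (rc x) M k =
  ez (k%:~R * x) * cexp (- (rc (pi ^+ 2 * k%:~R ^+ 2) / al)) *
  rsum (inv_mesh M) (rc x + two_pi_i R * rc (k%:~R / 2) / al).
Proof.
have a0 := al_neq0.
have hh := inv_mesh_itv M.
rewrite /gauss_coef /rsum mulrCA; congr (_ * _).
set w := rc x + _ / al.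
have := has_sumZ (ez (k%:~R * x) * cexp (- (rc (pi ^+ 2 * k%:~R ^+ 2) / al))) (tsumP (summ_mesh w hh)).
move=> h; apply: has_sum_tsum; apply: has_sum_ext h => n.
rewrite /mesh /ez /gau -!cexpD; move: (n%:~R * inv_mesh M) => y.
suff -> : two_pi_i R * rc (k%:~R * x) + - (rc (pi ^+ 2 * k%:~R ^+ 2) / al) +
   - (al * ((w + rc y) * (w + rc y))) =
  - (al * ((rc x + rc y) * (rc x + rc y))) + two_pi_i R * rc (- (k%:~R * y)) by [].
have i2 := ii2 R.
have -> : w + rc y = (rc x + rc y) + two_pi_i R * rc (k%:~R / 2) / al by rewrite /w; ring.
rewrite two_pi_iE !rmorphM !rmorphN !rmorphM /= ?rmorphXn !rmorph_nat.
have r2 : rc (2^-1 : R) = 2^-1 by rewrite fmorphV rmorph_nat.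
have -> : al * ((rc x + rc y + 2 * rc pi * ii R * (rc k%:~R * rc 2^-1) / al) *
     (rc x + rc y + 2 * rc pi * ii R * (rc k%:~R * rc 2^-1) / al)) =
   al * ((rc x + rc y) * (rc x + rc y)) + 2 * rc pi * ii R * rc k%:~R * (rc x + rc y) +
   rc pi ^+ 2 * rc k%:~R ^+ 2 * (ii R * ii R) / al by rewrite r2; field; exact: a0.
by rewrite i2; field; exact: a0.
Qed.

(** With [M = 2K] the number of nodes in a unit interval is odd, and the frequencies can be taken in
    the symmetric range from [- K] to [K]. *)
Lemma gauss_coef_lim x k : is_lim (fun K => gauss_coef (rc x) K.*2 k)
  (ez (k%:~R * x) * cexp (- (rc (pi ^+ 2 * k%:~R ^+ 2) / al)) * gauss_int).
Proof.
apply: (@is_lim_ext _ (fun K => ez (k%:~R * x) * cexp (- (rc (pi ^+ 2 * k%:~R ^+ 2) / al)) *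
  rsum (inv_mesh K.*2) (rc x + two_pi_i R * rc (k%:~R / 2) / al))).
  by move=> K; rewrite gauss_coefE.
apply: is_limM; first exact: is_lim_cst.
apply: (@is_lim_sub _ _ _ double _ (rsum_lim _)) => n; by rewrite -addnn leq_addr.
Qed.

(** Summation by parts, twice: multiplying the coefficient by [ez th + ez (- th) - 2] replaces
    [mesh] by its second difference [E], in which the terms with [gau'] cancel and which is O(h^2).
    As [|k| <= L] gives [|th| <= 1/2], that multiplier has modulus at least [4 (c |th|)^2], so a
    factor [1/k^2] is gained. *)
Lemma gauss_coef_bound x : exists2 K, 0 < K & forall (L : nat) (k : int), (`|k| <= L)%N ->
  nm (gauss_coef (rc x) L.*2 k) <= K * decay k%:~R.
Proof.
have [K1 K10 [hK1 _]] := rsum_variation (nm_ge0 (rc x)).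
have [K2 K20 hK2] := gau_bounds al0 (nm_ge0 (rc x)).
have [c c0 hc] := @sin_ge_linear R.
pose K3 := 3 * K2; have K30 : 0 < K3 by rewrite mulr_gt0.
pose Kk := K3 * 8 / c ^+ 2 + 3 * K2.
exists Kk => [|L k kL].
  by rewrite addr_gt0 // ?mulr_gt0 ?invr_gt0 ?exprn_gt0.
have hh := inv_mesh_itv L.*2; set h := inv_mesh L.*2 in hh *; have [h0 h1] := andP hh.
have base : nm (gauss_coef (rc x) L.*2 k) <= 3 * K2.
  rewrite /gauss_coef -/h nmM nm_rc ger0_norm ?(ltW h0) // mulrC -ler_pdivlMr //.
  apply: (has_sum_le (tsumP (summ_mesh_ez _ _ hh))).
  apply: bounded_sums_le (bounded_decay hh (ltW K20)) => n.
  by rewrite nmM nm_ez mulr1; have [] := hK2 (rc x) (n%:~R * h) (lexx _).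
have [k0|k0] := eqVneq k 0.
  apply: (le_trans base); rewrite k0 /decay normr0 addr0 expr1n invr1 mulr1 /Kk lerDr.
  by rewrite !mulr_ge0 ?invr_ge0 ?sqr_ge0 // ltW.
pose th := k%:~R * h : R.
pose T := tsum (fun n => mesh h (rc x) n * ez (- (k%:~R * (n%:~R * h)))).
pose E n := gau_err (rc x + rc (n%:~R * h)) (rc h) + gau_err (rc x + rc (n%:~R * h)) (- rc h).
have nrc : nm (rc h) <= 1 by rewrite nm_rc ger0_norm // ltW.
have hE : bounded_sums (fun n => nm (E n * ez (- (k%:~R * (n%:~R * h))))) (2 * h ^+ 2 * (3 * K2 / h)).
  have q0 : 0 <= 2 * h ^+ 2 by rewrite mulr_ge0 ?sqr_ge0.
  apply: bounded_sums_le (bounded_sumsZ q0 (bounded_decay hh (ltW K20))) => n.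
  rewrite nmM nm_ez mulr1 /E; apply: (le_trans (nmD _ _)).
  have [_ hh2] := hK2 (rc x) (n%:~R * h) (lexx _).
  have := hh2 _ nrc; have := hh2 (- rc h); rewrite nmN => /(_ nrc).
  rewrite nm_rc ger0_norm ?(ltW h0) //; lra.
have sT := tsumP (summ_mesh_ez (rc x) k%:~R hh).
have ET : has_sum (fun n => E n * ez (- (k%:~R * (n%:~R * h)))) ((ez th + ez (- th) - 2) * T).
  have s1 := has_sumZ (ez th) (has_sum_shift 1 sT).
  have s2 := has_sumZ (ez (- th)) (has_sum_shift (-1) sT).
  have s3 := has_sumD (has_sumD s1 s2) (has_sumZ (-2) sT).
  have -> : (ez th + ez (- th) - 2) * T = ez th * T + ez (- th) * T + -2 * T by ring.
  apply: has_sum_ext s3 => n.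
  have e1 : ez th * ez (- (k%:~R * ((n + 1)%:~R * h))) = ez (- (k%:~R * (n%:~R * h))).
    by rewrite -ezD; congr ez; rewrite /th rmorphD /=; ring.
  have e2 : ez (- th) * ez (- (k%:~R * ((n + -1)%:~R * h))) = ez (- (k%:~R * (n%:~R * h))).
    by rewrite -ezD; congr ez; rewrite /th rmorphD /=; ring.
  rewrite [X in X + _ + _]mulrCA e1 [X in _ + X + _]mulrCA e2 /mesh.
  have -> : rc x + rc ((n + 1)%:~R * h) = rc x + rc (n%:~R * h) + rc h.
    have -> : (n + 1)%:~R * h = n%:~R * h + h :> R by rewrite rmorphD /=; ring.
    by rewrite rmorphD addrA.
  have -> : rc x + rc ((n + -1)%:~R * h) = rc x + rc (n%:~R * h) - rc h.
    have -> : (n + -1)%:~R * h = n%:~R * h - h :> R by rewrite rmorphD /=; ring.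
    by rewrite rmorphB addrA.
  by rewrite /E /gau_err; ring.
have hT := has_sum_le ET hE.
have L1 : h = (L.*2.+1%:R)^-1 by [].
have kLr : `|k|%N%:R <= L%:R :> R by rewrite ler_nat.
have hth : `|th| <= 1 / 2.
  rewrite /th normrM (ger0_norm (ltW h0)) L1 ler_pdivrMr ?ltr0n //.
  rewrite -intr_norm -natr_absz.
  by rewrite -(natr1 L.*2) -muln2 natrM; lra.
have nth : nm (ez th + ez (- th) - 2) >= 4 * (c * `|th|) ^+ 2.
  have -> : ez th + ez (- th) - 2 = ez (- th) * ((ez th - 1) * (ez th - 1)).
    by rewrite ezN; field; exact: ez_neq0.
  rewrite !nmM nm_ez mul1r -expr2 nm_ez_sub1 ler_wpM2l //.
  have -> : sin (pi * th) ^+ 2 = sin (pi * `|th|) ^+ 2.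
    have [t0|t0] := leP 0 th; first by rewrite ger0_norm.
    by rewrite ltr0_norm // mulrN sinN sqrrN.
  have p2 := @pi_ge2 R; have t0 : 0 <= `|th| := normr_ge0 _.
  have hs := hc (pi * `|th|).
  have hp : 0 <= pi * `|th| <= pi / 2.
    rewrite mulr_ge0 ?pi_ge0 //= ; apply: (@le_trans _ _ (pi * (1/2))); last by rewrite mul1r.
    by rewrite ler_wpM2l // pi_ge0.
  have {}hs := hs hp.
  have ct0 : 0 <= c * `|th| by rewrite mulr_ge0 // ltW.
  have cle : c * `|th| <= c * (pi * `|th|).
    rewrite ler_wpM2l ?(ltW c0) // ler_peMl //; lra.
  rewrite lerXn2r // ?nnegrE //; last exact: le_trans cle hs.
  by apply: le_trans hs; apply: le_trans ct0 cle.
rewrite nmM in hT.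
have k1 : 1 <= `|k%:~R| :> R.
  by rewrite -intr_norm ler1z; move: k0; clear; lia.
have T0 : 0 <= nm T := nm_ge0 T.
have hT2 : 4 * (c * `|th|) ^+ 2 * nm T <= 2 * h ^+ 2 * (3 * K2 / h).
  by apply: le_trans hT; rewrite ler_wpM2r.
have thE : `|th| = `|k%:~R| * h by rewrite /th normrM (ger0_norm (ltW h0)).
set a := `|k%:~R| : R in k1 thE *.
have a0 : 0 < a by lra.
have hT3 : h * nm T * a ^+ 2 <= K3 / c ^+ 2 * (1/2).
  have e1 : 4 * (c * `|th|) ^+ 2 * nm T = (4 * c ^+ 2 * h) * (h * nm T * a ^+ 2) by rewrite thE; ring.
  have e2 : 2 * h ^+ 2 * (3 * K2 / h) = (4 * c ^+ 2 * h) * (K3 / c ^+ 2 * (1/2)).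
    by rewrite /K3; field; rewrite !gt_eqF.
  have p0 : 0 < 4 * c ^+ 2 * h by rewrite !mulr_gt0 // exprn_gt0.
  by move: hT2; rewrite e1 e2 ler_pM2l.
rewrite /gauss_coef -/h -/T nmM nm_rc ger0_norm ?(ltW h0) //.
rewrite /decay -/a ler_pdivlMr ?exprn_gt0 ?ltr_wpDr //; last exact: ltW.
have hT0 : 0 <= h * nm T by rewrite mulr_ge0 // ltW.
have : (1 + a) ^+ 2 <= 4 * a ^+ 2 by nra.
move=> h4; apply: (@le_trans _ _ (h * nm T * (4 * a ^+ 2))); first by rewrite ler_wpM2l.
have : 0 <= K3 / c ^+ 2 by rewrite divr_ge0 ?sqr_ge0 // ltW.
rewrite /Kk; lra.
Qed.

(* Fourier inversion on the group of (2L+1)-th roots of unity. *)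
Lemma gauss_coef_sum x L : tsum (mesh 1 (rc x)) = \sum_(j < L.*2.+1) gauss_coef (rc x) L.*2 (j%:Z - L%:Z).
Proof.
have hh := inv_mesh_itv L.*2; set h := inv_mesh L.*2 in hh *.
have M0 : L.*2.+1%:R != 0 :> C by rewrite pnatr_eq0.
have hM : h * L.*2.+1%:R = 1 by rewrite /h /inv_mesh mulVf // pnatr_eq0.
have s1 (j : 'I_L.*2.+1) := has_sumZ (rc h) (tsumP (summ_mesh_ez (rc x) (j%:Z - L%:Z)%:~R hh)).
have s2 := @has_sum_big _ _ _ (index_enum _) predT _ _ (fun j _ => s1 j).
apply: has_sum_tsum; have h11 : 0 < (1 : R) <= 1 by rewrite ltr01 lexx.
have s3 : has_sum (fun n : int => if (L.*2.+1%:Z %| n)%Z then mesh h (rc x) n else 0)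
   (\sum_(j < L.*2.+1) gauss_coef (rc x) L.*2 (j%:Z - L%:Z)).
  apply: has_sum_ext s2 => n.
  have E (j : 'I_L.*2.+1) : ez (- ((j%:Z - L%:Z)%:~R * (n%:~R * h))) =
     ez (L%:R * (n%:~R * h)) * ez ((- n)%:~R * j%:R / L.*2.+1%:R) :> C.
    rewrite -ezD; congr ez; rewrite rmorphB rmorphN /= -!pmulrn /h /inv_mesh; ring.
  under eq_bigr => j _ do rewrite E mulrA mulrA.
  rewrite -mulr_sumr ez_root_sum // rpredN.
  case: ifP => [/dvdzP[l ->]|_]; last by rewrite mulr0.
  have -> : L%:R * ((l * L.*2.+1%:Z)%:~R * h) = (L%:Z * l)%:~R :> R.
    by rewrite !rmorphM /= -!pmulrn -(mulrA l%:~R) (mulrC _ h) hM mulr1.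
  rewrite ez_int mulr1 mulrAC -[L.*2.+1%:R](rmorph_nat (@rc R)) -rmorphM hM rmorph1 mul1r //.
apply: has_sum_ext (has_sum_comp (f := fun l : int => l * L.*2.+1%:Z) _ _ _ s3) => [l|x' y'||].
- rewrite /= dvdz_mull // /mesh; congr (gau (_ + rc _)).
  by rewrite rmorphM /= -pmulrn -mulrA [_ * h]mulrC hM.
- by move/mulIf; apply.
- by move=> n hn; case: ifP => // /dvdzP[l hl]; case: (hn l).
- by apply: summ_restrict; exact: summ_mesh.
Qed.

(** The inversion of [gauss_coef_sum] is exact for every [L]. Letting [L] tend to infinity under the
    majorant [K * decay k] turns it into the Poisson formula; frequencies beyond [L] are set to 0 in
    [u]. *)
Lemma poisson x :
  summ (fun k : int => ez (k%:~R * x) * cexp (- (rc (pi ^+ 2 * k%:~R ^+ 2) / al)) * gauss_int) /\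
  has_sum (mesh 1 (rc x))
  (tsum (fun k : int => ez (k%:~R * x) * cexp (- (rc (pi ^+ 2 * k%:~R ^+ 2) / al)) * gauss_int)).
Proof.
set w := fun k : int => _.
have h11 : 0 < (1 : R) <= 1 by rewrite ltr01 lexx.
have [K K0 hK] := gauss_coef_bound x.
pose u (L : nat) (k : int) := if (`|k| <= L)%N then gauss_coef (rc x) L.*2 k else 0.
have hb : bounded_sums (fun k : int => K * decay k%:~R) (3 * K / 1).
  by apply: bounded_sums_le (bounded_decay h11 (ltW K0)) => k; rewrite mulr1.
have hu L k : nm (u L k) <= K * decay k%:~R.
  rewrite /u; case: ifP => [/hK//|_]; by rewrite nm0 mulr_ge0 ?ltW // decay_gt0.
have hlim k : is_lim (fun L => u L k) (w k).
  move=> e e0; have [N hN] := gauss_coef_lim x k e0.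
  exists (maxn N `|k|) => L; rewrite geq_max => /andP[/hN h kL].
  by rewrite /u kL.
have sw : summ w.
  by apply: (summ_le (fun k => is_lim_nm_le (fun L => hu L k) (hlim k)) hb).
split=> //.
have := tsumP (summ_mesh (rc x) h11); suff -> : tsum (mesh 1 (rc x)) = tsum w by [].
apply: is_lim_uniq (tannery hb hu hlim).
apply: is_lim_ext (is_lim_cst _) => L; apply/esym.
rewrite (gauss_coef_sum x L).
have sinj : injective (fun j : 'I_L.*2.+1 => j%:Z - L%:Z).
  by move=> a b /addIr [] /val_inj.
have us : uniq [seq (j%:Z - L%:Z) | j : 'I_L.*2.+1] by rewrite map_inj_uniq // enum_uniq.
have -> : \sum_(j < L.*2.+1) gauss_coef (rc x) L.*2 (j%:Z - L%:Z) =
  \sum_(k <- [seq (j%:Z - L%:Z) | j : 'I_L.*2.+1]) u L k.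
  rewrite big_map big_enum; apply: eq_bigr => j _; rewrite /u ifT //.
  have := ltn_ord j; lia.
apply: has_sum_tsum; apply: has_sum_finite => // k hk; rewrite /u; case: ifP => // kL.
case/negP: hk; apply/mapP.
have kb : (absz (k + L%:Z)%R < L.*2.+1)%N by lia.
exists (Ordinal kb); rewrite ?mem_enum //=; lia.
Qed.

End Poisson.

(** * Theta series *)

Section Theta.
Variable R : realType.
Local Notation C := (Cplx R).

Lemma two_pi_i_rc : two_pi_i R = 2 * rc pi * ii R.
Proof. by rewrite two_pi_iE rmorphM rmorph_nat. Qed.
Implicit Types (t : C) (d : int -> C).

Definition modS t : C := - t^-1.

Lemma uhp_neq0 t : uhp t -> t != 0.
Proof. by rewrite uhpE; apply: contraTneq => ->; rewrite im0 ltxx. Qed.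

Lemma uhp_norm2_gt0 t : uhp t -> 0 < re t ^+ 2 + im t ^+ 2.
Proof. by move=> ht; rewrite ltr_wpDl ?sqr_ge0 // exprn_gt0. Qed.

Lemma im_modS t : im (modS t) = im t / (re t ^+ 2 + im t ^+ 2).
Proof. by rewrite /modS imN imV mulNr opprK. Qed.

Lemma uhp_modS t : uhp t -> uhp (modS t).
Proof. by move=> ht; rewrite uhpE im_modS divr_gt0 // uhp_norm2_gt0. Qed.

Lemma modSK t : modS (modS t) = t.
Proof. by rewrite /modS invrN opprK invrK. Qed.

Lemma uhp_scale t (x : R) : 0 < x -> uhp t -> uhp (rc x * t).
Proof. by move=> x0 ht; rewrite uhpE imM re_rc im_rc mul0r addr0 mulr_gt0. Qed.

(** With this parameter [gau x] is [exp(pi i x^2 (-1/t))], and the Gaussian of the dual sum becomes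
    [exp(pi i k^2 t)]. *)
Definition gal t : C := rc pi * ii R / t.

Lemma gal_re t : uhp t -> 0 < re (gal t).
Proof.
move=> ht; have n0 := uhp_norm2_gt0 ht; rewrite /gal !(reM, imM, re_rc, im_rc, re_ii, im_ii) reV imV.
rewrite [X in 0 < X](_ : _ = pi * (im t / (re t ^+ 2 + im t ^+ 2))); last by ring.
by rewrite mulr_gt0 ?pi_gt0 // divr_gt0.
Qed.

(** A square root of [t / i] in classical terms. Only [gauss_factor t ^+ 2 = k * t] for some nonzero
    [k] will be established. *)
Definition gauss_factor t : C := gauss_int (gal t).

Variable L0 : nat.
Local Notation L := L0.+1.

(** For [L = 2pp'] the exponent is [x^2 / 4pp'], as in the numerators of the characters. *)
Definition qtheta (x : int) : C -> C := qpow (x%:~R ^+ 2 / (2 * L%:R)).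
Definition theta d t : C := tsum (fun x : int => d x * qtheta x t).

Lemma summ_qtheta t : uhp t -> summ (fun x : int => qtheta x t).
Proof.
move=> ht; have b0 : 0 < 2 * pi * im t / (2 * L%:R).
  by rewrite divr_gt0 ?mulr_gt0 ?pi_gt0.
have [K K0 hK] := gauss_decay 0 b0.
have h11 : 0 < (1 : R) <= 1 by rewrite ltr01 lexx.
apply: (summ_le _ (bounded_decay h11 (ltW K0))) => x.
rewrite mulr1; apply: le_trans (hK _); rewrite /qtheta nm_qpow mul0r addr0.
rewrite (_ : - (2 * pi * _ * _) = - (2 * pi * im t / (2 * L%:R) * x%:~R ^+ 2)); last by ring.
by rewrite ler_peMl ?expR_ge0 // expr_ge1 // ?lerDl // addr_ge0.
Qed.

Lemma summ_theta d t (B : R) : (forall x, nm (d x) <= B) -> uhp t ->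
  summ (fun x : int => d x * qtheta x t).
Proof. by move=> hB ht; apply: summ_bounded_mul hB _; exact: summ_qtheta. Qed.

Definition fourier d (y : int) : C := \sum_(r < L) d r%:Z * ez (y%:~R * r%:R / L%:R).

Definition periodic_mod d := forall x l : int, d (l * L%:Z + x) = d x.

Lemma periodic_bounded d : periodic_mod d -> exists B, forall x, nm (d x) <= B.
Proof.
move=> hd; exists (\sum_(r < L) nm (d r%:Z)) => x.
have hx : (absz (x %% L%:Z)%Z < L)%N by rewrite -ltz_nat gez0_abs ?modz_ge0 // ltz_pmod.
rewrite (divz_eq x L%:Z) hd -[(x %% L)%Z]gez0_abs ?modz_ge0 //.
rewrite (bigD1 (Ordinal hx)) //= lerDl sumr_ge0 // => i _; exact: nm_ge0.
Qed.

Lemma periodic_fourier d : periodic_mod (fourier d).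
Proof.
move=> x l; apply: eq_bigr => r _; congr (_ * _).
have -> : (l * L%:Z + x)%:~R * r%:R / L%:R = (l * r%:Z)%:~R + x%:~R * r%:R / L%:R :> R.
  by rewrite rmorphD !rmorphM /= -!pmulrn; field; rewrite addrC natr1 pnatr_eq0.
by rewrite ezD ez_int mul1r.
Qed.

(** Writing [x = l L + r], each residue class is a Gaussian sum shifted by [r / L] with parameter
    [gal (t / L)]. Poisson summation turns the shift into the phase [ez (k r / L)], and the sum over
    [r] is the finite Fourier transform. *)
Lemma theta_modS d t : periodic_mod d -> uhp t ->
  theta d (modS t) = gauss_factor (rc (L%:R^-1) * t) * theta (fourier d) t.
Proof.
move=> hd ht; have hSt := uhp_modS ht; have t0 := uhp_neq0 ht.
have [B hB] := periodic_bounded hd.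
have L0r : 0 < L%:R :> R by [].
have Lc : L%:R != 0 :> C by rewrite pnatr_eq0.
have htL : uhp (rc (L%:R^-1) * t) by apply: uhp_scale => //; rewrite invr_gt0.
have al0 := gal_re htL; set al := gal _ in al0.
pose w (r : int) (k : int) : C := ez (k%:~R * (r%:~R / L%:R)) *
   cexp (- (rc (pi ^+ 2 * k%:~R ^+ 2) / al)) * gauss_int al.
have hw (r : int) := poisson al0 (r%:~R / L%:R).
have s1 := tsumP (summ_theta hB hSt).
have E : theta d (modS t) = \sum_(r < L) d r%:Z * tsum (w r%:Z).
  apply: (has_sum_residues s1) => r.
  have [_ hr] := hw r%:Z; apply: has_sum_ext (has_sumZ (d r%:Z) hr) => l.
  rewrite hd; congr (_ * _); rewrite /mesh /gau /qtheta qpowE.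
  suff -> : two_pi_i R * rc ((l * L%:Z + r%:Z)%:~R ^+ 2 / (2 * L%:R)) * modS t =
    - (al * ((rc (r%:~R / L%:R) + rc (l%:~R * 1)) * (rc (r%:~R / L%:R) + rc (l%:~R * 1)))) by [].
  rewrite /al /gal /modS two_pi_i_rc; move: (rc pi) => P.
  rewrite !(rmorphM, rmorphD, fmorphV, rmorph_nat, rmorph_int, rmorph1, rmorphXn) /= -!pmulrn.
  by move: Lc; move: (L%:R : C) => Lx Lc; field; rewrite t0 Lc.
rewrite E /theta.
have cE k : cexp (- (rc (pi ^+ 2 * k%:~R ^+ 2) / al)) = qtheta k t.
  rewrite /qtheta qpowE.
  suff -> : - (rc (pi ^+ 2 * k%:~R ^+ 2) / al) = two_pi_i R * rc (k%:~R ^+ 2 / (2 * L%:R)) * t by [].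
  have i2 := ii2 R.
  have i0 : ii R != 0 by rewrite -nm_eq0 nm_ii oner_neq0.
  have : rc (pi : R) != 0 by rewrite fmorph_eq0 gt_eqF // pi_gt0.
  have pE : rc (pi ^+ 2 * k%:~R ^+ 2) = rc pi ^+ 2 * k%:~R ^+ 2 :> C.
    by rewrite -(rmorph_int (@rc R)) -!rmorphXn -rmorphM.
  rewrite /al /gal two_pi_i_rc pE; move: (rc pi) => P P0.
  rewrite !(rmorphM, rmorphD, fmorphV, rmorph_nat, rmorph_int, rmorph1, rmorphXn) /=.
  move: Lc; move: (L%:R : C) => Lx Lc; apply: (mulIf i0).
  have -> : 2 * P * ii R * (k%:~R ^+ 2 / (2 * Lx)) * t * ii R =
     2 * P * (ii R * ii R) * (k%:~R ^+ 2 / (2 * Lx)) * t by ring.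
  by rewrite i2; field; rewrite t0 Lc i0 P0.
apply/esym.
have s2 := has_sum_big (index_enum 'I_L) (P := predT) (fun (r : 'I_L) _ => has_sumZ (d r%:Z) (tsumP (hw r%:Z).1)).
have [B' hB'] := periodic_bounded (periodic_fourier d).
have s3 := has_sumZ (gauss_factor (rc (L%:R^-1) * t)) (tsumP (summ_theta hB' ht)).
apply: (has_sum_uniq s3); apply: has_sum_ext s2 => k.
rewrite /fourier mulr_suml mulr_sumr; apply: eq_bigr => r _.
have -> : k%:~R * (r%:Z%:~R / L%:R) = k%:~R * r%:R / L%:R :> R by rewrite -pmulrn mulrA.
by rewrite cE /gauss_factor -/al; ring.
Qed.

End Theta.

(** * Homogeneity of degree 1/2 of the factor in the theta inversion *)

Section GaussIntegralScaling.
Variable R : realType.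
Local Notation C := (Cplx R).
Implicit Types (t : C).

Lemma rcM (x y : R) : rc (x * y) = rc x * rc y. Proof. exact: rmorphM. Qed.
Lemma rc_natV (n : nat) : rc (n%:R^-1 : R) = n%:R^-1.
Proof. by rewrite fmorphV rmorph_nat. Qed.

(** Stretching the line by [M + 1] turns the Riemann sum of mesh [1/((n+1)(M+1))] for [t] into that
    of mesh [1/(n+1)] for [(M+1)^2 t]; the factor is the Jacobian. *)
Lemma gauss_factor_sqr_nat t (M : nat) : uhp t -> gauss_factor (rc (M.+1%:R ^+ 2) * t) = M.+1%:R * gauss_factor t.
Proof.
move=> ht; have t0 := uhp_neq0 ht.
have M0 : 0 < M.+1%:R :> R by [].
have Mc : M.+1%:R != 0 :> C by rewrite pnatr_eq0.
have htM : uhp (rc (M.+1%:R ^+ 2) * t) by apply: uhp_scale; rewrite ?exprn_gt0.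
have al0 := gal_re ht; have al1 := gal_re htM.
have l1 := rsum_lim al1 0.
have l2 := is_limM (is_lim_cst (M.+1%:R : C)) (rsum_lim al0 0).
have hf n : (n <= (n.+1 * M.+1).-1)%N by rewrite -ltnS prednK // leq_pmulr.
have key n : M.+1%:R * rsum (gal t) (inv_mesh R (n.+1 * M.+1).-1) 0 =
   rsum (gal (rc (M.+1%:R ^+ 2) * t)) (inv_mesh R n) 0.
  have iE : inv_mesh R (n.+1 * M.+1).-1 = inv_mesh R n / M.+1%:R.
    by rewrite /inv_mesh prednK // natrM invfM.
  rewrite /rsum iE [LHS]mulrA.
  have -> : M.+1%:R * rc (inv_mesh R n / M.+1%:R) = rc (inv_mesh R n) :> C.
    by rewrite rcM (rc_natV M.+1) mulrCA mulfV // mulr1.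
  suff -> : mesh (gal t) (inv_mesh R n / M.+1%:R) 0 =
    mesh (gal (rc (M.+1%:R ^+ 2) * t)) (inv_mesh R n) 0 by [].
  apply/funext => k; rewrite /mesh /gau !add0r.
  suff -> : - (gal t * (rc (k%:~R * (inv_mesh R n / M.+1%:R)) * rc (k%:~R * (inv_mesh R n / M.+1%:R)))) =
    - (gal (rc (M.+1%:R ^+ 2) * t) * (rc (k%:~R * inv_mesh R n) * rc (k%:~R * inv_mesh R n))) by [].
  have mE : rc (k%:~R * (inv_mesh R n / M.+1%:R)) = rc (k%:~R * inv_mesh R n) / M.+1%:R.
    by rewrite mulrA rcM (rc_natV M.+1).
  have mE2 : rc (M.+1%:R ^+ 2 : R) = M.+1%:R ^+ 2 by rewrite rmorphXn rmorph_nat.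
  rewrite mE mE2 /gal; move: (rc (k%:~R * inv_mesh R n)) (rc pi) => Q P.
  by move: Mc; move: (M.+1%:R : C) => m Mc; field; rewrite t0 Mc.
exact: is_lim_uniq l1 (is_lim_ext key (is_lim_sub hf l2)).
Qed.

(* The differential equation follows from differentiability and the
   homogeneity of degree 1/2 under the rational squares ((n+2)/(n+1))^2, which
   tend to 1. *)
Lemma gauss_factor_cd t d : uhp t -> cd (@gauss_factor R) t d -> 2 * t * d = gauss_factor t.
Proof.
move=> ht hd; have t0 := uhp_neq0 ht.
pose c (n : nat) : R := n.+2%:R / n.+1%:R.
have c0 n : 0 < c n by rewrite divr_gt0.
have cE n : c n = 1 + n.+1%:R^-1.
  by rewrite /c -(natr1 n.+1) mulrDl mulfV ?pnatr_eq0 // mul1r.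
have hc n : gauss_factor (rc (c n ^+ 2) * t) = rc (c n) * gauss_factor t.
  have hs : uhp (rc (n.+1%:R ^- 2) * t) by apply: uhp_scale => //; rewrite invr_gt0 exprn_gt0.
  have n1 : n.+1%:R != 0 :> R by rewrite pnatr_eq0.
  have n1c : n.+1%:R != 0 :> C by rewrite pnatr_eq0.
  have E1 : rc (n.+1%:R ^+ 2) * (rc (n.+1%:R ^- 2) * t) = t.
    by rewrite mulrA -rmorphM mulfV ?expf_neq0 // rmorph1 mul1r.
  have E2 : rc (n.+2%:R ^+ 2) * (rc (n.+1%:R ^- 2) * t) = rc (c n ^+ 2) * t.
    by rewrite mulrA -rmorphM -exprVn -exprMn.
  have e1 := gauss_factor_sqr_nat n hs; have e2 := gauss_factor_sqr_nat n.+1 hs.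
  rewrite E1 in e1; rewrite E2 in e2; rewrite e2 e1 /c rcM rc_natV !rmorph_nat.
  by rewrite mulrA divfK.
apply/eqP; rewrite -subr_eq0; apply/eqP; apply: nm_lt_small => e e0.
have nt0 : 0 < nm t by rewrite nm_gt0.
have e1 : 0 < e / (6 * nm t) by rewrite divr_gt0 // mulr_gt0.
have [del del0 hdel] := cd_has_d hd e1.
(* Above [B], the index makes the increment [h], of modulus at most [3 r nm t], smaller than [del],
   and the correction [r * nm (t * d)] at most [e / 2]. *)
pose B := 2 * nm (t * d) / e + 3 * nm t / del.
have B0 : 0 <= B by rewrite addr_ge0 // divr_ge0 ?mulr_ge0 // ltW.
pose n := Num.bound B; have hn : B < n.+1%:R.
  by apply: (lt_trans (archi_boundP B0)); rewrite ltr_nat.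
have n0 : 0 < n.+1%:R :> R by [].
pose r : R := n.+1%:R^-1; have r0 : 0 < r by rewrite invr_gt0.
have r1 : r <= 1 by rewrite invf_le1 // ler1n.
have cn : c n = 1 + r := cE n.
pose h : C := rc (r * (2 + r)) * t.
have rt3 : r * (2 + r) <= 3 * r by nra.
have rp : 0 < r * (2 + r) by nra.
have nh : nm h = r * (2 + r) * nm t by rewrite nmM nm_rc ger0_norm ?ltW.
have hh : nm h < del.
  rewrite nh; apply: (@le_lt_trans _ _ (3 * r * nm t)); first by rewrite ler_wpM2r.
  have : 3 * nm t / del < n.+1%:R.
    by apply: le_lt_trans hn; rewrite lerDr divr_ge0 ?mulr_ge0 // ltW.
  rewrite ltr_pdivrMr // => h1; rewrite /r mulrAC ltr_pdivrMr //; lra.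
have th : t + h = rc (c n ^+ 2) * t.
  rewrite /h cn -{1}[t]mul1r -mulrDl; suff -> : rc ((1 + r) ^+ 2) = 1 + rc (r * (2 + r)) by [].
  by rewrite -(rmorph1 (@rc R)) -rmorphD; suff -> : (1 + r) ^+ 2 = 1 + r * (2 + r) by []; ring.
have := hdel h hh; rewrite th hc cn nh.
have -> : rc (1 + r) * gauss_factor t - gauss_factor t - h * d = rc r * (gauss_factor t - (2 + rc r) * t * d).
  by rewrite /h rmorphD rmorph1 rmorphM rmorphD rmorph_nat /=; ring.
rewrite nmM nm_rc (ger0_norm (ltW r0)) => hb.
have hb2 : nm (gauss_factor t - (2 + rc r) * t * d) <= e / 2.
  rewrite -(ler_pM2l r0); apply: (le_trans hb).
  apply: (@le_trans _ _ (e / (6 * nm t) * (3 * r * nm t))).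
    by apply: ler_wpM2l; [exact: ltW | rewrite ler_wpM2r].
  apply: le_of_eq; field; rewrite gt_eqF //.
have hr : r * nm (t * d) <= e / 2.
  have : 2 * nm (t * d) / e < n.+1%:R.
    by apply: le_lt_trans hn; rewrite lerDl divr_ge0 ?mulr_ge0 // ltW.
  rewrite ltr_pdivrMr // => h1.
  by rewrite /r mulrC ler_pdivrMr //; lra.
have -> : 2 * t * d - gauss_factor t = - (gauss_factor t - (2 + rc r) * t * d) - rc r * (t * d) by ring.
apply: (le_trans (nmB _ _)); rewrite nmN nmM nm_rc (ger0_norm (ltW r0)); lra.
Qed.

End GaussIntegralScaling.

Lemma dvd_bounded (q : nat) (a b : nat) : (a < q)%N -> (b < q)%N -> (q%:Z %| a%:Z - b%:Z)%Z -> a = b.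
Proof.
move=> aq bq /dvdzP[l hl].
have : (`|a%:Z - b%:Z| = `|l| * q)%N by rewrite hl abszM.
by case: (`|l|)%N (absz_eq0 l) => [|n] hn; [rewrite mul0n|rewrite mulSn]; lia.
Qed.

Lemma dvd_nat_bounded (q a : nat) : (0 < a < q)%N -> (q%:Z %| a%:Z)%Z -> False.
Proof. by move=> h1 /dvdn_leq; rewrite !absz_nat; lia. Qed.

Lemma dvd_small_eq0 (q a : int) : (q %| a)%Z -> `|a| < q -> a = 0.
Proof.
move=> /dvdzP[l ->]; rewrite normrM => h; apply/eqP; rewrite mulf_eq0 -absz_eq0.
case: (`|l|)%N (abszE l) => [//|n] hn; exfalso; move: h; rewrite -hn /=.
have := ler_norm q; nia.
Qed.

(** * Coefficient functions modulo 2pp' *)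

Section Arithmetic.
Variables p p' : nat.
Hypotheses (hp : (2 <= p)%N) (hp' : (2 <= p')%N) (hpp' : coprime p p').

(** The modulus is [level.+1]: the successor form is the one expected by [theta] and by sums over
    ordinals. *)
Definition level : nat := (2 * p * p').-1.
Lemma levelE : level.+1 = (2 * p * p')%N.
Proof. by rewrite /level prednK // !muln_gt0 /=; lia. Qed.

Definition cong (x y : int) : bool := (level.+1%:Z %| x - y)%Z.
Definition theta_lam (r s : nat) : int := p'%:Z * r%:Z - p%:Z * s%:Z.
Definition theta_mu (r s : nat) : int := p'%:Z * r%:Z + p%:Z * s%:Z.

Lemma coprimez_pp : coprimez p p'. Proof. by rewrite /coprimez /gcdz /= -/(coprime p p'). Qed.
Lemma coprimez_p'p : coprimez p' p. Proof. by rewrite coprimez_sym coprimez_pp. Qed.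

(** As [p] and [p'] are coprime, [2pp'] is the least common multiple of [2p] and [2p']; congruences
    involving [omega] are checked modulo these two numbers. *)
Lemma level_dvdP (x : int) : reflect (exists2 a, x = 2 * p%:Z * a & exists b, x = 2 * p'%:Z * b) (level.+1%:Z %| x)%Z.
Proof.
apply: (iffP idP) => [/dvdzP[l ->]|[a xa [b xb]]].
  by exists (l * p'%:Z); rewrite levelE !PoszM; [ring | exists (l * p%:Z); ring].
have : p'%:Z * b = p%:Z * a by apply: (mulfI (_ : 2 != 0 :> int)) => //; rewrite !mulrA -xa -xb.
move=> E; have : (p'%:Z %| p%:Z * a)%Z by rewrite -E dvdz_mulr.
rewrite Gauss_dvdzr ?coprimez_p'p // => /dvdzP[c ac].
by apply/dvdzP; exists c; rewrite xa ac levelE !PoszM; ring.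
Qed.

Lemma cong_sym x y : cong x y = cong y x.
Proof. by rewrite /cong -opprB rpredN. Qed.

Lemma cong_trans x y z : cong x y -> cong y z -> cong x z.
Proof. by rewrite /cong => h1 h2; have := rpredD h1 h2; rewrite addrA subrK. Qed.

Lemma cong_congr x y z : cong y z -> cong x y = cong x z.
Proof.
move=> h; apply/idP/idP => h2; first exact: cong_trans h2 h.
by apply: cong_trans h2 _; rewrite cong_sym.
Qed.

Lemma congN x y : cong (- x) (- y) = cong x y.
Proof. by rewrite /cong -opprD rpredN. Qed.

Lemma congNr x y : cong (- x) y = cong x (- y).
Proof. by rewrite -[y in LHS]opprK congN. Qed.

Lemma bezout_pp : exists u v, u * p%:Z + v * p'%:Z = 1.
Proof.
have [u v E _] := egcdzP p p'; exists u, v; rewrite E.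
by have := coprimez_pp; rewrite /coprimez => /eqP.
Qed.

(** The two congruences are compatible because the greatest common divisor of [2p] and [2p'] is 2,
    and [1 = -1] modulo 2. With [u p + v p' = 1] the witness is [1 - 2p'v]. *)
Lemma omega_exists : exists om : int, (exists a, om = 1 + 2 * p'%:Z * a) /\ (exists b, om = -1 + 2 * p%:Z * b).
Proof.
have [u [v E]] := bezout_pp.
exists (1 - 2 * p'%:Z * v); split; first by exists (- v); ring.
exists u; rewrite (_ : 1 - _ = 1 - 2 * (v * p'%:Z)); last by ring.
have -> : v * p'%:Z = 1 - u * p%:Z by rewrite -E; ring.
ring.
Qed.

Definition omega : int := projT1 (cid omega_exists).
Lemma omega1 : exists a, omega = 1 + 2 * p'%:Z * a. Proof. exact: (projT2 (cid omega_exists)).1. Qed.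
Lemma omega2 : exists b, omega = -1 + 2 * p%:Z * b. Proof. exact: (projT2 (cid omega_exists)).2. Qed.

Lemma omega_sqr : exists c, omega * omega = 1 + 2 * level.+1%:Z * c.
Proof.
have [a oa] := omega1; have [b ob] := omega2.
exists (a * b); rewrite levelE !PoszM.
have -> : omega * omega = 1 + (omega - 1) * (omega + 1) by ring.
rewrite {1}oa ob; ring.
Qed.

Lemma cong_omega x y : cong (omega * x) y = cong x (omega * y).
Proof.
have [c oc] := omega_sqr.
suff h x' y' : cong (omega * x') y' -> cong x' (omega * y').
  by apply/idP/idP; [exact: h | rewrite cong_sym => /h; rewrite cong_sym].
rewrite /cong => /dvdzP[l hl]; apply/dvdzP; exists (omega * l - 2 * c * x').
have -> : omega * y' = omega * (omega * x') - omega * (l * level.+1%:Z) by rewrite -hl; ring.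
by rewrite (mulrA omega omega) oc; ring.
Qed.

(** This is why the numerator of a character, with its minus sign between the [lam] and [mu] series,
    has coefficients that are odd under [omega]: up to sign, [omega] exchanges the two classes. *)
Lemma cong_omega_lam r s : cong (omega * theta_lam r s) (- theta_mu r s).
Proof.
have [a oa] := omega1; have [b ob] := omega2; apply/level_dvdP.
exists (b * theta_lam r s + s%:Z).
  rewrite ob /theta_lam /theta_mu; ring.
exists (a * theta_lam r s + r%:Z); rewrite oa /theta_lam /theta_mu; ring.
Qed.

Lemma cong_omega_mu r s : cong (omega * theta_mu r s) (- theta_lam r s).
Proof.
by rewrite cong_omega mulrN cong_sym congNr cong_omega_lam.
Qed.

(* The coefficient functions of the theta series in the span of the numerators
   of the characters. *)
Definition omega_odd (A : zmodType) (d : int -> A) := [/\ forall x l, d (l * level.+1%:Z + x) = d x,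
  forall x, d (- x) = d x & forall x, d (omega * x) = - d x].

Lemma omega_odd_cong (A : zmodType) (d : int -> A) x y : omega_odd d -> cong x y -> d x = d y.
Proof.
by move=> [hd _ _] /dvdzP[l hl]; rewrite -(hd y l) -hl subrK.
Qed.

Variable A : comRingType.

Definition cong_ind (x y : int) : A := (cong x y)%:R.
Definition char_coef (r s : nat) (x : int) : A :=
  cong_ind x (theta_lam r s) + cong_ind x (- theta_lam r s) - cong_ind x (theta_mu r s) - cong_ind x (- theta_mu r s).

Lemma cong_ind_period x y l : cong_ind (l * level.+1%:Z + x) y = cong_ind x y.
Proof. by rewrite /cong_ind /cong -addrA rpredDl // dvdz_mull. Qed.

Lemma char_coef_omega_odd r s : omega_odd (char_coef r s).
Proof.
split=> [x l|x|x]; rewrite /char_coef ?cong_ind_period //.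
  by rewrite /cong_ind !congNr !opprK; ring.
have h1 : cong (omega * x) (theta_lam r s) = cong x (- theta_mu r s).
  by rewrite cong_omega (cong_congr _ (cong_omega_lam r s)).
have h2 : cong (omega * x) (- theta_lam r s) = cong x (theta_mu r s).
  rewrite cong_omega mulrN; apply: cong_congr.
  by rewrite congNr cong_omega_lam.
have h3 : cong (omega * x) (theta_mu r s) = cong x (- theta_lam r s).
  by rewrite cong_omega (cong_congr _ (cong_omega_mu r s)).
have h4 : cong (omega * x) (- theta_mu r s) = cong x (theta_lam r s).
  rewrite cong_omega mulrN; apply: cong_congr.
  by rewrite congNr cong_omega_mu.
by rewrite /cong_ind h1 h2 h3 h4; ring.
Qed.

Lemma omega_odd_mu (B : zmodType) (d : int -> B) r s : omega_odd d -> d (theta_mu r s) = - d (theta_lam r s).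
Proof.
move=> hd; have [_ hN hom] := hd.
by rewrite -hN -(omega_odd_cong hd (cong_omega_lam r s)) hom.
Qed.

(** Such an [x] lies in exactly one class [p' r - p s] or [p' r + p s] modulo [2pp']: its residue
    modulo [p] determines [r], and the remaining multiple of [p] determines [s] and the sign modulo
    [2p']. *)
Lemma sum_ind_class x : ~~ (p%:Z %| x)%Z -> ~~ (p'%:Z %| x)%Z ->
  \sum_(rs : 'I_p.-1 * 'I_p'.-1) (cong_ind x (theta_lam rs.1.+1 rs.2.+1) + cong_ind x (theta_mu rs.1.+1 rs.2.+1)) = 1.
Proof.
move=> px p'x.
have p0 : p%:Z != 0 by move: hp; clear; lia.
have q0 : (2 * p'%:Z) != 0 by move: hp'; clear; lia.
(* Bezout's identity gives [r0 = v x mod p]; it is nonzero because [p] does not divide [x]. *)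
have [r0 hr0 [y hy]] : exists2 r0 : nat, (0 < r0 < p)%N & exists y, x = p'%:Z * r0%:Z + p%:Z * y.
  have [u [v E]] := bezout_pp.
  pose r := ((v * x) %% p%:Z)%Z.
  have r_ge0 : 0 <= r by rewrite modz_ge0.
  have r_lt : r < p%:Z by rewrite ltz_pmod //; move: hp; clear; lia.
  have vx := divz_eq (v * x) p%:Z; rewrite -/r in vx.
  have xE : x = p'%:Z * r + p%:Z * (u * x + p'%:Z * ((v * x) %/ p%:Z)%Z).
    rewrite -[LHS]mul1r -E mulrDl.
    have -> : v * p'%:Z * x = p'%:Z * (v * x) by ring.
    rewrite {1}vx; move: r ((v * x) %/ p%:Z)%Z {r_ge0 r_lt vx} => r w; ring.
  exists (absz r); last first.
    by exists (u * x + p'%:Z * ((v * x) %/ p%:Z)%Z); rewrite gez0_abs.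
  apply/andP; split; last by rewrite -ltz_nat gez0_abs.
  rewrite lt0n absz_eq0; apply: contra px => /eqP rz.
  by rewrite xE rz mulr0 add0r dvdz_mulr.
pose z := (y %% (2 * p'%:Z))%Z.
have z_ge0 : 0 <= z by rewrite modz_ge0.
have z_lt : z < 2 * p'%:Z by rewrite ltz_pmod //; move: hp'; clear; lia.
have yz := divz_eq y (2 * p'%:Z); rewrite -/z in yz.
clearbody z.
have p'z : ~~ (p'%:Z %| z)%Z.
  apply: contra p'x => h; rewrite hy; apply: rpredD; first by rewrite dvdz_mulr.
  apply: dvdz_mull; rewrite yz; apply: rpredD => //.
  by apply: dvdz_mull; exact: dvdz_mull.
have z0 : z != 0 by apply: contra p'z => /eqP ->; rewrite dvdz0.
have zp : z != p'%:Z by apply: contra p'z => /eqP ->; rewrite dvdzz.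
have cE r (s : int) : (0 < r < p)%N -> cong x (p'%:Z * r%:Z + p%:Z * s) = (r == r0) && (2 * p'%:Z %| z - s)%Z.
  move=> hr; apply/idP/idP.
    move=> h; have rr : r = r0.
      apply/esym/(@dvd_bounded p); [by case/andP: hr0 | by case/andP: hr |].
      rewrite -(@Gauss_dvdzr _ p'%:Z) ?coprimez_pp //.
      have : (p%:Z %| x - (p'%:Z * r%:Z + p%:Z * s))%Z.
        by apply: dvdz_trans h; rewrite levelE !PoszM dvdz_mulr // dvdz_mull.
      rewrite hy; have -> : p'%:Z * r0%:Z + p%:Z * y - (p'%:Z * r%:Z + p%:Z * s) =
        p%:Z * (y - s) + p'%:Z * (r0%:Z - r%:Z) by ring.
      by rewrite rpredDl // dvdz_mulr.
    rewrite rr eqxx /=; move: h; rewrite rr /cong hy => /dvdzP[l hl].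
    have : p%:Z * (y - s) = p%:Z * (l * (2 * p'%:Z)).
      have -> : p%:Z * (y - s) = p'%:Z * r0%:Z + p%:Z * y - (p'%:Z * r0%:Z + p%:Z * s) by ring.
      by rewrite hl levelE !PoszM; ring.
    move/(mulfI p0) => E; apply/dvdzP; exists (l - (y %/ (2 * p'%:Z))%Z).
    have gen (v z' : int) : y = v * (2 * p'%:Z) + z' -> z' - s = (l - v) * (2 * p'%:Z).
      by move=> e; rewrite mulrBl -E e; ring.
    exact: gen yz.
  move=> /andP[/eqP -> /dvdzP[l hl]]; apply/dvdzP; exists (l + (y %/ (2 * p'%:Z))%Z).
  have gen (v z' : int) : y = v * (2 * p'%:Z) + z' -> z' - s = l * (2 * p'%:Z) ->
      p%:Z * (y - s) = p%:Z * ((l + v) * (2 * p'%:Z)).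
    by move=> e1 e2; rewrite mulrDl -e2 e1; congr (_ * _); ring.
  have -> : x - (p'%:Z * r0%:Z + p%:Z * s) = p%:Z * (y - s) by rewrite hy; ring.
  by rewrite (gen _ _ yz hl) levelE !PoszM; ring.
have r0p : (r0.-1 < p.-1)%N by move: hr0; clear; lia.
(* A residue [z] below [p'] belongs to [theta_mu] with [s = z], one above [p'] to [theta_lam] with
   [s = 2p' - z]. *)
pose s0 := if z < p'%:Z then absz z else absz (2 * p'%:Z - z)%R.
have s0_itv : (0 < s0 < p')%N.
  by rewrite /s0; case: ifP; move: z_ge0 z_lt z0 zp; clear; lia.
have s0p : (s0.-1 < p'.-1)%N by move: s0_itv; clear; lia.
have s0E : z = if z < p'%:Z then s0%:Z else 2 * p'%:Z - s0%:Z.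
  by rewrite /s0; have [h|h] := ltP z p'%:Z; move: h z_ge0 z_lt z0 zp; clear; lia.
have dvdS (j : nat) : (j < p'.-1)%N ->
    ((2 * p'%:Z %| z - - j.+1%:Z)%Z%:R + (2 * p'%:Z %| z - j.+1%:Z)%Z%:R = (j.+1 == s0)%:R :> A).
  move=> jp.
  have h1 : (2 * p'%:Z %| z - j.+1%:Z)%Z = (z == j.+1%:Z).
    apply/idP/eqP => [h|->]; last by rewrite subrr dvdz0.
    apply/eqP; rewrite -subr_eq0; apply/eqP; apply: dvd_small_eq0 h _.
    by move: z_ge0 z_lt jp hp'; clear; lia.
  have h2 : (2 * p'%:Z %| z - - j.+1%:Z)%Z = (z == 2 * p'%:Z - j.+1%:Z).
    apply/idP/eqP => [h|->]; last by rewrite opprK subrK dvdzz.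
    apply/eqP; rewrite -subr_eq0; apply/eqP; apply: (@dvd_small_eq0 (2 * p'%:Z)).
      have -> : z - (2 * p'%:Z - j.+1%:Z) = (z - - j.+1%:Z) - 2 * p'%:Z by ring.
      by rewrite rpredB // dvdzz.
    by move: z_ge0 z_lt jp hp'; clear; lia.
  rewrite h1 h2; clearbody s0; case: ifP s0E => hz s0E.
    have -> : (z == 2 * p'%:Z - j.+1%:Z) = false by move: hz jp hp'; clear; lia.
    by rewrite add0r s0E; congr (_%:R); congr nat_of_bool; clear; lia.
  have -> : (z == j.+1%:Z) = false by move: hz jp hp'; clear; lia.
  by rewrite addr0 s0E; congr (_%:R); congr nat_of_bool; clear; lia.
rewrite (bigD1 (Ordinal r0p, Ordinal s0p)) //= [X in _ + X]big1 ?addr0; last first.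
  move=> [i j] /= ij; rewrite /cong_ind /theta_lam -mulrN /theta_mu !cE.
  2,3: by move: (ltn_ord i) hp; clear; lia.
  case: eqP => [ir|_] /=; last by rewrite addr0.
  have jj : (j.+1 != s0)%N.
    apply: contra ij => /eqP js; apply/eqP; congr pair; apply: val_inj => /=.
      by move: ir; clear; lia.
    by move: js; clear; lia.
  by rewrite dvdS ?(ltn_ord j) // (negPf jj).
have s0S : s0.-1.+1 = s0 by rewrite prednK //; case/andP: s0_itv.
have r0S : r0.-1.+1 = r0 by rewrite prednK //; case/andP: hr0.
rewrite s0S r0S /cong_ind /theta_lam -mulrN /theta_mu !cE // eqxx /=.
have := dvdS s0.-1 s0p; rewrite s0S eqxx => ->.
by [].
Qed.

Lemma lam_dvdp r s : (0 < r < p)%N -> ~~ (p%:Z %| theta_lam r s)%Z.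
Proof.
move=> hr; apply/negP => h; apply: (dvd_nat_bounded hr).
rewrite -(@Gauss_dvdzr _ p'%:Z) ?coprimez_pp //.
have -> : p'%:Z * r%:Z = theta_lam r s + p%:Z * s%:Z by rewrite /theta_lam; ring.
by rewrite rpredD // dvdz_mulr.
Qed.

Lemma mu_dvdp r s : (0 < r < p)%N -> ~~ (p%:Z %| theta_mu r s)%Z.
Proof.
move=> hr; apply/negP => h; apply: (dvd_nat_bounded hr).
rewrite -(@Gauss_dvdzr _ p'%:Z) ?coprimez_pp //.
have -> : p'%:Z * r%:Z = theta_mu r s - p%:Z * s%:Z by rewrite /theta_mu; ring.
by rewrite rpredB // dvdz_mulr.
Qed.

Lemma lam_dvdp' r s : (0 < s < p')%N -> ~~ (p'%:Z %| theta_lam r s)%Z.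
Proof.
move=> hs; apply/negP => h; apply: (dvd_nat_bounded hs).
rewrite -(@Gauss_dvdzr _ p%:Z) ?coprimez_p'p //.
have -> : p%:Z * s%:Z = p'%:Z * r%:Z - theta_lam r s by rewrite /theta_lam; ring.
by rewrite rpredB // dvdz_mulr.
Qed.

Lemma mu_dvdp' r s : (0 < s < p')%N -> ~~ (p'%:Z %| theta_mu r s)%Z.
Proof.
move=> hs; apply/negP => h; apply: (dvd_nat_bounded hs).
rewrite -(@Gauss_dvdzr _ p%:Z) ?coprimez_p'p //.
have -> : p%:Z * s%:Z = theta_mu r s - p'%:Z * r%:Z by rewrite /theta_mu; ring.
by rewrite rpredB // dvdz_mulr.
Qed.

Lemma cong_dvdp x y : cong x y -> (p%:Z %| x)%Z = (p%:Z %| y)%Z.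
Proof.
move=> h; have h' : (p%:Z %| x - y)%Z.
  by apply: dvdz_trans h; rewrite levelE !PoszM dvdz_mulr // dvdz_mull.
by rewrite -[x](subrK y) rpredDl.
Qed.

Lemma cong_dvdp' x y : cong x y -> (p'%:Z %| x)%Z = (p'%:Z %| y)%Z.
Proof.
move=> h; have h' : (p'%:Z %| x - y)%Z.
  by apply: dvdz_trans h; rewrite levelE !PoszM dvdz_mull.
by rewrite -[x](subrK y) rpredDl.
Qed.

Lemma lam_rev (i : 'I_p.-1) (j : 'I_p'.-1) : theta_lam (rev_ord i).+1 (rev_ord j).+1 = - theta_lam i.+1 j.+1.
Proof.
rewrite /theta_lam /=; have := ltn_ord i; have := ltn_ord j; move: (nat_of_ord i) (nat_of_ord j) => a b h1 h2.
have -> : (p.-1 - a.+1).+1%:Z = p%:Z - a.+1%:Z by move: h2; clear; lia.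
have -> : (p'.-1 - b.+1).+1%:Z = p'%:Z - b.+1%:Z by move: h1; clear; lia.
ring.
Qed.

Lemma mu_rev (i : 'I_p.-1) (j : 'I_p'.-1) : cong (theta_mu (rev_ord i).+1 (rev_ord j).+1) (- theta_mu i.+1 j.+1).
Proof.
apply/dvdzP; exists 1.
rewrite /theta_mu /=; have := ltn_ord i; have := ltn_ord j; move: (nat_of_ord i) (nat_of_ord j) => a b h1 h2.
have -> : (p.-1 - a.+1).+1%:Z = p%:Z - a.+1%:Z by move: h2; clear; lia.
have -> : (p'.-1 - b.+1).+1%:Z = p'%:Z - b.+1%:Z by move: h1; clear; lia.
by rewrite levelE !PoszM; ring.
Qed.

Lemma sum_rev (F : nat -> nat -> A) :
  \sum_(rs : 'I_p.-1 * 'I_p'.-1) F rs.1.+1 rs.2.+1 =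
  \sum_(rs : 'I_p.-1 * 'I_p'.-1) F (rev_ord rs.1).+1 (rev_ord rs.2).+1.
Proof.
rewrite (reindex_inj (h := fun rs : 'I_p.-1 * 'I_p'.-1 => (rev_ord rs.1, rev_ord rs.2))) //.
by apply: inv_inj => -[a b]; rewrite !rev_ordK.
Qed.

(* The factor 2 is due to the symmetry (r, s) ~ (p - r, p' - s). *)
Lemma omega_odd_expand (d : int -> A) x : omega_odd d ->
  d x *+ 2 = \sum_(rs : 'I_p.-1 * 'I_p'.-1) d (theta_lam rs.1.+1 rs.2.+1) * char_coef rs.1.+1 rs.2.+1 x.
Proof.
move=> hd; have [hper hN hom] := hd.
have ri (i : 'I_p.-1) : (0 < i.+1 < p)%N by move: (ltn_ord i) hp; clear; lia.
have si (j : 'I_p'.-1) : (0 < j.+1 < p')%N by move: (ltn_ord j) hp'; clear; lia.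
have [a oa] := omega1; have [b ob] := omega2.
have [/dvdzP[l hl]|px] := boolP (p%:Z %| x)%Z.
  (* When [p] divides [x], [omega] fixes its class and oddness gives [d x + d x = 0]; when [p']
     divides [x], the class is negated and evenness leads to the same conclusion. The doubled left
     side makes this sufficient in any ring. *)
  have c1 : cong (omega * x) x.
    apply/level_dvdP; exists (b * x - l); first by rewrite ob hl; ring.
    by exists (a * x); rewrite oa; ring.
  have -> : d x *+ 2 = 0 by rewrite mulr2n -{1}[d x]opprK -hom (omega_odd_cong hd c1) addNr.
  rewrite big1 // => -[i j] _ /=; have px : (p%:Z %| x)%Z by rewrite hl dvdz_mull.
  have z y : ~~ (p%:Z %| y)%Z -> cong x y = false.
    by move=> hy; apply: contraNF hy => /cong_dvdp <-.
  rewrite /char_coef /cong_ind !z ?rpredN ?lam_dvdp ?mu_dvdp //; ring.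
have [/dvdzP[l hl]|p'x] := boolP (p'%:Z %| x)%Z.
  have c1 : cong (omega * x) (- x).
    apply/level_dvdP; exists (b * x); first by rewrite ob; ring.
    exists (a * x + l); have -> : 2 * p'%:Z * (a * x + l) = 2 * p'%:Z * a * x + 2 * (l * p'%:Z) by ring.
    by rewrite -hl oa; ring.
  have -> : d x *+ 2 = 0 by rewrite mulr2n -{1}[d x]opprK -hom (omega_odd_cong hd c1) hN addNr.
  rewrite big1 // => -[i j] _ /=; have p'x : (p'%:Z %| x)%Z by rewrite hl dvdz_mull.
  have z y : ~~ (p'%:Z %| y)%Z -> cong x y = false.
    by move=> hy; apply: contraNF hy => /cong_dvdp' <-.
  rewrite /char_coef /cong_ind !z ?rpredN ?lam_dvdp' ?mu_dvdp' //; ring.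
have key y : d y * cong_ind x y = d x * cong_ind x y.
  by rewrite /cong_ind; case: (boolP (cong x y)) => [h|_]; rewrite ?(omega_odd_cong hd h) // !mulr0.
have E (r s : nat) : d (theta_lam r s) * char_coef r s x =
    d x * (cong_ind x (theta_lam r s) + cong_ind x (theta_mu r s)) + d x * (cong_ind x (- theta_lam r s) + cong_ind x (- theta_mu r s)).
  rewrite /char_coef !mulrBr !mulrDr -!key hN hN (omega_odd_mu _ _ hd); ring.
under eq_bigr => rs _ do rewrite E.
rewrite big_split /= -!mulr_sumr.
rewrite sum_ind_class // (sum_rev (fun r s => cong_ind x (- theta_lam r s) + cong_ind x (- theta_mu r s))).
rewrite (eq_bigr (fun rs : 'I_p.-1 * 'I_p'.-1 => cong_ind x (theta_lam rs.1.+1 rs.2.+1) + cong_ind x (theta_mu rs.1.+1 rs.2.+1))).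
  by rewrite sum_ind_class // mulr1 mulr2n.
move=> [i j] _ /=; rewrite lam_rev opprK /cong_ind; congr (_ + _%:R); congr nat_of_bool.
by apply: cong_congr; rewrite congNr -[cong _ _]/(cong _ _) mu_rev.
Qed.

End Arithmetic.

(** * Stability under the finite Fourier transform, and theta series of cosets *)

Section Fourier.
Variable R : realType.
Local Notation C := (Cplx R).
Variables p p' : nat.
Hypotheses (hp : (2 <= p)%N) (hp' : (2 <= p')%N) (hpp' : coprime p p').
Local Notation N := (level p p').

Lemma sum_residues_involution (G : int -> C) (u : int) :
  (forall x l, G (l * N.+1%:Z + x) = G x) -> (N.+1%:Z %| u * u - 1)%Z ->
  \sum_(r < N.+1) G (u * r%:Z) = \sum_(r < N.+1) G r%:Z.
Proof.
move=> hG /dvdzP[c hc].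
pose w (r : 'I_N.+1) : 'I_N.+1 := inord (absz ((u * r%:Z) %% N.+1%:Z)%Z).
have wE r : (w r)%:Z = ((u * r%:Z) %% N.+1%:Z)%Z.
  rewrite /w inordK ?gez0_abs ?modz_ge0 // -ltz_nat gez0_abs ?modz_ge0 //.
  exact: ltz_pmod.
have wK : involutive w.
  move=> r; apply: val_inj => /=; apply/eqP; rewrite -eqz_nat wE wE modzMmr mulrA.
  have -> : u * u * r%:Z = r%:Z + c * r%:Z * N.+1%:Z.
    by rewrite -[u * u](subrK 1) hc; ring.
  by rewrite addrC modzMDl modz_small // ltz_nat ltn_ord.
rewrite [RHS](reindex_inj (inv_inj wK)) /=; apply: eq_bigr => r _.
by rewrite wE {1}(divz_eq (u * r%:Z) N.+1%:Z) hG.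
Qed.

Lemma ez_period (y x l : int) : ez ((y * (l * N.+1%:Z + x))%:~R / N.+1%:R) = ez ((y * x)%:~R / N.+1%:R) :> C.
Proof.
have N0 : N.+1%:R != 0 :> R by rewrite pnatr_eq0.
have -> : (y * (l * N.+1%:Z + x))%:~R / N.+1%:R = (y * l)%:~R + (y * x)%:~R / N.+1%:R :> R.
  by rewrite !(rmorphM, rmorphD) /= -!pmulrn; move: N0; move: (N.+1%:R : R) => L N0; field.
by rewrite ezD ez_int mul1r.
Qed.

Lemma fourierE (d : int -> C) y :
  fourier N d y = \sum_(r < N.+1) d r%:Z * ez ((y * r%:Z)%:~R / N.+1%:R).
Proof. by apply: eq_bigr => r _; rewrite rmorphM. Qed.

(** The substitution [r -> u r], an involution of the residues, moves the multiplier from [y] to the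
    coefficient function. It is used for [u = -1] and [u = omega]. *)
Lemma fourier_twist (d : int -> C) (u : int) (s : C) y :
  (forall x l, d (l * N.+1%:Z + x) = d x) -> (forall x, d (u * x) = s * d x) ->
  s * s = 1 -> (N.+1%:Z %| u * u - 1)%Z -> fourier N d (u * y) = s * fourier N d y.
Proof.
move=> hd hu ss h; rewrite !fourierE.
pose G x : C := d x * ez ((y * x)%:~R / N.+1%:R).
have hG x l : G (l * N.+1%:Z + x) = G x by rewrite /G hd ez_period.
rewrite -(sum_residues_involution hG h) mulr_sumr; apply: eq_bigr => r _.
by rewrite /G hu !mulrA ss mul1r; do 4![congr (_ * _) || congr ez || congr (_%:~R)]; ring.
Qed.

Local Notation omega_odd := (omega_odd hpp').
Local Notation kf := (char_coef p p' C).

Lemma fourier_omega_odd (d : int -> C) : omega_odd d -> omega_odd (fourier N d).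
Proof.
move=> [hd hN hom]; split.
- by move=> x l; exact: periodic_fourier.
- move=> x; rewrite -mulN1r (@fourier_twist _ (-1) 1) ?mul1r //.
  by move=> y; rewrite mulN1r mul1r hN.
- move=> x; rewrite (@fourier_twist _ (omega hpp') (-1)) ?mulN1r //.
  + by move=> y; rewrite mulN1r hom.
  + by rewrite opprK.
  have [c ->] := omega_sqr hp hp' hpp'; apply/dvdzP; exists (2 * c); ring.
Qed.

Lemma omega_odd_bounded (d : int -> C) : omega_odd d -> exists B, forall x, nm (d x) <= B.
Proof. by move=> [hd _ _]; apply: (@periodic_bounded _ N). Qed.

Lemma omega_odd_summ (d : int -> C) t : omega_odd d -> uhp t -> has_sum (fun x => d x * qtheta N x t) (theta N d t).
Proof. by move=> /omega_odd_bounded[B hB] ht; apply: tsumP; exact: summ_theta hB ht. Qed.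

Lemma theta_omega_odd (d : int -> C) t : omega_odd d -> uhp t ->
  2 * theta N d t = \sum_(rs : 'I_p.-1 * 'I_p'.-1)
    d (theta_lam p p' rs.1.+1 rs.2.+1) * theta N (kf rs.1.+1 rs.2.+1) t.
Proof.
move=> hd ht; have s1 := has_sumZ 2 (omega_odd_summ hd ht).
apply: (has_sum_uniq s1).
have s2 (rs : 'I_p.-1 * 'I_p'.-1) := has_sumZ (d (theta_lam p p' rs.1.+1 rs.2.+1))
  (omega_odd_summ (char_coef_omega_odd hp hp' hpp' C rs.1.+1 rs.2.+1) ht).
apply: has_sum_ext (has_sum_big _ (fun rs _ => s2 rs)) => x /=.
rewrite mulrA mulr_natl (omega_odd_expand hp hp' x hd) mulr_suml.
by apply: eq_bigr => rs _; rewrite mulrA.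
Qed.

Definition coset_theta (y : int) (t : C) : C := tsum (fun n : int => qtheta N (n * N.+1%:Z + y) t).

Lemma coset_inj (y : int) : injective (fun n : int => n * N.+1%:Z + y).
Proof. by move=> a b /addIr /mulIf; apply. Qed.

Lemma coset_theta_has_sum y t : uhp t -> has_sum (fun n : int => qtheta N (n * N.+1%:Z + y) t) (coset_theta y t).
Proof. by move=> ht; apply: tsumP; apply: (summ_inj (@coset_inj y) (summ_qtheta N ht)). Qed.

Lemma cong_ind_has_sum y t : uhp t -> has_sum (fun x : int => cong_ind p p' C x y * qtheta N x t) (coset_theta y t).
Proof.
move=> ht; apply: (has_sum_extend (@coset_inj y)) => [x hx|].
  rewrite /cong_ind; case: (boolP (cong p p' x y)) => [/dvdzP[l hl]|_]; last by rewrite mul0r.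
  by case: (hx l); rewrite -hl subrK.
apply: has_sum_ext (coset_theta_has_sum y ht) => n /=.
by rewrite /cong_ind /cong addrK dvdz_mull // mul1r.
Qed.

Lemma qthetaN x (t : C) : qtheta N (- x) t = qtheta N x t.
Proof. by rewrite /qtheta rmorphN sqrrN. Qed.

Lemma coset_theta_opp y t : uhp t -> coset_theta (- y) t = coset_theta y t.
Proof.
move=> ht; apply: (has_sum_uniq (coset_theta_has_sum (- y) ht)).
apply: has_sum_ext (has_sum_opp (coset_theta_has_sum y ht)) => n.
by rewrite -qthetaN; congr (qtheta N _ t); ring.
Qed.

Lemma coset_theta_shift y l t : uhp t -> coset_theta (l * N.+1%:Z + y) t = coset_theta y t.
Proof.
move=> ht; apply: (has_sum_uniq (coset_theta_has_sum _ ht)).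
apply: has_sum_ext (has_sum_shift l (coset_theta_has_sum y ht)) => n.
by congr (qtheta N _ t); ring.
Qed.

Lemma theta_char_coef r s t : uhp t ->
  theta N (kf r s) t = 2 * (coset_theta (theta_lam p p' r s) t - coset_theta (theta_mu p p' r s) t).
Proof.
move=> ht; apply: (has_sum_uniq (omega_odd_summ (char_coef_omega_odd hp hp' hpp' C r s) ht)).
have h := has_sumD (has_sumD (cong_ind_has_sum (theta_lam p p' r s) ht) (cong_ind_has_sum (- theta_lam p p' r s) ht))
  (has_sumZ (-1) (has_sumD (cong_ind_has_sum (theta_mu p p' r s) ht) (cong_ind_has_sum (- theta_mu p p' r s) ht))).
have -> : 2 * (coset_theta (theta_lam p p' r s) t - coset_theta (theta_mu p p' r s) t) = coset_theta (theta_lam p p' r s) t + coset_theta (- theta_lam p p' r s) t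
    + (-1) * (coset_theta (theta_mu p p' r s) t + coset_theta (- theta_mu p p' r s) t).
  by rewrite !coset_theta_opp //; ring.
by apply: has_sum_ext h => x; rewrite /char_coef; ring.
Qed.

End Fourier.

(** * The inversion formula for eta *)

Section EtaTransform.
Variable R : realType.
Local Notation C := (Cplx R).
Local Notation eta := (@Defs.eta R).
Local Notation gauss_factor := (@gauss_factor R).

Let h2 : (2 <= 2)%N := isT.
Let h3 : (2 <= 3)%N := isT.
Lemma coprime23 : coprime 2 3. Proof. by []. Qed.

(** The quadratic character modulo 12: 1 at the classes of 1 and -1, -1 at those of 5 and -5, and 0
    elsewhere. *)
Definition eta_character : int -> C := char_coef 2 3 C 1 1.
Lemma chi_omega_odd : omega_odd coprime23 eta_character. Proof. exact: char_coef_omega_odd. Qed.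

Lemma level23 : level 2 3 = 11%N. Proof. by []. Qed.

(** Splitting the pentagonal series by the parity of [n] puts [6n + 1] in the class of 1 or 7 modulo
    12, with sign + or -. The class of 7 is that of -5, and the factor 2 counts [x] and [- x]. *)
Lemma theta_chi t : uhp t -> theta 11 eta_character t = 2 * eta t.
Proof.
move=> ht; rewrite -level23 (theta_char_coef h2 h3 coprime23) //.
have E : coset_theta 2 3 5 t = coset_theta 2 3 7 t by rewrite -(coset_theta_opp 2 3 5 ht) -(coset_theta_shift 2 3 7 (-1) ht).
have h : eta t = \sum_(j < 2) (if j == ord0 then coset_theta 2 3 1 t else - coset_theta 2 3 7 t).
  apply: (has_sum_residues (eta_has_sum ht)) => j.
  have qE (x : int) : qpow (x%:~R ^+ 2 / 24) t = qtheta (level 2 3) x t.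
    rewrite /qtheta level23; congr (qpow (_ / _) t).
    by rewrite -natrM.
  case: ifP => [/eqP -> | hj].
    apply: has_sum_ext (coset_theta_has_sum 2 3 1 ht) => n; rewrite /pent_term addr0.
    have -> : (-1) ^+ `|n * 2| = 1 :> C.
      have : ~~ odd `|n * 2| by clear; lia.
      by rewrite -signr_odd => /negPf ->.
    rewrite mul1r -qE.
    have -> : (n * (level 2 3).+1%:Z + 1)%:~R = 6 * (n * 2)%:~R + 1 :> R.
      by rewrite level23 !(rmorphD, rmorphM) /=; ring.
    by [].
  have -> : j%:Z = 1 by move: (ltn_ord j) hj; rewrite -val_eqE /=; clear; lia.
  rewrite -[- coset_theta _ _ _ _]mulN1r.
  apply: has_sum_ext (has_sumZ (-1) (coset_theta_has_sum 2 3 7 ht)) => n; rewrite /pent_term.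
  have -> : (-1) ^+ `|n * 2 + 1| = -1 :> C.
    have : odd `|n * 2 + 1| by clear; lia.
    by rewrite -signr_odd => ->.
  rewrite -qE.
  have -> : (n * (level 2 3).+1%:Z + 7)%:~R = 6 * (n * 2 + 1)%:~R + 1 :> R.
    by rewrite level23 !(rmorphD, rmorphM) /=; ring.
  by [].
rewrite h big_ord_recl big_ord1 /= -[theta_lam 2 3 1 1]/(1 : int) -[theta_mu 2 3 1 1]/(5 : int) E.
by rewrite mulrDr mulrN.
Qed.

(** For (2, 3) the two index pairs are exchanged by the symmetry, so the odd coefficient functions
    form a line and the Fourier transform acts on it by a scalar. *)
Lemma fourier_chi y : fourier 11 eta_character y = fourier 11 eta_character 1 * eta_character y.
Proof.
have hF : omega_odd coprime23 (fourier 11 eta_character) by rewrite -level23; exact: fourier_omega_odd chi_omega_odd.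
have := omega_odd_expand h2 h3 y hF.
have [_ hN _] := hF.
rewrite -(pair_big xpredT xpredT (fun (i : 'I_2.-1) (j : 'I_3.-1) =>
   fourier 11 eta_character (theta_lam 2 3 i.+1 j.+1) * char_coef 2 3 C i.+1 j.+1 y)) /= big_ord1 big_ord_recl big_ord1 /=.
have -> : char_coef 2 3 C 1 (bump 0 0).+1 y = eta_character y.
  rewrite /eta_character /char_coef /cong_ind -[theta_lam 2 3 1 _]/(-1 : int) -[theta_mu 2 3 1 (bump _ _).+1]/(7 : int).
  rewrite -[theta_lam 2 3 1 1]/(1 : int) -[theta_mu 2 3 1 1]/(5 : int) opprK.
  have -> : cong 2 3 y 7 = cong 2 3 y (-5) by apply: cong_congr.
  have -> : cong 2 3 y (-7) = cong 2 3 y 5 by apply: cong_congr.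
  ring.
rewrite -[theta_lam 2 3 1 1]/(1 : int) -[theta_lam 2 3 1 _]/(- (1) : int) hN -/eta_character -mulr2n => h.
have n2 : 2%:R != 0 :> C by rewrite pnatr_eq0.
by apply: (mulfI n2); rewrite !mulr_natl.
Qed.

(** The constant is a Gauss sum. That it is nonzero is read off at the point [i] from the
    nonvanishing of eta. *)
Lemma eta_modS : exists2 c, c != 0 & forall t, uhp t ->
  eta (modS t) = c * gauss_factor (rc 12^-1 * t) * eta t.
Proof.
have E t : uhp t -> eta (modS t) = fourier 11 eta_character 1 * gauss_factor (rc 12^-1 * t) * eta t.
  move=> ht; have hper : periodic_mod 11 eta_character by case: chi_omega_odd.
  apply: (mulfI (_ : 2 != 0)); first by rewrite pnatr_eq0.
  rewrite -(theta_chi (uhp_modS ht)) (theta_modS hper ht).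
  have -> : theta 11 (fourier 11 eta_character) t = fourier 11 eta_character 1 * theta 11 eta_character t.
    have hF : omega_odd coprime23 (fourier 11 eta_character) by rewrite -level23; exact: fourier_omega_odd chi_omega_odd.
    rewrite -level23; apply: (has_sum_uniq (omega_odd_summ hF ht)).
    apply: has_sum_ext (has_sumZ _ (omega_odd_summ chi_omega_odd ht)) => x.
    by rewrite fourier_chi mulrA.
  by rewrite theta_chi //; ring.
exists (fourier 11 eta_character 1) => //.
apply/eqP => h0; have hi : uhp (ii R) by rewrite uhpE im_ii.
by have := eta_neq0 (uhp_modS hi); rewrite E // h0 !mul0r eqxx.
Qed.

Definition hol (f : C -> C) := forall t, uhp t -> exists d, cd f t d.

Lemma hol_eta : hol eta. Proof. move=> t; exact: eta_derivable. Qed.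

Lemma cd_modS t : uhp t -> cd (@modS R) t (t ^- 2).
Proof.
move=> ht; have h := cdN (cdV (f := id) (uhp_neq0 ht) (cd_id t)).
by move: h; rewrite mulr1 opprK.
Qed.

(** The inversion formula of eta at [12 t] is solved for [gauss_factor t], a quotient of
    differentiable functions; no limit of Riemann sums has to be differentiated. *)
Lemma hol_gauss_factor : hol gauss_factor.
Proof.
move=> t ht; have [c c0 hc] := eta_modS.
have h12 (z : C) : uhp z -> uhp (rc 12 * z) by move=> hz; apply: uhp_scale => //; rewrite ltr0n.
have r12 : rc (12^-1 : R) * rc 12 = 1.
  by rewrite -rcM mulVf ?rmorph1 // pnatr_eq0.
have [d1 hd1] := hol_eta (uhp_modS (h12 _ ht)); have [d2 hd2] := hol_eta (h12 _ ht).
have hm := cdZ (rc 12) (cd_id t).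
have g1 := cd_comp (cd_comp hm (cd_modS (h12 _ ht))) hd1.
have e0 : (eta \o (fun z => rc 12 * z)) t != 0 by apply: eta_neq0; exact: h12.
have g2 := cdV e0 (cd_comp hm hd2).
have g := cdZ c^-1 (cdM g1 g2).
eexists; apply: (cd_ext_uhp ht) g => z hz /=.
by rewrite (hc _ (h12 _ hz)) [rc 12^-1 * _]mulrA r12 mul1r; field; rewrite c0 eta_neq0 //; exact: h12.
Qed.

Lemma gauss_factor_neq0 t : uhp t -> gauss_factor t != 0.
Proof.
move=> ht; have [c c0 hc] := eta_modS.
have h12 : uhp (rc 12 * t) by apply: uhp_scale => //; rewrite ltr0n.
have := eta_neq0 (uhp_modS h12); rewrite (hc _ h12) [rc 12^-1 * _]mulrA.
have -> : rc (12^-1 : R) * rc 12 = 1 by rewrite -rcM mulVf ?rmorph1 // pnatr_eq0.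
by rewrite mul1r; apply: contraNneq => ->; rewrite mulr0 mul0r.
Qed.

(** The equation [2 t g' = g] makes the derivative of [g^2 / t] vanish. *)
Lemma gauss_factor_sqr : exists2 k, k != 0 & forall t, uhp t -> gauss_factor t ^+ 2 = k * t.
Proof.
have hi : uhp (ii R) by rewrite uhpE im_ii.
exists (gauss_factor (ii R) ^+ 2 / ii R) => [|t ht].
  by rewrite mulf_neq0 ?expf_neq0 ?invr_neq0 ?gauss_factor_neq0 // uhp_neq0.
suff E s : uhp s -> cd (fun z => gauss_factor z ^+ 2 / z) s 0.
  by rewrite (cd0_constant E hi ht) divfK ?uhp_neq0.
move=> hs; have [d hd] := hol_gauss_factor hs; have s0 := uhp_neq0 hs.
have h := cdM (cdX 1 hd) (cdV (f := id) s0 (cd_id s)).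
have Ed := gauss_factor_cd hs hd.
suff E0 : 2%:R * gauss_factor s ^+ 1 * d / s + gauss_factor s ^+ 2 * (- s ^- 2 * 1) = 0 by rewrite -E0.
by rewrite -Ed; field.
Qed.

(** From [2 f f' = 0] and [f != 0]. It takes the place of choosing a branch of the square root. *)
Lemma sqr_constant (f : C -> C) k : hol f -> k != 0 -> (forall t, uhp t -> f t ^+ 2 = k) ->
  forall s t, uhp s -> uhp t -> f s = f t.
Proof.
move=> hf k0 hk; apply: cd0_constant => z hz; have [d hd] := hf z hz.
suff -> : (0 : C) = d by [].
have h1 := cdX 1 hd; have h2' := cd_ext_uhp hz hk (cd_cst k z).
have f0 : f z != 0 by apply: contraNneq k0 => f0; rewrite -(hk _ hz) f0 expr0n.
move/eqP: (cd_uniq h2' h1); rewrite eq_sym mulf_eq0 mulf_eq0 pnatr_eq0 expr1 (negPf f0) /=.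
by move/eqP.
Qed.

(** The square of the quotient is [a / b], so the quotient itself is constant. This reconciles the
    arguments [t / 2pp'] of the characters and [t / 12] of eta. *)
Lemma gauss_factor_ratio (a b : R) : 0 < a -> 0 < b -> exists2 c, c != 0 & forall t, uhp t ->
  gauss_factor (rc a * t) = c * gauss_factor (rc b * t).
Proof.
move=> a0 b0; have [k k0 hk] := gauss_factor_sqr.
have hi : uhp (ii R) by rewrite uhpE im_ii.
have ha (z : C) : uhp z -> uhp (rc a * z) by exact: uhp_scale.
have hb (z : C) : uhp z -> uhp (rc b * z) by exact: uhp_scale.
have ra : rc a != 0 :> C by rewrite fmorph_eq0 gt_eqF.
have rb : rc b != 0 :> C by rewrite fmorph_eq0 gt_eqF.
pose f z := gauss_factor (rc a * z) / gauss_factor (rc b * z).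
have f0 (z : C) : uhp z -> f z != 0.
  by move=> hz; rewrite mulf_neq0 ?invr_neq0 ?gauss_factor_neq0 //; [exact: ha | exact: hb].
exists (f (ii R)); first exact: f0.
move=> t ht; suff -> : f (ii R) = f t by rewrite divfK // gauss_factor_neq0 //; exact: hb.
apply: (@sqr_constant f (rc a / rc b)) => // [z hz||z hz].
- have [d1 hd1] := hol_gauss_factor (ha _ hz); have [d2 hd2] := hol_gauss_factor (hb _ hz).
  have g0 : (gauss_factor \o (fun z => rc b * z)) z != 0 by apply: gauss_factor_neq0; exact: hb.
  eexists; exact: cdM (cd_comp (cdZ (rc a) (cd_id z)) hd1) (cdV g0 (cd_comp (cdZ (rc b) (cd_id z)) hd2)).
- by rewrite mulf_neq0 ?invr_neq0.
- rewrite /f expr_div_n.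
  have E1 := hk _ (ha _ hz).
  have E2 := hk _ (hb _ hz).
  apply: (eq_trans (f_equal2 (fun u v => u / v) E1 E2)).
  by have z0 := uhp_neq0 hz; field; rewrite k0 z0 rb.
Qed.

Lemma eta_modS_sqr : exists2 c, c != 0 & forall t, uhp t ->
  eta (modS t) ^+ 2 = c * t * eta t ^+ 2.
Proof.
have [c c0 hc] := eta_modS; have [k k0 hk] := gauss_factor_sqr.
have r0 : rc (12^-1 : R) != 0 by rewrite fmorph_eq0 invr_neq0 // pnatr_eq0.
exists (c ^+ 2 * k * rc 12^-1); first by rewrite !mulf_neq0 // expf_neq0.
move=> t ht; rewrite hc // !exprMn hk; first by ring.
by apply: uhp_scale => //; rewrite invr_gt0 ltr0n.
Qed.

End EtaTransform.

(** * The characters *)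

Section IntegerSeries.
Variable R : realType.
Local Notation C := (Cplx R).
Implicit Types (u : int -> C) (e : int -> nat).

Lemma disk_summable_le (a b : nat -> C) : (forall n, nm (a n) <= nm (b n)) ->
  disk_summable b -> disk_summable a.
Proof.
move=> h hb r r01; have [K hK] := hb r r01; exists K; apply: bounded_sums_le hK => n.
by rewrite ler_wpM2r // exprn_ge0 //; case/andP: r01 => /ltW.
Qed.

Lemma disk_summable_cst (B : C) : disk_summable (fun=> B).
Proof.
move=> r r01; exists (nm B * (1 - r)^-1).
by apply: bounded_sumsZ => //; exact: bounded_sums_geom.
Qed.

(** The coefficient of [q^k] after regrouping an integer series by its exponent [e]. The range from
    [- k] to [k] contains the whole fibre as soon as [|x| <= e x]. *)
Definition fiber_sum u e (k : nat) : C :=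
  \sum_(j < k.*2.+1) (if e (j%:Z - k%:Z) == k then u (j%:Z - k%:Z) else 0).

Lemma has_sum_fiber_sum u e k : (forall x, (`|x| <= e x)%N) ->
  has_sum (fun x => if e x == k then u x else 0) (fiber_sum u e k).
Proof.
move=> he.
have inj : injective (fun j : 'I_k.*2.+1 => j%:Z - k%:Z).
  by move=> i j /addIr [] /val_inj.
apply: (has_sum_extend inj) => [x hx|].
  case: eqP => // ek; exfalso.
  have lt : (absz (x + k%:Z)%R < k.*2.+1)%N by move: (he x) ek; clear; lia.
  apply: (hx (Ordinal lt)) => /=; move: (he x) ek; clear; lia.
have := has_sum_finite (u := (fun x => if e x == k then u x else 0) \o (fun j : 'I_k.*2.+1 => j%:Z - k%:Z))
   (enum_uniq 'I_k.*2.+1).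
rewrite /fiber_sum -big_enum; apply => j; by rewrite mem_enum.
Qed.

(** Fibres have at most [2k + 1] points, so bounded terms give coefficients of at most linear
    growth. *)
Lemma int_series u e (B h : R) : (forall x, (`|x| <= e x)%N) -> (forall x, nm (u x) <= B) ->
  disk_summable (fiber_sum u e) /\ forall f,
    (forall t, uhp t -> has_sum (fun x => u x * qpow (h + (e x)%:R) t) (f t)) ->
    qs_sum h (fiber_sum u e) f.
Proof.
move=> he hu; have B0 : 0 <= B by apply: le_trans (hu 0).
split=> [|f hf t ht].
  have h1 := disk_summable_cst (rc B).
  have h2 := disk_summableD (disk_summableZ 2 (disk_summable_nat h1)) h1.
  apply: disk_summable_le h2 => k; rewrite /fiber_sum.
  apply: le_trans (nm_sum _ _ _) _.
  apply: (@le_trans _ _ (\sum_(j < k.*2.+1) B)).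
    by apply: ler_sum => j _; case: ifP => _; rewrite ?nm0.
  rewrite sumr_const card_ord.
  have -> : 2 * (k%:R * rc B) + rc B = rc (k.*2.+1%:R * B) :> C.
    rewrite rcM rmorph_nat.
    have -> : k.*2.+1%:R = 2 * k%:R + 1 :> C by rewrite -natrM natr1 mul2n.
    by ring.
  by rewrite nm_rc ger0_norm ?mulr_ge0 // mulr_natl.
apply: (has_sum_fibers (f := e)) (hf t ht) => k.
rewrite mulrC; apply: has_sum_ext (has_sumZ (qpow (h + k%:R) t) (has_sum_fiber_sum u k he)) => x /=.
by case: eqP => [->|_]; rewrite ?mulr0 // mulrC.
Qed.

End IntegerSeries.

(** This and [abs_le_prod] supply the bound [|n| <= e n] that [int_series] requires of the exponents
    of the [lam] and [mu] series. *)
Lemma abs_le_quad (n D x : int) : `|x| < D -> `|n| <= n * (n * D + x).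
Proof.
move=> hx; have [h|h|->] := ltgtP n 0; last by rewrite mul0r.
  have h1 : n * D <= - D by move: h hx; clear; nia.
  have h2 : n * D + x <= -1 by move: h1 hx; clear; lia.
  by move: (n * D + x) h2 h => y; clear; nia.
have h1 : D <= n * D by move: h hx; clear; nia.
have h2 : 1 <= n * D + x by move: h1 hx; clear; lia.
by move: (n * D + x) h2 h => y; clear; nia.
Qed.

Lemma abs_le_prod (n a b x y : int) : 0 < x < a -> 0 < y < b -> `|n| <= (n * b + y) * (n * a + x).
Proof.
move=> hx hy; have [h|h] := ltP n 0.
  have h1 : n * b + y <= -1.
    have : n * b <= - b by move: h hy; clear; nia.
    by move: hy; clear; lia.
  have h2 : n * a + x <= n.
    have : n * a <= n + 1 - a by move: h hx; clear; nia.
    by move: hx; clear; lia.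
  by move: (n * b + y) (n * a + x) h1 h2 h => u v; clear; nia.
have h1 : 1 <= n * b + y by move: h hy; clear; nia.
have h2 : n <= n * a + x by move: h hx; clear; nia.
by move: (n * b + y) (n * a + x) h1 h2 h => u v; clear; nia.
Qed.

Section Characters.
Variable R : realType.
Local Notation C := (Cplx R).
Local Notation eta := (@Defs.eta R).
Variables p p' : nat.
Hypotheses (hp : (2 <= p)%N) (hp' : (2 <= p')%N) (hpp' : coprime p p').
Local Notation N := (level p p').
Local Notation lam := (theta_lam p p').
Local Notation mu := (theta_mu p p').
Local Notation coset_theta := (@coset_theta R p p').
Local Notation ch := (@minimal_char R p p').

Lemma exponentE (n y : int) (z : R) : z = y%:~R ->
  (2 * n%:~R * p%:R * p'%:R + z) ^+ 2 / (4 * p%:R * p'%:R) = 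
  (n * N.+1%:Z + y)%:~R ^+ 2 / (2 * N.+1%:R) :> R.
Proof.
move=> ->; rewrite levelE // rmorphD rmorphM /= -pmulrn !natrM.
by congr (_ ^+ 2 / _); ring.
Qed.

Lemma eta_minimal_char r s t : uhp t ->
  eta t * ch r s t = coset_theta (lam r s) t - coset_theta (mu r s) t.
Proof.
move=> ht; rewrite /minimal_char mulrA mulfV ?eta_neq0 // mul1r.
have sm y := summ_inj (@coset_inj p p' y) (summ_qtheta N ht).
have E n : qpow ((2 * n%:~R * p%:R * p'%:R + p'%:R * r%:R - p%:R * s%:R) ^+ 2 / (4 * p%:R * p'%:R)) t
    - qpow ((2 * n%:~R * p%:R * p'%:R + p'%:R * r%:R + p%:R * s%:R) ^+ 2 / (4 * p%:R * p'%:R)) t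
    = qtheta N (n * N.+1%:Z + lam r s) t + (-1) * qtheta N (n * N.+1%:Z + mu r s) t :> C.
  rewrite mulN1r /qtheta -!addrA (exponentE n (y := lam r s)); last first.
    by rewrite /theta_lam rmorphB !rmorphM.
  by rewrite (exponentE n (y := mu r s)) // /theta_mu rmorphD !rmorphM.
rewrite (funext E); apply: has_sum_sumZ.
  exact: summD (sm (lam r s)) (summZ (-1) (sm (mu r s))).
have h := has_sumD (coset_theta_has_sum p p' (lam r s) ht) (has_sumZ (-1) (coset_theta_has_sum p p' (mu r s) ht)).
by rewrite mulN1r in h.
Qed.

Lemma theta_minimal_char r s t : uhp t -> theta N (char_coef p p' C r s) t = 2 * (eta t * ch r s t).
Proof. by move=> ht; rewrite theta_char_coef // eta_minimal_char. Qed.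

(** Numerator and eta are inverted separately; the factors at [t / 2pp'] and [t / 12] agree up to
    the constant [c'] and cancel. *)
Lemma char_modS r s : exists rho : 'I_p.-1 * 'I_p'.-1 -> C, forall t, uhp t ->
  ch r s (modS t) = \sum_i rho i * minimal_chars i t.
Proof.
have [c c0 hc] := eta_modS R.
have L0 : 0 < N.+1%:R^-1 :> R by rewrite invr_gt0.
have T0 : 0 < 12^-1 :> R by rewrite invr_gt0.
have [c' _ hc'] := gauss_factor_ratio L0 T0.
pose F := fourier N (char_coef p p' C r s).
have hd := char_coef_omega_odd hp hp' hpp' C r s.
have hF : omega_odd hpp' F := fourier_omega_odd hp hp' hd.
(* [c] and [c'] come from eta and from the ratio of factors. In [E1] the left side carries the
   factor 4 and the right side the factor 2, which leaves [1/2]. *)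
exists (fun i : 'I_p.-1 * 'I_p'.-1 => c' / (2 * c) * F (lam i.1.+1 i.2.+1)) => t ht.
have hper : periodic_mod N (char_coef p p' C r s) by case: hd.
have n2 : 2 != 0 :> C by rewrite pnatr_eq0.
have E1 : 2 * (2 * (eta (modS t) * ch r s (modS t))) =
    gauss_factor (rc N.+1%:R^-1 * t) * \sum_(i : 'I_p.-1 * 'I_p'.-1) F (lam i.1.+1 i.2.+1) * (2 * (eta t * minimal_chars i t)).
  rewrite -(theta_minimal_char r s (uhp_modS ht)) (theta_modS hper ht) mulrCA -/F.
  rewrite (theta_omega_odd hp hp' hF ht); congr (_ * _).
  by apply: eq_bigr => i _; rewrite theta_minimal_char.
have g0 : gauss_factor (rc 12^-1 * t) != 0 by apply: gauss_factor_neq0; exact: uhp_scale.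
have e0 := eta_neq0 ht.
move: E1; rewrite hc // hc' //; move: (gauss_factor _) g0 => g g0.
have -> : \sum_(i : 'I_p.-1 * 'I_p'.-1) F (lam i.1.+1 i.2.+1) * (2 * (eta t * minimal_chars i t)) =
   2 * eta t * \sum_(i : 'I_p.-1 * 'I_p'.-1) F (lam i.1.+1 i.2.+1) * minimal_chars i t.
  by rewrite mulr_sumr; apply: eq_bigr => i _; ring.
under [X in _ -> _ = X]eq_bigr => i _ do rewrite -mulrA.
rewrite -mulr_sumr; move: (\sum_i _) (ch r s (modS t)) => S x; move: (eta t) e0 => e e0 E.
apply: (mulfI (_ : 2 * (2 * (c * g * e)) != 0)); first by rewrite !mulf_neq0.
rewrite -!mulrA in E *; rewrite E; by field.
Qed.

Lemma lam_bound r s : (0 < r < p)%N -> (0 < s < p')%N -> (`|lam r s| < p * p')%N.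
Proof. by rewrite /theta_lam; move: hp hp'; clear; nia. Qed.

Definition hpow (r s : nat) : R := (lam r s)%:~R ^+ 2 / (2 * N.+1%:R).

Lemma isQS_coset_theta_lam r s : (0 < r < p)%N -> (0 < s < p')%N -> isQS (hpow r s) 1 (coset_theta (lam r s)).
Proof.
move=> hr hs; pose e (n : int) := absz (n * (n * p%:Z * p'%:Z + lam r s)).
have l := lam_bound hr hs.
have key n : `|n| <= n * (n * p%:Z * p'%:Z + lam r s).
  by rewrite -[n * p%:Z * _]mulrA; apply: abs_le_quad; rewrite -PoszM -abszE ltz_nat.
have pos n : (e n)%:Z = n * (n * p%:Z * p'%:Z + lam r s).
  by rewrite /e gez0_abs //; apply: le_trans (key n).
have he n : (`|n| <= e n)%N by rewrite -lez_nat pos abszE.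
have hu (n : int) : nm ((fun=> 1) n : C) <= 1 by rewrite nm1.
have [ds qs] := int_series (hpow r s) he hu.
exists (fiber_sum (fun=> 1) e); split=> //.
  by rewrite /fiber_sum big_ord1 /e /= mul0r.
apply: qs => t ht; apply: has_sum_ext (coset_theta_has_sum p p' (lam r s) ht) => n.
rewrite mul1r /qtheta.
have L0 : p%:R != 0 :> R by rewrite pnatr_eq0; move: hp; clear; lia.
have L0' : p'%:R != 0 :> R by rewrite pnatr_eq0; move: hp'; clear; lia.
suff -> : (n * N.+1%:Z + lam r s)%:~R ^+ 2 / (2 * N.+1%:R) = hpow r s + (e n)%:R :> R by [].
have -> : (e n)%:R = (n * (n * p%:Z * p'%:Z + lam r s))%:~R :> R by rewrite -pos.
rewrite /hpow !(rmorphM, rmorphD) /= -!pmulrn levelE // !natrM.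
move: (_%:~R) L0 L0' => x; move: (p%:R : R) (p'%:R : R) ((lam r s)%:~R : R) => a b y a0 b0.
by field; rewrite a0 b0.
Qed.

(** [(2npp' + mu)^2 - lam^2 = 4pp' (np' + s)(np + r)], and this product is positive for every [n].
    So the [mu] series contributes nothing at the leading exponent [lam^2 / 4pp']. *)
Lemma isQS_coset_theta_mu r s : (0 < r < p)%N -> (0 < s < p')%N -> isQS (hpow r s) 0 (coset_theta (mu r s)).
Proof.
move=> hr hs; pose e (n : int) := absz ((n * p'%:Z + s%:Z) * (n * p%:Z + r%:Z)).
have key n : `|n| <= (n * p'%:Z + s%:Z) * (n * p%:Z + r%:Z) by apply: abs_le_prod.
have pos n : (e n)%:Z = (n * p'%:Z + s%:Z) * (n * p%:Z + r%:Z).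
  by rewrite /e gez0_abs //; apply: le_trans (key n).
have he n : (`|n| <= e n)%N by rewrite -lez_nat pos abszE.
have hu (n : int) : nm ((fun=> 1) n : C) <= 1 by rewrite nm1.
have [ds qs] := int_series (hpow r s) he hu.
exists (fiber_sum (fun=> 1) e); split=> //.
  rewrite /fiber_sum big_ord1 /= subrr; have -> : e 0 = (s * r)%N by rewrite /e !mul0r !add0r abszM.
  by case: eqP => //; move: hr hs; clear; nia.
apply: qs => t ht; apply: has_sum_ext (coset_theta_has_sum p p' (mu r s) ht) => n.
rewrite mul1r /qtheta.
have L0 : p%:R != 0 :> R by rewrite pnatr_eq0; move: hp; clear; lia.
have L0' : p'%:R != 0 :> R by rewrite pnatr_eq0; move: hp'; clear; lia.
suff -> : (n * N.+1%:Z + mu r s)%:~R ^+ 2 / (2 * N.+1%:R) = hpow r s + (e n)%:R :> R by [].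
have -> : (e n)%:R = ((n * p'%:Z + s%:Z) * (n * p%:Z + r%:Z))%:~R :> R by rewrite -pos.
rewrite /hpow /theta_lam /theta_mu !(rmorphB, rmorphM, rmorphD) /= -!pmulrn levelE // !natrM.
move: (_%:~R) L0 L0' => x; move: (p%:R : R) (p'%:R : R) (r%:R : R) (s%:R : R) => a b y z a0 b0.
by field; rewrite a0 b0.
Qed.

Lemma isQS_minimal_char r s : (0 < r < p)%N -> (0 < s < p')%N ->
  isQS (hpow r s - 24^-1) 1 (ch r s).
Proof.
move=> hr hs.
have h := isQSM (isQS_eta_inv R) (isQSD (isQS_coset_theta_lam hr hs) (isQSZ (-1) (isQS_coset_theta_mu hr hs))).
apply: isQS_ext (isQS_eq _ _ h).
- move=> t ht /=; rewrite mulN1r -eta_minimal_char // mulrA mulVf ?mul1r //; exact: eta_neq0.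
- by rewrite addrC.
- by rewrite mulr0 addr0 mulr1.
Qed.

End Characters.

(** * Forms on the modular group *)

Section ModularGroup.
Variable R : realType.
Local Notation C := (Cplx R).
Implicit Types (t z : C).
Variable F : C -> C.
Hypothesis FT : forall t, uhp t -> F (t + 1) = F t.

Lemma uhp_addz t (n : int) : uhp t -> uhp (t + n%:~R).
Proof. by move=> ht; rewrite -(rmorph_int (@rc R)); exact: uhp_shift. Qed.

Lemma shift_invariant t (n : int) : uhp t -> F (t + n%:~R) = F t.
Proof.
have pos (k : nat) : forall z, uhp z -> F (z + k%:R) = F z.
  elim: k => [|k IH] z hz; first by rewrite addr0.
  by rewrite -natr1 addrA FT ?IH // -[k%:R]/(k%:Z%:~R); exact: uhp_addz.
move=> ht; case: n => n; first exact: pos.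
rewrite -(pos n.+1 (t + (Negz n)%:~R)); last exact: uhp_addz.
by rewrite NegzE rmorphN /= subrK.
Qed.

Lemma shift_im t (n : int) : im (t + n%:~R) = im t.
Proof. by rewrite -(rmorph_int (@rc R)) imD im_rc addr0. Qed.

Section Weight.
Variable m : nat.
Hypothesis FS : forall t, uhp t -> F (modS t) = t ^+ m.*2 * F t.

Lemma cz_neq0 t (c d : int) : uhp t -> (c != 0) || (d != 0) -> c%:~R * t + d%:~R != 0.
Proof.
move=> ht h; apply/eqP => E.
have := congr1 (@im R) E; have := congr1 (@re R) E.
rewrite -!(rmorph_int (@rc R)) !(reD, imD, reM, imM, re_rc, im_rc, re0, im0) !mul0r !addr0 subr0 /=.
move=> E1 /eqP; rewrite mulf_eq0 (gt_eqF ht) orbF intr_eq0 => /eqP c0.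
move: E1 h; rewrite c0 mul0r add0r eqxx /= => /eqP; rewrite intr_eq0 => /eqP ->.
by rewrite eqxx.
Qed.

(** Euclidean descent on [|c|]. With [d = q c + r], the matrix is the product of one with lower row
    [(r, -c)], the inversion and the translation by [q]. At [c = 0] one has [a = d = 1] or
    [a = d = -1], and the even weight hides the sign. *)
Lemma weakly_modular_of_generators : weakly_modular (m.*2)%:Z F.
Proof.
move=> a b c d; have [n] := ubnP (absz c).
elim: n a b c d => // n IH a b c d; rewrite ltnS => cn D t ht.
rewrite -exprnP.
have [c0|c0] := eqVneq c 0.
  have D' : a * d = 1 by rewrite -D c0 mulr0 subr0.
  have : (d == 1) || (d == -1).
    have : `|d|%N = 1%N.
      have : (`|a| * `|d| = 1)%N by rewrite -abszM D'.
      by move/eqP; rewrite muln_eq1 => /andP[_ /eqP].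
    by clear; lia.
  rewrite c0 mul0r add0r => /orP[] /eqP d1; move: D'; rewrite d1.
    rewrite mulr1 => ->; rewrite !mul1r divr1 expr1n mul1r; exact: shift_invariant.
  rewrite mulrN1 => /eqP; rewrite eqr_oppLR => /eqP ->.
  have -> : ((-1)%:~R * t + b%:~R) / (-1)%:~R = t + (- b)%:~R :> C.
    by rewrite !rmorphN /=; field.
  by rewrite shift_invariant // rmorphN /= -mul2n exprM sqrrN !expr1n mul1r.
set q := (d %/ c)%Z; pose r := (d %% c)%Z; pose b' := b - a * q.
have dE : d = q * c + r by exact: divz_eq.
have t1 := uhp_addz q ht; set z := t + q%:~R in t1.
have hz := uhp_modS t1; have z0 := uhp_neq0 t1.
have D' : b' * - c - - a * r = 1.
  by rewrite -D /b' [in RHS]dE; ring.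
have rc_lt : (`|r| < n)%N.
  by apply: leq_trans cn; rewrite -ltz_nat !abszE ger0_norm ?modz_ge0 // ltz_mod.
have := IH _ _ _ _ rc_lt D' _ hz; rewrite -exprnP FS //.
have cd0 : c%:~R * t + d%:~R != 0 by apply: cz_neq0; rewrite ?c0.
have E1 : c%:~R * t + d%:~R = c%:~R * z + r%:~R :> C.
  by rewrite dE /z !(rmorphD, rmorphM) /=; ring.
have E2 : a%:~R * t + b%:~R = a%:~R * z + b'%:~R :> C.
  by rewrite /b' /z !(rmorphB, rmorphM) /=; ring.
rewrite E1 in cd0 *; rewrite E2 /modS !rmorphN /=.
have E3 : r%:~R * - z^-1 - c%:~R = - (c%:~R * z + r%:~R) / z :> C by field.
rewrite E3 => E; rewrite -[RHS]mul1r.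
have -> : (a%:~R * z + b'%:~R) / (c%:~R * z + r%:~R) = (b'%:~R * - z^-1 - a%:~R) / (- (c%:~R * z + r%:~R) / z).
  have -> : b'%:~R * - z^-1 - a%:~R = - (a%:~R * z + b'%:~R) / z :> C by field.
  by rewrite !mulNr invrN mulrN opprK invfM invrK mulrACA mulVf // mulr1.
rewrite E mul1r mulrA -exprMn divfK // -mul2n exprM sqrrN -exprM.
by rewrite -/z shift_invariant.
Qed.

End Weight.

Hypothesis FS : forall t, uhp t -> F (modS t) = F t.

(* If im t < 1/2 and |re t| <= 1/2 then |t|^2 < 1/2, so that t -> -1/t doubles
   the imaginary part. *)
Lemma raise_im n t : 2^-1 ^+ n.+1 <= im t -> exists2 t', 2^-1 <= im t' & F t' = F t.
Proof.
elim: n t => [|n IH] t ht; first by exists t; rewrite // -[2^-1]expr1.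
have it0 : 0 < im t by apply: lt_le_trans ht; rewrite exprn_gt0 // invr_gt0.
have hu : uhp t by [].
have [h|h] := leP 2^-1 (im t); first by exists t.
pose k := Num.floor (re t + 2^-1); pose z := t + (- k)%:~R.
have hz : uhp z := uhp_addz _ hu.
have iz : im z = im t by exact: shift_im.
have rz : `|re z| <= 2^-1.
  have -> : re z = re t - k%:~R by rewrite /z -(rmorph_int (@rc R)) reD re_rc rmorphN.
  have := floor_le_tmp (re t + 2^-1); have := floorD1_gt (re t + 2^-1); rewrite -/k rmorphD /=.
  by move=> h1 h2; rewrite ler_norml; apply/andP; split; move: h1 h2; clear; lra.
suff hb : 2^-1 ^+ n.+1 <= im (modS z).
  by have [t' h1 h2] := IH _ hb; exists t' => //; rewrite h2 FS // shift_invariant.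
rewrite im_modS iz ler_pdivlMr; last first.
  by rewrite -iz; apply: uhp_norm2_gt0.
have e1 : re z ^+ 2 <= 2^-1 ^+ 2.
  by rewrite -real_normK ?num_real // lerXn2r // nnegrE.
have e2 : im t ^+ 2 <= 2^-1 ^+ 2 by rewrite lerXn2r ?nnegrE // ltW.
apply: (@le_trans _ _ (2^-1 ^+ n.+1 * 2^-1)); last by rewrite -exprSr.
rewrite ler_pM2l ?exprn_gt0 ?invr_gt0 //.
by move: e1 e2; clear; lra.
Qed.

Lemma invariant_bounded (B : R) : (forall t, 2^-1 <= im t -> nm (F t) <= B) ->
  forall t, uhp t -> nm (F t) <= B.
Proof.
move=> hB t ht.
have [n hn] : exists n, 2^-1 ^+ n.+1 <= im t.
  have h12 : 0 < (2^-1 : R) < 1 by apply/andP; split; [rewrite invr_gt0 | rewrite invf_lt1 // ltr1n].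
  have [n hn] := expr_small h12 ht; exists n; apply: ltW; exact: hn.
by have [t' h1 <-] := raise_im hn; exact: hB.
Qed.

(** For [rho <= 4/9] the geometric sum [rho / (1 - rho)] is at most [4/5], the contraction factor in
    [invariant_eq0]. *)
Lemma rho_bound : expR (- (pi / 2)) <= 4 / 9 :> R.
Proof.
have h1 : 3 / 2 <= expR (pi / 4) :> R.
  apply: le_trans (expR_ge1Dx _); have := pi_ge2 R; lra.
have h2 : 9 / 4 <= expR (pi / 2) :> R.
  have -> : pi / 2 = pi / 4 + pi / 4 :> R by lra.
  rewrite expRD; move: (expR _) h1 => x h1; nra.
by rewrite expRN -[leRHS]invrK lef_pV2 ?posrE ?expR_gt0 ?invr_gt0 //; lra.
Qed.

(* A bound B for |F| at height 1/4 bounds the coefficients, and so improves to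
   4/5 B for im t >= 1/2, hence everywhere by invariance. *)
Lemma invariant_eq0 : isQS 0 0 F -> forall t, uhp t -> F t = 0.
Proof.
move=> [a [ha a0 hf]].
have i2 (t : C) : 2^-1 <= im t -> uhp t by move=> h; apply: lt_le_trans h; rewrite invr_gt0.
have qle (t : C) : 2^-1 <= im t -> qabs t <= expR (- pi).
  move=> h; rewrite /qabs ler_expR lerN2.
  have := pi_gt0 R; move: h; move: (im t) (pi : R) => y P; clear; nra.
(* The initial bound: absolute convergence at radius [expR (- pi)] controls [F] for [im t >= 1/2],
   and invariance extends this to the half-plane. *)
have [K hK] : exists K, forall t, uhp t -> nm (F t) <= K.
  have r01 : 0 < (expR (- pi) : R) < 1 by rewrite expR_gt0 /= expR_lt1 oppr_lt0 pi_gt0.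
  have [K hK] := ha _ r01; exists K; apply: invariant_bounded => t ht.
  apply: (has_sum_le (hf _ (i2 _ ht))); apply: bounded_sums_le hK => n.
  rewrite nmM nm_qpow_nat qpow0 nm1 mul1r ler_wpM2l // lerXn2r ?nnegrE ?expR_ge0 //.
  exact: qle.
have K0 : 0 <= K.
  have hi : uhp (ii R) by rewrite uhpE im_ii.
  exact: le_trans (nm_ge0 _) (hK _ hi).
have step B : 0 <= B -> (forall t, uhp t -> nm (F t) <= B) -> forall t, uhp t -> nm (F t) <= B * (4 / 5).
  move=> B0 hB; apply: invariant_bounded => t ht.
  have y0 : 0 < 4^-1 :> R by rewrite invr_gt0.
  have hy (z : C) : im z = 4^-1 -> nm (F z) <= B by move=> hz; apply: hB; rewrite uhpE hz.
  have est := cauchy_estimate ha hf y0 hy.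
  pose rho : R := expR (- (pi / 2)).
  have rho0 : 0 < rho := expR_gt0 _.
  have rho1 := rho_bound; rewrite -/rho in rho1.
  (* The largest [qabs] at height at least 1/2 is the square of its value at height 1/4. One factor
     is used up by the Cauchy estimate; the other makes the n-th term at most [B rho^n], and the sum
     starts at [n = 1]. *)
  have rhoE : expR (- pi) = expR (- (2 * pi * 4^-1)) * rho.
    by rewrite /rho -expRD; congr expR; field.
  clearbody rho.
  have rho01 : 0 < rho < 1 by rewrite rho0 /=; apply: le_lt_trans rho1 _; lra.
  pose b (n : nat) : R := if n is n'.+1 then B * rho * rho ^+ n' else 0.
  have hb : bounded_sums b (B * rho * (1 - rho)^-1).
    apply: (bounded_sums_extend succn_inj) => [[|n] // h|]; first by case: (h n).
    by apply: bounded_sumsZ; [rewrite mulr_ge0 // ltW | exact: bounded_sums_geom].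
  apply: le_trans (_ : B * rho * (1 - rho)^-1 <= _).
    apply: (has_sum_le (hf _ (i2 _ ht))); apply: bounded_sums_le hb.
    case=> [|n]; first by rewrite a0 mul0r nm0.
    rewrite nmM nm_qpow_nat qpow0 nm1 mul1r /b -mulrA -exprS.
    have e := est n.+1.
    apply: (@le_trans _ _ (nm (a n.+1) * expR (- pi) ^+ n.+1)).
      by rewrite ler_wpM2l // lerXn2r ?nnegrE ?expR_ge0 //; exact: qle.
    rewrite rhoE exprMn mulrA ler_wpM2r // exprn_ge0 //; exact: ltW.
  rewrite -mulrA ler_wpM2l // ler_pdivrMr; last by case/andP: rho01 => _; rewrite subr_gt0.
  by lra.
have iter n : forall t, uhp t -> nm (F t) <= K * (4 / 5) ^+ n.
  elim: n => [|n IH]; first by rewrite expr0 mulr1.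
  move=> t ht; have K0' : 0 <= K * (4 / 5) ^+ n by rewrite mulr_ge0 // exprn_ge0 //; lra.
  by have := step _ K0' IH t ht; rewrite -[K * _ * _]mulrA -exprSr.
move=> t ht; apply: nm_lt_small => e e0.
have h45 : 0 < (4 / 5 : R) < 1 by apply/andP; split; lra.
have K1 : 0 < K + 1 by rewrite ltr_wpDl ?ltr01.
have [n hn] := expr_small h45 (divr_gt0 e0 K1).
apply: (le_trans (iter n t ht)).
have := hn n (leqnn n); rewrite ltr_pdivlMr // => h.
have x0 : 0 <= (4 / 5 : R) ^+ n by rewrite exprn_ge0 //; lra.
by move: h x0 K0; move: (_ ^+ n) => x; clear; nra.
Qed.

End ModularGroup.

Lemma invariant_constant (R : realType) (F : Cplx R -> Cplx R) c : isQS 0 c F ->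
  (forall t, uhp t -> F (modS t) = F t) -> forall t, uhp t -> F t = c.
Proof.
move=> hF FS t ht; apply/eqP; rewrite -subr_eq0; apply/eqP.
have h : isQS 0 0 (fun t => F t - c).
  apply: isQS_eq (isQSD hF (isQS_cst (- c))) => //; exact: subrr.
apply: (invariant_eq0 (F := fun t => F t - c)) h _ ht => z hz.
  by rewrite (isQS_shift hF hz) ez0 mul1r.
by rewrite FS.
Qed.

(** * Wronskians *)

Section Holomorphic.
Variable R : realType.
Local Notation C := (Cplx R).
Local Notation hol := (@hol R).
Implicit Types (f g : C -> C) (t : C).

Definition smooth f := forall j, hol (iter j (@Dq R) f).

Lemma isQS_smooth h c f : isQS h c f -> smooth f.
Proof.
by move=> hf j t ht; eexists; exact: isQS_derivable (isQS_iter_Dq j hf) ht.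
Qed.

Lemma smooth_Dq f : smooth f -> smooth (Dq f).
Proof. by move=> hf j; rewrite -iterSr; exact: hf. Qed.

Lemma hol_cd f t : hol f -> uhp t -> cd f t (two_pi_i R * Dq f t).
Proof. by move=> hf ht; have [d hd] := hf t ht; exact: derivable_cd (cd_derivable hd). Qed.

Lemma iter_Dq_linear (I : finType) (c : I -> C) (e : I -> C -> C) f :
  (forall i, smooth (e i)) -> (forall t, uhp t -> f t = \sum_i c i * e i t) ->
  forall j t, uhp t -> iter j (@Dq R) f t = \sum_i c i * iter j (@Dq R) (e i) t.
Proof.
move=> he hf; elim=> [|j IH] t ht //=; first exact: hf.
have h : cd (iter j (@Dq R) f) t (\sum_i c i * (two_pi_i R * Dq (iter j (@Dq R) (e i)) t)).
  apply: (cd_ext_uhp ht IH); apply: cd_sum => i _; apply: cdZ.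
  exact: hol_cd (he i j) ht.
rewrite (cd_Dq h) mulr_sumr; apply: eq_bigr => i _.
by rewrite mulrCA mulKf // two_pi_i_neq0.
Qed.

Lemma hol_sum I (r : seq I) (P : pred I) (f : I -> C -> C) :
  (forall i, P i -> hol (f i)) -> hol (fun t => \sum_(i <- r | P i) f i t).
Proof.
move=> hf t ht; exists (\sum_(i <- r | P i) two_pi_i R * Dq (f i) t).
by apply: cd_sum => i Pi; exact: hol_cd (hf i Pi) ht.
Qed.

Lemma hol_mul f g : hol f -> hol g -> hol (fun t => f t * g t).
Proof. by move=> hf hg t ht; eexists; exact: cdM (hol_cd hf ht) (hol_cd hg ht). Qed.

Lemma hol_cst (c : C) : hol (fun=> c).
Proof. by move=> t _; exists 0; exact: cd_cst. Qed.

Lemma hol_prod I (r : seq I) (P : pred I) (f : I -> C -> C) :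
  (forall i, P i -> hol (f i)) -> hol (fun t => \prod_(i <- r | P i) f i t).
Proof.
move=> hf; elim: r => [|i r IH].
  by have := hol_cst 1; congr hol; apply/funext => t; rewrite big_nil.
case Pi: (P i).
  have := hol_mul (hf i Pi) IH; congr hol; apply/funext => t; by rewrite big_cons Pi.
by move: IH; congr hol; apply/funext => t; rewrite big_cons Pi.
Qed.

Lemma hol_det n (M : 'I_n -> 'I_n -> C -> C) : (forall i j, hol (M i j)) ->
  hol (fun t => \det (\matrix_(i, j) M i j t)).
Proof.
move=> hM.
have -> : (fun t => \det (\matrix_(i, j) M i j t)) =
    (fun t => \sum_(s : 'S_n) (-1) ^+ s * \prod_i M i (s i) t).
  apply/funext => t; apply: eq_bigr => s _; congr (_ * _).
  by apply: eq_bigr => i _; rewrite mxE.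
apply: hol_sum => s _; apply: hol_mul; first exact: hol_cst.
by apply: hol_prod.
Qed.

Lemma hol_inv f : hol f -> (forall t, uhp t -> f t != 0) -> hol (fun t => (f t)^-1).
Proof. by move=> hf f0 t ht; eexists; exact: cdV (f0 t ht) (hol_cd hf ht). Qed.

(** The exponent depends on the column only, so all terms of the Leibniz expansion share the
    exponent [\sum_j h j], and their leading coefficients assemble to a determinant. *)
Lemma isQS_det n (M : 'I_n -> 'I_n -> C -> C) (h : 'I_n -> R) (c : 'I_n -> 'I_n -> C) :
  (forall i j, isQS (h j) (c i j) (M i j)) ->
  isQS (\sum_j h j) (\det (\matrix_(i, j) c i j)) (fun t => \det (\matrix_(i, j) M i j t)).
Proof.
move=> hM; rewrite /determinant.
have -> : (fun t => \sum_(s : 'S_n) (-1) ^+ s * \prod_i (\matrix_(i, j) M i j t) i (s i)) =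
    (fun t => \sum_(s : 'S_n) (-1) ^+ s * \prod_i M i (s i) t).
  apply/funext => t; apply: eq_bigr => s _; congr (_ * _).
  by apply: eq_bigr => i _; rewrite mxE.
apply: isQS_sum => s _; apply: isQSZ.
have -> : \sum_j h j = \sum_j h (s j) by rewrite (reindex_inj (@perm_inj _ s)).
have -> : \prod_i (\matrix_(i, j) c i j) i (s i) = \prod_i c i (s i).
  by apply: eq_bigr => i _; rewrite mxE.
by apply: isQS_prod.
Qed.

Lemma cd_expN n t : uhp t -> cd (fun z => z ^- n) t (- n%:R * t ^- n.+1).
Proof.
move=> ht; have t0 := uhp_neq0 ht; case: n => [|n].
  rewrite oppr0 mul0r; have -> : (fun z : C => z ^- 0) = (fun=> 1).
    by apply/funext => z; rewrite expr0 invr1.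
  exact: cd_cst.
have tn0 : t ^+ n.+1 != 0 by rewrite expf_neq0.
have h := cdV (f := fun z => z ^+ n.+1) tn0 (cdX n (cd_id t)).
suff -> : - n.+1%:R * t ^- n.+2 = - (t ^+ n.+1) ^- 2 * (n.+1%:R * t ^+ n * 1) by [].
rewrite !exprS expr0; move: (t ^+ n) (expf_neq0 n t0) => u u0; field.
by rewrite u0 t0.
Qed.

(* The coefficients in
   D^j (f o S) (t) = sum_k modS_coef j k * t^-(j+k) * (D^k f) (S t). *)
Fixpoint modS_coef (j k : nat) : C :=
  if j is j'.+1 then (if k is k'.+1 then modS_coef j' k' else 0)
     - (two_pi_i R)^-1 * (j' + k)%:R * modS_coef j' k
  else (k == 0)%N%:R.

Lemma modS_coef_gt j k : (j < k)%N -> modS_coef j k = 0.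
Proof.
elim: j k => [|j IH] [|k] //= jk.
by rewrite !IH ?mulr0 ?subr0 // ltnW.
Qed.

Lemma modS_coef_diag j : modS_coef j j = 1.
Proof. by elim: j => [|j IH] //=; rewrite IH modS_coef_gt // mulr0 subr0. Qed.

(** A positive-order derivative of [f o S] involves only derivatives of [f]. Hence the Wronskian of
    the derivatives is transformed by a triangular matrix of its own. *)
Lemma modS_coefS0 j : modS_coef j.+1 0 = 0.
Proof.
elim: j => [|j IH]; first by rewrite /= addn0 mulr0 mul0r subr0.
by rewrite -[LHS]/(0 - (two_pi_i R)^-1 * (j.+1 + 0)%:R * modS_coef j.+1 0) IH mulr0 subr0.
Qed.

(** The length [n] is any number above [j], the extra coefficients being 0, so that all rows of a
    Wronskian matrix can be written with the same length. *)
Lemma iter_Dq_modS f g : smooth f -> (forall t, uhp t -> g t = f (modS t)) ->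
  forall j n t, (j < n)%N -> uhp t -> iter j (@Dq R) g t =
    \sum_(k < n) modS_coef j k * (t ^- (j + k) * iter k (@Dq R) f (modS t)).
Proof.
move=> hf hg; elim=> [|j IH] [//|n] t jn ht.
  rewrite big_ord_recl big1 /= => [|i _]; last by rewrite mul0r.
  by rewrite hg // addn0 expr0 invr1 !mul1r addr0.
have hSt := uhp_modS ht; have t0 := uhp_neq0 ht.
pose d k := modS_coef j k * (- (j + k)%:R * t ^- (j + k).+1 * iter k (@Dq R) f (modS t) +
   t ^- (j + k) * (two_pi_i R * iter k.+1 (@Dq R) f (modS t) * t ^- 2)).
have h : cd (iter j (@Dq R) g) t (\sum_(k < n) d k).
  apply: (cd_ext_uhp ht (fun z hz => IH n z jn hz)); apply: cd_sum => k _.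
  apply: cdZ; apply: cdM; first exact: cd_expN.
  exact: cd_comp (cd_modS ht) (hol_cd (hf k) hSt).
rewrite iterS (cd_Dq h) mulr_sumr.
have E k : (two_pi_i R)^-1 * d k =
   - ((two_pi_i R)^-1 * (j + k)%:R * modS_coef j k) * (t ^- (j.+1 + k) * iter k (@Dq R) f (modS t)) +
   modS_coef j k * (t ^- (j.+1 + k.+1) * iter k.+1 (@Dq R) f (modS t)).
  rewrite /d !addSn addnS !exprS -/(iter k.+1 (@Dq R) f).
  move: (iter k.+1 _ _ _) (iter k _ _ _) (modS_coef _ _) (t ^+ _) (expf_neq0 (j + k) t0) => x y c u u0.
  have p0 := two_pi_i_neq0 R; move: (two_pi_i R) p0 => P p0.
  by rewrite expr0; field; rewrite u0 t0 p0.
under eq_bigr => k _ do rewrite E.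
rewrite big_split /=; under [RHS]eq_bigr => k _ do rewrite mulrBl.
rewrite sumrB /= addrC; congr (_ + _).
  by rewrite [RHS]big_ord_recl /= mul0r add0r.
rewrite -sumrN big_ord_recr /= modS_coef_gt // mulr0 mul0r oppr0 addr0.
by apply: eq_bigr => k _; rewrite mulNr.
Qed.

End Holomorphic.

Section Wronskian.
Variable R : realType.
Local Notation C := (Cplx R).
Local Notation hol := (@hol R).
Local Notation D := (@Dq R).
Variable m : nat.
Implicit Types (e f : 'I_m -> C -> C).

Lemma wronskian_linear (A : 'M[C]_m) f e t : (forall i, smooth (e i)) ->
  (forall i t, uhp t -> f i t = \sum_k A i k * e k t) -> uhp t ->
  wronskian f t = \det A * wronskian e t.
Proof.
move=> he hf ht; rewrite mulrC -(det_tr A) -det_mulmx; congr (\det _).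
apply/matrixP => j i; rewrite !mxE (iter_Dq_linear he (hf i)) //.
by apply: eq_bigr => k _; rewrite !mxE mulrC.
Qed.

Lemma wronskian_Dq_linear (A : 'M[C]_m) f e t : (forall i, smooth (e i)) ->
  (forall i t, uhp t -> f i t = \sum_k A i k * e k t) -> uhp t ->
  wronskian (fun i => D (f i)) t = \det A * wronskian (fun i => D (e i)) t.
Proof.
move=> he hf; apply: wronskian_linear => [i|i z hz]; first exact: smooth_Dq.
exact: (iter_Dq_linear he (hf i) 1).
Qed.

Definition wronskian_weight : nat := \sum_(k < m) k.*2.

Variable (e : 'I_m -> C -> C) (P : 'M[C]_m).
Hypothesis he : forall i, smooth (e i).
Hypothesis hP : forall i t, uhp t -> e i (modS t) = \sum_j P i j * e j t.

(** The matrix is triangular with diagonal entries [t^-(2s + 2k)]. The shift [s = 0] serves the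
    Wronskian and [s = 1] that of the derivatives, which accounts for the additional weight [2m]. *)
Lemma modS_coef_det (s : nat) t : uhp t ->
  \det (\matrix_(j < m, k < m) (modS_coef R (s + j) (s + k) * t ^- ((s + j) + (s + k)))) =
  t ^- (wronskian_weight + m * s.*2).
Proof.
move=> ht; rewrite det_trig; last first.
  by apply/is_trig_mxP => i j ij; rewrite mxE modS_coef_gt ?mul0r // ltn_add2l.
rewrite (eq_bigr (fun k : 'I_m => t^-1 ^+ (s.*2 + k.*2))) => [|k _]; last first.
  by rewrite mxE modS_coef_diag mul1r exprVn addnn doubleD.
rewrite -expr_sum -exprVn; congr (_ ^+ _).
by rewrite big_split /= sum_nat_const card_ord addnC.
Qed.

Lemma wronskian_modS t : uhp t ->
  wronskian e (modS t) = t ^+ wronskian_weight * (\det P * wronskian e t).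
Proof.
move=> ht; have t0 := uhp_neq0 ht.
rewrite -(wronskian_linear (f := fun i z => e i (modS z)) he hP ht).
have := modS_coef_det 0 ht; rewrite muln0 addn0 => detL.
apply: (mulfI (invr_neq0 (expf_neq0 wronskian_weight t0))).
rewrite mulKf ?expf_neq0 // -detL -det_mulmx; congr (\det _).
apply/matrixP => j i; rewrite !mxE (iter_Dq_modS (he i) (fun _ _ => erefl) (ltn_ord j) ht).
by apply: eq_bigr => k _; rewrite !mxE mulrA.
Qed.

Lemma wronskian_Dq_modS t : uhp t ->
  wronskian (fun i => D (e i)) (modS t) =
  t ^+ (wronskian_weight + m.*2) * (\det P * wronskian (fun i => D (e i)) t).
Proof.
move=> ht; have t0 := uhp_neq0 ht.
rewrite -(wronskian_Dq_linear (f := fun i z => e i (modS z)) he hP ht).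
have := modS_coef_det 1 ht; rewrite muln2 => detL.
apply: (mulfI (invr_neq0 (expf_neq0 (wronskian_weight + m.*2) t0))).
rewrite mulKf ?expf_neq0 // -detL -det_mulmx; congr (\det _).
apply/matrixP => j i; rewrite !mxE -iterSr.
have jm : (j.+1 < m.+1)%N by rewrite ltnS.
rewrite (iter_Dq_modS (he i) (fun _ _ => erefl) jm ht) big_ord_recl modS_coefS0 mul0r add0r.
by apply: eq_bigr => k _; rewrite !mxE mulrA -iterSr.
Qed.

Lemma wronskian_Dq_eq0 (c : 'I_m -> C) : (forall t, uhp t -> \sum_i c i * e i t = 1) ->
  forall t, uhp t -> wronskian (fun i => D (e i)) t = 0.
Proof.
move=> hc t ht; apply/eqP; rewrite /wronskian -det_tr; apply/det0P.
exists (\row_i c i).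
  apply/eqP => c0; have := hc t ht; rewrite big1 => [/esym/eqP|i _]; first by rewrite oner_eq0.
  by have := congr1 (fun M : 'rV_m => M 0 i) c0; rewrite !mxE => ->; rewrite mul0r.
have D1 j : forall z, uhp z -> iter j D (D (fun=> 1)) z = 0.
  elim: j => [|j IH] z hz; first by rewrite /= (cd_Dq (cd_cst 1 z)) mulr0.
  rewrite iterS (cd_Dq (cd_ext_uhp hz IH (cd_cst 0 z))) mulr0 //.
apply/matrixP => i j; rewrite !mxE; apply: etrans (D1 j t ht); rewrite -iterSr.
have hc' z : uhp z -> (fun=> 1) z = \sum_i c i * e i z by move=> hz; rewrite hc.
rewrite (iter_Dq_linear he hc' j.+1 ht).
by apply: eq_bigr => k _; rewrite !mxE -iterSr.
Qed.

Hypothesis W0 : forall t, uhp t -> wronskian e t != 0.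

Let M (t : C) : 'M[C]_m := \matrix_(j, i) iter j D (e i) t.

Lemma wronskian_mx_inj t (v : 'cV[C]_m) : uhp t -> M t *m v = 0 -> v = 0.
Proof.
move=> ht h; have := W0 ht; rewrite -unitfE -/(M t) => u.
have uM : M t \in unitmx by rewrite unitmxE.
by rewrite -(mulKmx uM v) h mulmx0.
Qed.

(* At each point Cramer's rule gives the combination with value 1 all of whose
   first m - 1 derivatives vanish.  As the m-th derivative vanishes too, the
   derivative of the coefficients is killed by the Wronskian matrix. *)
Lemma wronskian_Dq_eq0_span : (0 < m)%N ->
  (forall t, uhp t -> wronskian (fun i => D (e i)) t = 0) ->
  exists c : 'I_m -> C, forall t, uhp t -> \sum_i c i * e i t = 1.
Proof.
move=> m0 hW; pose o : 'I_m := Ordinal m0.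
pose c i t : C := (wronskian e t)^-1 * cofactor (M t) o i.
pose cv t : 'cV[C]_m := \col_i c i t.
have Mc t : uhp t -> M t *m cv t = delta_mx o 0.
  move=> ht; have -> : cv t = (wronskian e t)^-1 *: (\adj (M t) *m delta_mx o 0).
    apply/matrixP => i j; rewrite !mxE (bigD1 o) //= big1 => [|k ko]; last first.
      by rewrite !mxE (negPf ko) mulr0.
    by rewrite !mxE !eqxx addr0 (ord1 j) eqxx mulr1.
  by rewrite -scalemxAr mulmxA mul_mx_adj mul_scalar_mx scalerA mulVf ?scale1r // W0.
have holM k i : hol (fun t => iter k D (e i) t) by exact: he.
have holc i : hol (c i).
  apply: hol_mul.
    apply: hol_inv; last exact: W0.
    by apply: hol_det => j k; exact: he.
  rewrite /cofactor; apply: hol_mul; first exact: hol_cst.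
  have := @hol_det R m.-1 (fun a b => iter (lift o a) D (e (lift i b))).
  move=> /(_ (fun a b => he _ _)); congr hol; apply/funext => t; congr (\det _).
  by apply/matrixP => a b; rewrite !mxE.
have top t : uhp t -> forall k, (k < m)%N -> \sum_i iter k.+1 D (e i) t * c i t = 0.
  move=> ht; have := hW t ht => /eqP; rewrite /wronskian -det_tr => /det0P[v v0 hv].
  have hv' k : (k < m)%N -> \sum_i iter k.+1 D (e i) t * v 0 i = 0.
    move=> km; have := congr1 (fun A : 'rV_m => A 0 (Ordinal km)) hv; rewrite !mxE => h.
    by rewrite -[RHS]h; apply: eq_bigr => i _; rewrite !mxE mulrC -iterSr.
  (* The kernel vector [v] is sent by [M t] to [l] times the first unit vector, and [l] is nonzero
     since [M t] is injective. So the solution [c] is [v / l] and inherits from [v] that the m-th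
     derivative vanishes too. *)
  pose l := \sum_i e i t * v 0 i.
  have hMv : M t *m v^T = l *: delta_mx o 0.
    apply/matrixP => k j; rewrite !mxE (ord1 j) eqxx andbT.
    have -> : \sum_i M t k i * v^T i 0 = \sum_i iter k D (e i) t * v 0 i.
      by apply: eq_bigr => i _; rewrite !mxE.
    case: k => [[|k] km]; rewrite -val_eqE /=; first by rewrite mulr1.
    by rewrite mulr0; apply: hv'; exact: ltnW.
  have l0 : l != 0.
    apply: contraNneq v0 => l0; rewrite l0 scale0r in hMv.
    by rewrite -(trmxK v) (wronskian_mx_inj ht hMv) trmx0.
  have Ei i : c i t = l^-1 * v 0 i.
    have E : cv t = l^-1 *: v^T.
      apply/eqP; rewrite -subr_eq0; apply/eqP; apply: (wronskian_mx_inj ht).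
      by rewrite mulmxBr Mc // -scalemxAr hMv scalerA mulVf // scale1r subrr.
    by have := congr1 (fun A : 'cV_m => A i 0) E; rewrite !mxE.
  move=> k km; under eq_bigr => i _ do rewrite Ei mulrCA.
  by rewrite -mulr_sumr hv' // mulr0.
have c'0 i t : uhp t -> cd (c i) t 0.
  move=> ht; have hd i := hol_cd (holc i) ht.
  suff -> : (0 : C) = two_pi_i R * D (c i) t by exact: hd.
  have : \col_i (two_pi_i R * D (c i) t) = 0.
    apply: (wronskian_mx_inj ht); apply/matrixP => k j; rewrite !mxE.
    pose s z := \sum_i iter k D (e i) z * c i z.
    have s1 z : uhp z -> s z = ((k == o) : nat)%:R.
      move=> hz; have := congr1 (fun A : 'cV_m => A k 0) (Mc z hz); rewrite !mxE eqxx andbT => <-.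
      by apply: eq_bigr => i' _; rewrite !mxE.
    have d1 : cd s t (\sum_i (two_pi_i R * iter k.+1 D (e i) t * c i t + iter k D (e i) t * (two_pi_i R * D (c i) t))).
      by apply: cd_sum => i' _; apply: cdM (hol_cd (he i' k) ht) (hd i').
    have := cd_uniq d1 (cd_ext_uhp ht s1 (cd_cst _ t)).
    rewrite big_split /=; under eq_bigr => i' _ do rewrite -mulrA.
    rewrite -mulr_sumr (top t ht k (ltn_ord k)) mulr0 add0r => h; apply: etrans h.
    by apply: eq_bigr => i' _; rewrite !mxE.
  by move=> /(congr1 (fun A : 'cV_m => A i 0)); rewrite !mxE => ->.
have hi : uhp (ii R) by rewrite uhpE im_ii.
exists (fun i => c i (ii R)) => t ht.
have := congr1 (fun A : 'cV_m => A o 0) (Mc t ht); rewrite !mxE !eqxx => h; apply: etrans h.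
apply: eq_bigr => i _; rewrite !mxE mulrC /=.
by rewrite (cd0_constant (c'0 i) hi ht).
Qed.

End Wronskian.

(** * The square of the Wronskian as a power of eta, and the modularity of W'/W *)

Section WronskianModularity.
Variable R : realType.
Local Notation C := (Cplx R).
Local Notation eta := (@Defs.eta R).
Local Notation D := (@Dq R).
Variables (m : nat) (e : 'I_m -> C -> C) (h : 'I_m -> R) (P : 'M[C]_m).
Hypothesis he : forall i, isQS (h i) 1 (e i).
Hypothesis h_inj : injective h.
Hypothesis hP : forall i t, uhp t -> e i (modS t) = \sum_j P i j * e j t.
Local Notation K := (wronskian_weight m).
Hypothesis h_sum : \sum_i h i = K%:R / 12.

Let smooth_e i : smooth (e i) := isQS_smooth (he i).

Lemma isQS_wronskian : exists2 v, v != 0 & isQS (K%:R / 12) v (wronskian e).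
Proof.
exists (\det (\matrix_(j < m, i < m) (rc (h i) ^+ j * 1))).
  have -> : (\matrix_(j < m, i < m) (rc (h i) ^+ j * 1) : 'M[C]_m) = Vandermonde m (\row_i rc (h i)).
    by apply/matrixP => j i; rewrite !mxE mulr1.
  rewrite det_Vandermonde; apply/prodf_neq0 => i _; apply/prodf_neq0 => j ij.
  rewrite !mxE subr_eq0 (inj_eq (fmorph_inj _)) (inj_eq h_inj).
  by rewrite -val_eqE neq_ltn ij orbT.
by rewrite -h_sum; apply: isQS_det => j i; exact: isQS_iter_Dq.
Qed.

Lemma isQS_wronskian_Dq : exists v, isQS (K%:R / 12) v (wronskian (fun i => D (e i))).
Proof.
eexists; rewrite -h_sum; apply: isQS_det => j i.
by apply: isQS_iter_Dq; apply: isQS_Dq.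
Qed.

Lemma isQS_eta_invX n : isQS (- (n%:R / 12)) 1 (fun t => (eta t)^-1 ^+ n.*2).
Proof.
apply: isQS_eq (isQSX n.*2 (isQS_eta_inv R)) => //; last by rewrite expr1n.
have E (x : R) : x *+ n.*2 = x * (2 * n%:R) by rewrite -[LHS]mulr_natr -mul2n natrM.
by rewrite E; field.
Qed.

(* The 24-th power of eta has weight 12, hence W / eta^(2 K) is invariant up to
   a constant. *)
Lemma wronskian_sqr : exists2 w, w != 0 & forall t, uhp t -> wronskian e t ^+ 2 = w * eta t ^+ (K.*2).*2.
Proof.
have [v v0 hW] := isQS_wronskian.
pose g t := wronskian e t * (eta t)^-1 ^+ K.*2.
have hg : isQS 0 v g.
  by apply: isQS_eq (isQSM hW (isQS_eta_invX K)); rewrite ?subrr ?mulr1.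
have [c c0 hc] := eta_modS_sqr R.
pose r := \det P / c ^+ K.
have gS t : uhp t -> g (modS t) = r * g t.
  move=> ht; have t0 := uhp_neq0 ht; have e0 := eta_neq0 ht.
  have E : (eta (modS t))^-1 ^+ K.*2 = (c ^+ K * t ^+ K * eta t ^+ K.*2)^-1.
    have := hc t ht; move: (eta (modS t)) (eta t) => x y hxy.
    by rewrite exprVn -mul2n !(exprM _ 2) hxy 2!exprMn.
  have E2 : (eta t)^-1 ^+ K.*2 = (eta t ^+ K.*2)^-1 := exprVn _ _.
  apply: (eq_trans (f_equal2 (fun a b => a * b) (wronskian_modS smooth_e hP ht) E)).
  rewrite /g /r E2.
  have := expf_neq0 K t0; have := expf_neq0 K c0; have := expf_neq0 K.*2 e0.
  move: (t ^+ K) (c ^+ K) (eta t ^+ _) (\det P) (wronskian e t) => a b u x W u0 b0 a0.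
  by field; rewrite u0 b0 a0.
have [t1 ht1 gt1] : exists2 t, uhp t & g t != 0.
  apply: contrapT => h0.
  have [a [ha a0 hf]] := hg.
  have : a 0%N = 0.
    apply: (qs_coef_eq0 ha hf) => t ht; apply/eqP; apply: contrapT => /negP gt.
    by apply: h0; exists t.
  by rewrite a0 => v0'; rewrite v0' eqxx in v0.
(* The inversion is an involution and [g] is nonzero at [t1]; hence the square of [g] is invariant
   although [r] is unknown. *)
have r2 : r ^+ 2 = 1.
  apply: (mulIf gt1); rewrite mul1r expr2 -mulrA -gS // -gS ?modSK //; exact: uhp_modS.
have hg2 : isQS 0 (v ^+ 2) (fun t => g t ^+ 2).
  by apply: isQS_eq (isQSX 2 hg); rewrite ?mul0rn.
exists (v ^+ 2); first exact: expf_neq0.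
move=> t ht.
have g2S z : uhp z -> g (modS z) ^+ 2 = g z ^+ 2.
  by move=> hz; rewrite gS // exprMn r2 mul1r.
rewrite -(invariant_constant hg2 g2S ht) /g.
have := eta_neq0 ht; move: (eta t) (wronskian e t) => x W x0.
by rewrite exprMn -exprM muln2 -mulrA -exprMn mulVf // expr1n mulr1.
Qed.

Lemma wronskian_neq0 t : uhp t -> wronskian e t != 0.
Proof.
move=> ht; have [w w0 hw] := wronskian_sqr.
have : wronskian e t ^+ 2 != 0 by rewrite hw // mulf_neq0 // expf_neq0 // eta_neq0.
by apply: contraNneq => ->; rewrite expr0n.
Qed.

(** [W'/W] is rewritten as [W' W / W^2], and [W^2] is a constant times a power of eta, whose inverse
    has a q-series. The exponents [K/12 + K/12 - 2K/12] cancel. *)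
Lemma wronskian_quotient_QS : exists c, isQS 0 c (wronskian_quotient e).
Proof.
have [w w0 hw] := wronskian_sqr; have [v _ hW] := isQS_wronskian.
have [v' hW'] := isQS_wronskian_Dq.
have h1 := isQSZ w^-1 (isQSM (isQSM hW' hW) (isQS_eta_invX K.*2)).
eexists; apply: isQS_ext (isQS_eq _ (erefl _) h1) => [t ht|]; last first.
  by rewrite -[K.*2]mul2n natrM; field.
have W0 := wronskian_neq0 ht; have e0 := eta_neq0 ht.
rewrite /wronskian_quotient exprVn.
have := hw t ht; move: (eta t ^+ _) (expf_neq0 (K.*2).*2 e0) => u u0 E.
move: (wronskian e t) W0 E => W W0 E; move: (wronskian _ t) => W'.
apply: (mulIf W0); rewrite divfK //.
have -> : w^-1 * (W' * W / u) * W = W' * (W ^+ 2) / (w * u) by field; rewrite w0 u0.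
by rewrite E mulfK // mulf_neq0.
Qed.

Lemma wronskian_quotient_modS t : uhp t ->
  wronskian_quotient e (modS t) = t ^+ m.*2 * wronskian_quotient e t.
Proof.
move=> ht; have W0 := wronskian_neq0 ht; have WS := wronskian_neq0 (uhp_modS ht).
have t0 := uhp_neq0 ht.
rewrite /wronskian_quotient; rewrite (wronskian_modS smooth_e hP ht) in WS *.
rewrite (wronskian_Dq_modS smooth_e hP ht) exprD.
have P0 : \det P != 0 by apply: contraNneq WS => ->; rewrite mul0r mulr0.
have := expf_neq0 K t0; move: (t ^+ K) (t ^+ _) => a b a0.
by field; rewrite a0 W0 P0.
Qed.

Section Basis.
Variables (f : 'I_m -> C -> C) (A : 'M[C]_m).
Hypothesis hf : forall i t, uhp t -> f i t = \sum_j A i j * e j t.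
Hypothesis f_indep : lin_indep f.

Lemma basis_det_neq0 : \det A != 0.
Proof.
apply/negP => /det0P[v v0 hv].
case/negP: v0; apply/eqP/matrixP => i j; rewrite (ord1 i) mxE.
apply: (f_indep (a := fun i => v 0 i)) => t ht.
under eq_bigr => k _ do rewrite hf // mulr_sumr.
rewrite exchange_big big1 //= => k _.
have := congr1 (fun B : 'rV_m => B 0 k) hv; rewrite !mxE => E.
by under eq_bigr => l _ do rewrite mulrA; rewrite -mulr_suml E mul0r.
Qed.

Lemma wronskian_quotient_basis t : uhp t -> wronskian_quotient f t = wronskian_quotient e t.
Proof.
move=> ht; rewrite /wronskian_quotient.
have E1 := wronskian_linear smooth_e hf ht; have E2 := wronskian_Dq_linear smooth_e hf ht.
apply: (eq_trans (f_equal2 (fun a b => a / b) E2 E1)).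
by rewrite -mulf_div divff ?mul1r // basis_det_neq0.
Qed.

Lemma wronskian_quotient_modular : modular_form_of_weight (m.*2)%:Z (wronskian_quotient f).
Proof.
have [c hc] := wronskian_quotient_QS.
have hF : isQS 0 c (wronskian_quotient f) := isQS_ext wronskian_quotient_basis hc.
split.
- by move=> t ht; exact: cd_derivable (isQS_derivable hF ht).
- apply: weakly_modular_of_generators => t ht.
    by rewrite (isQS_shift hF ht) ez0 mul1r.
  by rewrite (wronskian_quotient_basis (uhp_modS ht)) (wronskian_quotient_modS ht) (wronskian_quotient_basis ht).
- have [a [_ _ ha]] := hF; exists a => t ht; apply: is_lim_cvg.
  have := has_sum_series (ha t ht); apply: is_lim_ext => n; apply: eq_bigr => k _.
  by rewrite add0r qpow_nat.
Qed.

Lemma wronskian_quotient_eq0 : (0 < m)%N ->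
  (forall t, uhp t -> wronskian_quotient f t = 0) <->
  (exists c : 'I_m -> C, forall t, uhp t -> \sum_i c i * e i t = 1).
Proof.
move=> m0; split=> [h0|[c hc] t ht].
  apply: (wronskian_Dq_eq0_span smooth_e (@wronskian_neq0) m0) => t ht.
  have := h0 t ht; rewrite wronskian_quotient_basis // => /eqP.
  by rewrite mulf_eq0 invr_eq0 (negPf (wronskian_neq0 ht)) orbF => /eqP.
rewrite wronskian_quotient_basis // /wronskian_quotient.
by rewrite (wronskian_Dq_eq0 smooth_e hc ht) mul0r.
Qed.

End Basis.
End WronskianModularity.

(** * A basis of the span of the characters *)

Section StandardBasis.
Variable R : realType.
Local Notation C := (Cplx R).
Variables p p' : nat.
Hypotheses (hp : (2 <= p)%N) (hp' : (2 <= p')%N) (hpp' : coprime p p').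
Local Notation N := (level p p').
Local Notation T := ('I_p.-1 * 'I_p'.-1)%type.
Local Notation m := ((p.-1 * p'.-1)./2).
Local Notation mc := (@minimal_chars R p p').

Definition lam_of (rs : T) : int := theta_lam p p' rs.1.+1 rs.2.+1.
Definition rev_pair (rs : T) : T := (rev_ord rs.1, rev_ord rs.2).

Lemma rev_pairK : involutive rev_pair.
Proof. by case=> a b; rewrite /rev_pair /= !rev_ordK. Qed.

Lemma lam_of_rev rs : lam_of (rev_pair rs) = - lam_of rs.
Proof. exact: lam_rev. Qed.

Lemma ord_pred_bound (q : nat) (i : 'I_q.-1) : (0 < i.+1 < q)%N.
Proof. by have := ltn_ord i; lia. Qed.

Lemma lam_of_neq0 rs : lam_of rs != 0.
Proof.
apply/eqP => E; have := lam_dvdp hpp' rs.2.+1 (ord_pred_bound rs.1).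
by rewrite -/(lam_of rs) E dvdz0.
Qed.

Lemma lam_of_inj : injective lam_of.
Proof.
move=> [r s] [r' s']; rewrite /lam_of /theta_lam /= => E.
have E' : p'%:Z * (r.+1%:Z - r'.+1%:Z) = p%:Z * (s.+1%:Z - s'.+1%:Z).
  by rewrite !mulrBr; move: E; clear; lia.
have rr : r = r'.
  apply: val_inj; apply: succn_inj; apply: (@dvd_bounded p).
  - by case/andP: (ord_pred_bound r).
  - by case/andP: (ord_pred_bound r').
  by rewrite -(@Gauss_dvdzr _ p'%:Z) ?coprimez_pp // E' dvdz_mulr.
have ss : s = s'.
  apply: val_inj; apply: succn_inj; apply: (@dvd_bounded p').
  - by case/andP: (ord_pred_bound s).
  - by case/andP: (ord_pred_bound s').
  by rewrite -(@Gauss_dvdzr _ p%:Z) ?coprimez_p'p // -E' dvdz_mulr.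
by rewrite rr ss.
Qed.

(** One pair from each class of the symmetry, which negates [lam_of], a number that is never 0.
    Positivity also lets [lam_of] be recovered from its square, so that the leading exponents are
    distinct. *)
Definition pos_pairs : {set T} := [set rs | 0 < lam_of rs].

Lemma pos_pairs_rev rs : (rev_pair rs \in pos_pairs) = (rs \notin pos_pairs).
Proof. by rewrite !inE lam_of_rev oppr_gt0 -leNgt le_eqVlt (negPf (lam_of_neq0 rs)). Qed.

Lemma sum_pos_pairs (V : nmodType) (F : T -> V) : (forall rs, F (rev_pair rs) = F rs) ->
  (\sum_(rs in pos_pairs) F rs) *+ 2 = \sum_rs F rs.
Proof.
move=> hF; rewrite [RHS](bigID (mem pos_pairs)) /= mulr2n; congr (_ + _).
rewrite [RHS](reindex_inj (inv_inj rev_pairK)) /=.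
by apply: eq_big => [rs|rs _]; rewrite ?hF // pos_pairs_rev negbK.
Qed.

Lemma card_pos_pairs : #|pos_pairs| = m.
Proof.
apply: double_inj; rewrite -muln2.
have := @sum_pos_pairs nat (fun=> 1%N) (fun _ => erefl).
rewrite !sum1_card card_prod !card_ord.
have -> : (#|pos_pairs| *+ 2 = #|pos_pairs| * 2)%N by rewrite mulr2n muln2 -addnn.
by move=> <-; rewrite muln2 doubleK.
Qed.

Lemma card_doubleE : (m.*2 = p.-1 * p'.-1)%N.
Proof.
have := @sum_pos_pairs nat (fun=> 1%N) (fun _ => erefl).
by rewrite !sum1_card card_prod !card_ord card_pos_pairs mulr2n -addnn.
Qed.

(** Passes once from the set of representatives to the ordinal type that indexes the bases of the
    theorem. *)
Lemma pos_index : exists idx : 'I_m -> T, [/\ injective idx,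
  forall rs, rs \in pos_pairs -> exists i, idx i = rs,
  forall i, idx i \in pos_pairs &
  forall F : T -> R, \sum_i F (idx i) = \sum_(rs in pos_pairs) F rs].
Proof.
move: m card_pos_pairs => n <-; exists enum_val; split.
- exact: enum_val_inj.
- by move=> rs h; exists (enum_rank_in h rs); rewrite enum_rankK_in.
- exact: enum_valP.
- by move=> F; rewrite -big_enum_val.
Qed.

Lemma minimal_chars_rev rs t : uhp t -> mc (rev_pair rs) t = mc rs t.
Proof.
move=> ht; apply: (mulfI (eta_neq0 ht)); rewrite !eta_minimal_char //.
have /dvdzP[l hl] := mu_rev hp hp' hpp' rs.1 rs.2.
have := lam_of_rev rs; rewrite /lam_of => ->; rewrite coset_theta_opp //; congr (_ - _).
rewrite -(coset_theta_opp p p' (theta_mu p p' rs.1.+1 rs.2.+1) ht) -(coset_theta_shift p p' (- theta_mu p p' rs.1.+1 rs.2.+1) l ht).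
by rewrite -hl subrK.
Qed.

Lemma isQS_minimal_chars (rs : T) : isQS (hpow R p p' rs.1.+1 rs.2.+1 - 24^-1) 1 (mc rs).
Proof. by apply: isQS_minimal_char => //; exact: ord_pred_bound. Qed.

Lemma sum_sqr_lin (n n' : nat) (a b : R) :
  \sum_(i < n) \sum_(j < n') (b * i.+1%:R - a * j.+1%:R) ^+ 2 =
  b ^+ 2 * n'%:R * (n%:R * (n%:R + 1) * (2 * n%:R + 1) / 6)
  - a * b * (n%:R * (n%:R + 1)) * (n'%:R * (n'%:R + 1)) / 2
  + a ^+ 2 * n%:R * (n'%:R * (n'%:R + 1) * (2 * n'%:R + 1) / 6).
Proof.
have E x : \sum_(j < n') (x - a * j.+1%:R) ^+ 2 =
    n'%:R * x ^+ 2 - a * x * (n'%:R * (n'%:R + 1)) + a ^+ 2 * (n'%:R * (n'%:R + 1) * (2 * n'%:R + 1) / 6).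
  elim: n' => [|k IH]; first by rewrite big_ord0; ring.
  by rewrite big_ord_recr /= IH -!natr1; field.
under eq_bigr => i _ do rewrite E.
move: (n'%:R : R) => y {E n'}; elim: n => [|k IH]; first by rewrite big_ord0; ring.
by rewrite big_ord_recr /= IH -!natr1; field.
Qed.

Lemma wronskian_weightE n : (wronskian_weight n)%:R = n%:R * (n%:R - 1) :> R.
Proof.
rewrite /wronskian_weight; elim: n => [|n IH]; first by rewrite big_ord0 mul0r.
by rewrite big_ord_recr /= natrD IH -mul2n natrM -natr1; ring.
Qed.

(** The exponents are invariant under the symmetry, so twice the sum runs over the whole rectangle
    of pairs, where it reduces to sums of first and second powers. *)
Lemma sum_hpow : \sum_(rs in pos_pairs) (hpow R p p' rs.1.+1 rs.2.+1 - 24^-1) = (wronskian_weight m)%:R / 12.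
Proof.
have hrev rs : hpow R p p' (rev_pair rs).1.+1 (rev_pair rs).2.+1 - 24^-1 = hpow R p p' rs.1.+1 rs.2.+1 - 24^-1.
  have := lam_of_rev rs; rewrite /lam_of => E.
  by rewrite /hpow E rmorphN sqrrN.
apply: (mulIf (_ : 2%:R != 0)); first by rewrite pnatr_eq0.
rewrite [LHS]mulr_natr (sum_pos_pairs hrev).
have p0 : p%:R != 0 :> R by rewrite pnatr_eq0; move: hp; clear; lia.
have p'0 : p'%:R != 0 :> R by rewrite pnatr_eq0; move: hp'; clear; lia.
have E (rs : T) : hpow R p p' rs.1.+1 rs.2.+1 - 24^-1 =
    (4 * p%:R * p'%:R)^-1 * ((p'%:R * rs.1.+1%:R - p%:R * rs.2.+1%:R) ^+ 2) - 24^-1.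
  by rewrite /hpow /theta_lam rmorphB !rmorphM /= -!pmulrn levelE // !natrM; field; rewrite p0 p'0.
under eq_bigr => rs _ do rewrite E.
rewrite sumrB sumr_const card_prod !card_ord -mulr_sumr.
rewrite -(pair_big xpredT xpredT (fun (i : 'I_p.-1) (j : 'I_p'.-1) => (p'%:R * i.+1%:R - p%:R * j.+1%:R) ^+ 2)) /=.
rewrite sum_sqr_lin wronskian_weightE.
have hm : m%:R * 2 = p.-1%:R * p'.-1%:R :> R by rewrite -!natrM muln2 card_doubleE.
have mE : m%:R = p.-1%:R * p'.-1%:R / 2 :> R by rewrite -hm mulfK // pnatr_eq0.
have E3 (x : R) (a b : nat) : x *+ (a * b) = x * (a%:R * b%:R) by rewrite -natrM mulr_natr.
rewrite mE E3.
have e1 : p%:R = p.-1%:R + 1 :> R by rewrite natr1 prednK //; move: hp; clear; lia.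
have e2 : p'%:R = p'.-1%:R + 1 :> R by rewrite natr1 prednK //; move: hp'; clear; lia.
move: p0 p'0; rewrite e1 e2; move: (p.-1%:R : R) (p'.-1%:R : R) => x y x0 y0.
by field; rewrite x0 y0.
Qed.

Lemma hpow_inj rs rs' : rs \in pos_pairs -> rs' \in pos_pairs ->
  hpow R p p' rs.1.+1 rs.2.+1 = hpow R p p' rs'.1.+1 rs'.2.+1 -> rs = rs'.
Proof.
rewrite !inE => h h' E; apply: lam_of_inj.
have L0 : 2 * N.+1%:R != 0 :> R by rewrite mulf_neq0 ?pnatr_eq0.
move: E; rewrite /hpow => /(mulIf (invr_neq0 L0)) /eqP.
rewrite eqrXn2 ?ler0z ?ltW //.
by rewrite eqr_int => /eqP.
Qed.

Lemma regroup_sum (I J : finType) (s : I -> J) (a : I -> C) (v : J -> C) :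
  \sum_i a i * v (s i) = \sum_j (\sum_(i | s i == j) a i) * v j.
Proof.
rewrite (partition_big s predT) //=; apply: eq_bigr => j _.
by rewrite mulr_suml; apply: eq_bigr => i /eqP ->.
Qed.

Variable idx : 'I_m -> T.
Hypothesis idx_onto : forall rs, rs \in pos_pairs -> exists i, idx i = rs.
Let e (i : 'I_m) : C -> C := mc (idx i).

Lemma span_reduce (g : C -> C) (a : T -> C) : (forall t, uhp t -> g t = \sum_rs a rs * mc rs t) ->
  exists b : 'I_m -> C, forall t, uhp t -> g t = \sum_j b j * e j t.
Proof.
move=> hg.
have hs rs : exists i, forall t, uhp t -> mc rs t = e i t.
  have [h|h] := boolP (rs \in pos_pairs).
    by have [i hi] := idx_onto h; exists i => t _; rewrite /e hi.
  rewrite -pos_pairs_rev in h; have [i hi] := idx_onto h; exists i => t ht.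
  by rewrite /e hi minimal_chars_rev.
pose s rs := projT1 (cid (hs rs)); have sE rs := projT2 (cid (hs rs)).
exists (fun j => \sum_(rs | s rs == j) a rs) => t ht.
rewrite hg // -(regroup_sum s a (fun j => e j t)).
by apply: eq_bigr => rs _; rewrite (sE rs t ht).
Qed.

Lemma span_expand (b : 'I_m -> C) t :
  \sum_j b j * e j t = \sum_rs (\sum_(j | idx j == rs) b j) * mc rs t.
Proof. exact: (regroup_sum idx b (fun rs => mc rs t)). Qed.

Lemma basis_modS : exists P : 'M[C]_m, forall i t, uhp t -> e i (modS t) = \sum_j P i j * e j t.
Proof.
have h i : exists b : 'I_m -> C, forall t, uhp t -> e i (modS t) = \sum_j b j * e j t.
  have [rho hrho] := char_modS R hp hp' hpp' (idx i).1.+1 (idx i).2.+1.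
  exact: (@span_reduce (fun t => e i (modS t)) rho hrho).
exists (\matrix_(i, j) projT1 (cid (h i)) j) => i t ht.
rewrite (projT2 (cid (h i)) t ht); apply: eq_bigr => j _; by rewrite mxE.
Qed.

End StandardBasis.

(** * The constant function in the span *)

Section SquareSeries.
Variable R : realType.
Local Notation C := (Cplx R).

Definition scaled_sqr (a : nat) (x : int) : nat := (a * absz x ^ 2)%N.

Lemma abs_le_scaled_sqr a x : (0 < a)%N -> (`|x| <= scaled_sqr a x)%N.
Proof. by rewrite /scaled_sqr; move: (absz x) => n; clear; nia. Qed.

Lemma fiber_sum_square (a : nat) (u : int -> C) (y : int) : (0 < a)%N -> y != 0 ->
  fiber_sum u (scaled_sqr a) (scaled_sqr a y) = u y + u (- y).
Proof.
move=> a0 y0; apply: (has_sum_uniq (has_sum_fiber_sum u (scaled_sqr a y) (fun x => abs_le_scaled_sqr x a0))).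
have yN : y != - y by move: y0; clear; lia.
have eN : scaled_sqr a (- y) = scaled_sqr a y by rewrite /scaled_sqr abszN.
have := @has_sum_finite R _ (fun x => if scaled_sqr a x == scaled_sqr a y then u x else 0) [:: y; - y].
rewrite big_cons big_seq1 eqxx eN eqxx; apply; first by rewrite /= inE yN.
move=> x; rewrite !inE negb_or => /andP[h1 h2]; case: eqP => // E; exfalso.
have : (absz x ^ 2 = absz y ^ 2)%N by move: E; rewrite /scaled_sqr; move: a0; clear; nia.
move=> /eqP; rewrite eqn_exp2r // => /eqP; move: h1 h2; clear; lia.
Qed.

Lemma fiber_sum_none (a k : nat) (u : int -> C) : (0 < a)%N -> (forall x, scaled_sqr a x != k) ->
  fiber_sum u (scaled_sqr a) k = 0.
Proof.
move=> a0 h; apply: big1 => j _; by rewrite (negPf (h _)).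
Qed.

End SquareSeries.

(** For [g = gcdn u x] and [u = u' g], coprimality gives that [u'] divides [g] and [g] divides [u'],
    so that [u = g^2]. *)
Lemma coprime_sqr (u v x : nat) : coprime u v -> (u * v = x ^ 2)%N -> exists a, u = (a ^ 2)%N.
Proof.
move=> cuv E; have [->|u0] := posnP u; first by exists 0%N.
pose g := gcdn u x; have g0 : (0 < g)%N by rewrite gcdn_gt0 u0.
have /dvdnP[u' hu] := dvdn_gcdl u x; have /dvdnP[x' hx] := dvdn_gcdr u x; rewrite -/g in hu hx.
have c' : coprime u' x'.
  by rewrite /coprime -(eqn_pmul2r g0) muln_gcdl -hu -hx mul1n.
have E' : (u' * v = x' ^ 2 * g)%N.
  by apply/eqP; rewrite -(eqn_pmul2r g0); apply/eqP; move: E; rewrite {1}hu hx; clear; nia.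
have d1 : (u' %| g)%N by rewrite -(@Gauss_dvdr _ (x' ^ 2)) ?coprimeXr // -E' dvdn_mulr.
have d2 : (g %| u')%N.
  have cg : coprime g v by apply: coprime_dvdl cuv; exact: dvdn_gcdl.
  by rewrite -(@Gauss_dvdl _ _ v) // E' dvdn_mull.
by exists g; rewrite hu (eqP (_ : u' == g)) ?mulnn // eqn_dvd d1 d2.
Qed.

Section ConstantInSpan.
Variable R : realType.
Local Notation C := (Cplx R).
Local Notation eta := (@Defs.eta R).
Local Notation chi := (eta_character R).
Variables p p' : nat.
Hypotheses (hp : (2 <= p)%N) (hp' : (2 <= p')%N) (hpp' : coprime p p').
Local Notation N := (level p p').
Local Notation T := ('I_p.-1 * 'I_p'.-1)%type.
Local Notation mc := (@minimal_chars R p p').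
Local Notation omega_odd := (omega_odd hpp').

Lemma chi_one : chi 1 = 1.
Proof. by rewrite /eta_character /char_coef /cong_ind /= addr0 !subr0. Qed.

Lemma chiN x : chi (- x) = chi x. Proof. by case: (chi_omega_odd R). Qed.

Lemma theta_span (b : T -> C) : let d x := \sum_(rs : T) b rs * char_coef p p' C rs.1.+1 rs.2.+1 x in
  omega_odd d /\ forall t, uhp t -> theta N d t = 2 * eta t * \sum_rs b rs * mc rs t.
Proof.
move=> d; have hk (rs : T) := char_coef_omega_odd hp hp' hpp' C rs.1.+1 rs.2.+1.
have hd : omega_odd d.
  split=> [x l|x|x]; rewrite /d -?sumrN; apply: eq_bigr => rs _; have [h1 h2 h3] := hk rs.
  - by rewrite h1.
  - by rewrite h2.
  - by rewrite h3 mulrN.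
split=> // t ht; apply: (has_sum_uniq (omega_odd_summ hd ht)).
rewrite mulr_sumr.
have := has_sum_big (index_enum T) (P := predT) (fun rs _ => has_sumZ (b rs) (omega_odd_summ (hk rs) ht)).
rewrite (eq_bigr (fun rs => 2 * eta t * (b rs * mc rs t))) => [|rs _].
  by apply: has_sum_ext => x; rewrite /d mulr_suml; apply: eq_bigr => rs _; rewrite mulrA.
by rewrite (theta_minimal_char hp hp' hpp') // -/(mc rs t); ring.
Qed.

(* Comparison of the coefficients of q^(6 x^2) = q^(p p' n^2) in
   theta_d (24 p p' t) = 2 eta (24 p p' t). *)
Lemma theta_eta_coef (d : int -> C) : omega_odd d -> (forall t, uhp t -> theta N d t = 2 * eta t) ->
  exists2 x : int, (6 * absz x ^ 2 = p * p')%N & forall n : int, n != 0 -> d (x * n) = chi n.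
Proof.
move=> hd hth; have [_ hN _] := hd.
have pp0 : (0 < p * p')%N by rewrite muln_gt0; move: hp hp'; clear; lia.
have [B hB] := omega_odd_bounded hd.
have [B' hB'] := omega_odd_bounded (chi_omega_odd R).
have [ds1 qs1] := int_series 0 (fun x => @abs_le_scaled_sqr 6 x isT) hB.
have [ds2 qs2] := int_series 0 (fun x => abs_le_scaled_sqr x pp0) hB'.
(* Rescaling by [24pp'] turns the exponents [x^2 / 4pp'] and [n^2 / 24] into the integers [6 x^2]
   and [pp' n^2]. *)
pose s : R := 24 * (p * p')%:R.
have s0 : 0 < s by rewrite mulr_gt0 // ltr0n.
have hs (t : C) : uhp t -> uhp (rc s * t) by exact: uhp_scale.
have p0 : p%:R != 0 :> R by rewrite pnatr_eq0; move: hp; clear; lia.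
have p'0 : p'%:R != 0 :> R by rewrite pnatr_eq0; move: hp'; clear; lia.
have sqz (x : int) : (absz x ^ 2)%:R = x%:~R ^+ 2 :> R.
  by rewrite natrX -[(absz x)%:R]/((absz x)%:Z%:~R) abszE intr_norm real_normK // num_real.
have e1 : qs_sum 0 (fiber_sum d (scaled_sqr 6)) (fun t => theta N d (rc s * t)).
  apply: qs1 => t ht; apply: has_sum_ext (omega_odd_summ hd (hs _ ht)) => x.
  rewrite /qtheta qpow_scale add0r; congr (_ * qpow _ t).
  by rewrite /scaled_sqr natrM sqz /s levelE // !natrM; field; rewrite p0 p'0.
have e2 : qs_sum 0 (fiber_sum chi (scaled_sqr (p * p'))) (fun t => theta 11 chi (rc s * t)).
  apply: qs2 => t ht; apply: has_sum_ext (omega_odd_summ (chi_omega_odd R) (hs _ ht)) => x.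
  rewrite /qtheta qpow_scale add0r; congr (_ * qpow _ t).
  by rewrite /scaled_sqr natrM sqz /s level23 natrM; field.
have key k : fiber_sum d (scaled_sqr 6) k = fiber_sum chi (scaled_sqr (p * p')) k.
  apply/eqP; rewrite -subr_eq0 -mulN1r; apply/eqP.
  apply: (qs_coef_eq0 (a := fun k => fiber_sum d (scaled_sqr 6) k + -1 * fiber_sum chi (scaled_sqr (p * p')) k)
    (f := fun t => theta N d (rc s * t) + -1 * theta 11 chi (rc s * t))).
  - exact: disk_summableD ds1 (disk_summableZ _ ds2).
  - move=> t ht; have h := has_sumD (e1 t ht) (has_sumZ (-1) (e2 t ht)).
    by apply: has_sum_ext h => n; ring.
  - by move=> t ht; rewrite hth ?theta_chi ?mulN1r ?subrr //; exact: hs.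
(* On the eta side [q^(pp')] has the coefficient [chi 1 + chi (-1) = 2], so this power must occur on
   the other side. *)
have [x hx] : exists x, scaled_sqr 6 x == scaled_sqr (p * p') 1.
  apply: contrapT => h; have := key (scaled_sqr (p * p') 1).
  rewrite fiber_sum_square // chiN chi_one fiber_sum_none // => [/esym/eqP|x].
    by rewrite -(natrD _ 1 1) pnatr_eq0.
  by apply/negP => hx; apply: h; exists x.
have hx6 : (6 * absz x ^ 2 = p * p')%N by move/eqP: hx; rewrite /scaled_sqr /= muln1.
exists x => // n n0.
have x0 : x != 0 by apply: contraTneq pp0 => x0; rewrite -hx6 x0.
have := key (scaled_sqr 6 (x * n)); rewrite fiber_sum_square ?mulf_neq0 //.
have -> : scaled_sqr 6 (x * n) = scaled_sqr (p * p') n by rewrite /scaled_sqr abszM expnMn mulnA hx6.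
rewrite (fiber_sum_square _ pp0 n0) hN chiN; move: (d _) (chi n) => a b E.
have n2 : (1 + 1 : C) != 0 by rewrite -(natrD _ 1 1) pnatr_eq0.
by apply: (mulfI n2); rewrite !mulrDl !mul1r.
Qed.

Definition square_form := exists a b : nat, [/\ (0 < a)%N, (0 < b)%N &
     (p = 2 * a ^ 2 /\ p' = 3 * b ^ 2)%N \/ (p' = 2 * a ^ 2 /\ p = 3 * b ^ 2)%N].

Lemma cong_23 (x y : int) : (exists u, x - y = 4 * u) -> (exists v, x - y = 6 * v) -> cong 2 3 x y.
Proof.
by move=> [u hu] [v hv]; rewrite /cong level23; apply/dvdzP; exists (u - v); move: hu hv; clear; lia.
Qed.

Lemma chi_cong x y : cong 2 3 x y -> chi x = chi y.
Proof. exact: omega_odd_cong (chi_omega_odd R). Qed.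

Local Notation om := (omega hpp').
Local Notation om23 := (omega coprime23).

(* If 6 divides p or p', then omega = -1 or 1 modulo 12. *)
Lemma chi_omega : (6 %| p)%N \/ (6 %| p')%N -> chi om = 1.
Proof.
have [a oa] := omega1 hpp'; have [b ob] := omega2 hpp'.
move=> [/dvdnP[k hk]|/dvdnP[k hk]].
  rewrite (@chi_cong _ (-1)) ?chiN ?chi_one //.
  by apply: cong_23; rewrite ob hk PoszM; [exists (3 * k%:Z * b) | exists (2 * k%:Z * b)]; ring.
rewrite (@chi_cong _ 1) ?chi_one //.
by apply: cong_23; rewrite oa hk PoszM; [exists (3 * k%:Z * a) | exists (2 * k%:Z * a)]; ring.
Qed.

(** For [p = 2c^2] and [p' = 3d^2], [omega] is -1 modulo 4 and 1 modulo 6, hence congruent modulo 12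
    to its counterpart for (2, 3), under which [chi] is odd. With the roles exchanged it is
    congruent to the negative of that counterpart, and [chi] is even. *)
Lemma chi_omega_mul y : square_form -> chi (om * y) = - chi y.
Proof.
have [a oa] := omega1 hpp'; have [b ob] := omega2 hpp'.
have [a' oa'] := omega1 coprime23; have [b' ob'] := omega2 coprime23.
have [_ _ hom] := chi_omega_odd R.
have cmul (u v : int) : cong 2 3 u v -> cong 2 3 (u * y) (v * y).
  by rewrite /cong -mulrBl => h; exact: dvdz_mulr.
move=> [c [d [_ _ [[hc hd]|[hc hd]]]]].
  rewrite -hom; apply/chi_cong/cmul; apply: cong_23.
    by exists (c%:Z ^+ 2 * b - b'); rewrite ob ob' hc; rewrite !PoszM; ring.
  by exists (d%:Z ^+ 2 * a - a'); rewrite oa oa' hd; rewrite !PoszM; ring.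
rewrite -hom -chiN -mulNr; apply/chi_cong/cmul; apply: cong_23.
  by exists (- (c%:Z ^+ 2 * a) - b'); rewrite oa ob' hc; rewrite !PoszM; ring.
by exists (- (d%:Z ^+ 2 * b) - a'); rewrite ob oa' hd; rewrite !PoszM; ring.
Qed.

(** The primes 2 and 3 divide [pp'] but cannot divide the same factor. Once they are removed, two
    coprime numbers with a square product remain. *)
Lemma six_square_form x : (6 * x ^ 2 = p * p')%N -> ~~ (6 %| p)%N -> ~~ (6 %| p')%N -> square_form.
Proof.
move=> E h6 h6'.
have pp0 : (0 < p)%N && (0 < p')%N by move: hp hp'; clear; lia.
have key (u v : nat) : coprime u v -> (0 < u)%N -> (0 < v)%N -> (2 %| u)%N -> (3 %| v)%N -> (6 * x ^ 2 = u * v)%N ->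
    exists a b : nat, [/\ (0 < a)%N, (0 < b)%N, u = (2 * a ^ 2)%N & v = (3 * b ^ 2)%N].
  move=> cuv u0 v0 /dvdnP[u' hu] /dvdnP[v' hv] E'.
  have c' : coprime u' v'.
    by move: cuv; rewrite hu hv coprimeMl coprimeMr => /andP[/andP[]].
  have E2 : (u' * v' = x ^ 2)%N by move: E'; rewrite hu hv; clear; nia.
  have [a ha] := coprime_sqr c' E2.
  have [b hb] : exists b, v' = (b ^ 2)%N by apply: (@coprime_sqr v' u' x); [rewrite coprime_sym | rewrite mulnC].
  exists a, b; split.
  - by move: u0; rewrite hu ha; case: a {ha}.
  - by move: v0; rewrite hv hb; case: b {hb}.
  - by rewrite hu ha mulnC.
  - by rewrite hv hb mulnC.
have d2 : (2 %| p * p')%N by rewrite -E; apply/dvdnP; exists (3 * x ^ 2)%N; ring.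
have d3 : (3 %| p * p')%N by rewrite -E; apply/dvdnP; exists (2 * x ^ 2)%N; ring.
have d6 (u : nat) : (2 %| u)%N -> (3 %| u)%N -> (6 %| u)%N.
  by move=> h2 h3; rewrite -[6%N]/(2 * 3)%N Gauss_dvd // h2 h3.
case/andP: pp0 => p0 p'0.
move: d2 d3; rewrite !Euclid_dvdM // => /orP[d2|d2] /orP[d3|d3].
- by rewrite d6 in h6.
- by have [a [b [h1 h2 h3 h4]]] := key _ _ hpp' p0 p'0 d2 d3 E; exists a, b; split=> //; left.
- have c' : coprime p' p by rewrite coprime_sym.
  have [a [b [h1 h2 h3 h4]]] := key _ _ c' p'0 p0 d2 d3 (etrans E (mulnC _ _)).
  by exists a, b; split=> //; right.
- by rewrite d6 in h6'.
Qed.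

Lemma one_in_span_square_form (b : T -> C) :
  (forall t, uhp t -> \sum_rs b rs * mc rs t = 1) -> square_form.
Proof.
move=> hb; have [hd hth] := theta_span b; set d := (fun x => _) in hd hth.
have hth1 t : uhp t -> theta N d t = 2 * eta t by move=> ht; rewrite hth // hb // mulr1.
have [x hx hdx] := theta_eta_coef hd hth1.
have no6 : ~ ((6 %| p)%N \/ (6 %| p')%N).
  move=> h; have := chi_omega h.
  have [a oa] := omega1 hpp'.
  have o0 : om != 0 by rewrite oa; clear; lia.
  have [_ _ hom] := hd.
  (* The value of [d] at [x om] is computed twice: it is [chi om = 1], and by oddness it is
     [- d x = - chi 1 = -1]. *)
  rewrite -hdx // mulrC hom -[x]mulr1 hdx // chi_one => /eqP.
  by rewrite -subr_eq0 -opprD oppr_eq0 -(natrD _ 1 1) pnatr_eq0.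
by apply: (six_square_form hx); apply/negP => h; apply: no6; [left | right].
Qed.

Lemma square_form_one_in_span : square_form ->
  exists b : T -> C, forall t, uhp t -> \sum_rs b rs * mc rs t = 1.
Proof.
move=> hf.
have [x x0 hx] : exists2 x : nat, (0 < x)%N & (6 * x ^ 2 = p * p')%N.
  case: (hf) => a [b [a0 b0 h]]; exists (a * b)%N; first by rewrite muln_gt0 a0.
  by case: h => -[-> ->]; rewrite expnMn; ring.
have LE : N.+1%:Z = 12 * x%:Z * x%:Z.
  by rewrite levelE // -mulnA -hx !PoszM; ring.
have xz : x%:Z != 0 by move: x0; clear; lia.
(* [chi] stretched by [x]: as [6 x^2 = pp'], the exponent [(w x)^2 / 4pp'] is [w^2 / 24], so the
   theta series of [d] is that of [chi]. *)
pose d (z : int) : C := if (x%:Z %| z)%Z then chi (z %/ x%:Z)%Z else 0.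
have dE w : d (w * x%:Z) = chi w by rewrite /d dvdz_mull ?dvdzz // mulzK.
have d0 z : ~~ (x%:Z %| z)%Z -> d z = 0 by rewrite /d => /negPf ->.
have [cper _ _] := chi_omega_odd R.
have hd : omega_odd d.
  split=> [z l|z|z]; have [/dvdzP[w ->]|h] := boolP (x%:Z %| z)%Z.
  - rewrite dE LE; have -> : l * (12 * x%:Z * x%:Z) + w * x%:Z = (l * x%:Z * 12%:Z + w) * x%:Z by ring.
    by rewrite dE; exact: cper.
  - rewrite !d0 // rpredDl // LE; apply: dvdz_mull; exact: dvdz_mull.
  - by rewrite -mulNr !dE chiN.
  - by rewrite !d0 // rpredN.
  - by rewrite mulrA !dE chi_omega_mul.
  - rewrite !d0 ?oppr0 //; apply: contra h => h.
    (* The square of [omega] is 1 modulo a multiple of [x], so [x] divides [z] whenever it divides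
       [omega z]. *)
    have [c hc] := omega_sqr hp hp' hpp'.
    have -> : z = om * (om * z) - 2 * c * z * (12 * x%:Z * x%:Z).
      by rewrite mulrA hc LE; ring.
    by rewrite rpredB // dvdz_mull // ?dvdz_mull.
exists (fun rs : T => d (theta_lam p p' rs.1.+1 rs.2.+1) / 2) => t ht.
have e0 := eta_neq0 ht.
have th : theta N d t = 2 * eta t.
  rewrite -theta_chi //; apply: (has_sum_uniq (omega_odd_summ hd ht)).
  apply: (has_sum_extend (f := fun w : int => w * x%:Z)) => [w w' /mulIf ->|z hz|] //.
    rewrite d0 ?mul0r //; apply/negP => /dvdzP[w hw]; exact: (hz w).
  apply: has_sum_ext (omega_odd_summ (chi_omega_odd R) ht) => w /=; rewrite dE; congr (_ * _).
  have xr : x%:R != 0 :> R by rewrite pnatr_eq0 -lt0n.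
  rewrite /qtheta level23.
  have -> : N.+1%:R = 12 * x%:R * x%:R :> R by rewrite -[N.+1%:R]/(N.+1%:Z%:~R) LE !rmorphM.
  have E : w%:~R ^+ 2 / (2 * 12) = (w * x%:Z)%:~R ^+ 2 / (2 * (12 * x%:R * x%:R)) :> R.
    by rewrite rmorphM /= -pmulrn; field.
  by rewrite E.
have := theta_omega_odd hp hp' hd ht; rewrite th.
have -> : \sum_(rs : T) d (theta_lam p p' rs.1.+1 rs.2.+1) * theta N (char_coef p p' C rs.1.+1 rs.2.+1) t =
   2 * (2 * eta t) * \sum_(rs : T) d (theta_lam p p' rs.1.+1 rs.2.+1) / 2 * mc rs t.
  rewrite mulr_sumr; apply: eq_bigr => rs _.
  by rewrite (theta_minimal_char hp hp' hpp') // -/(mc rs t); field.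
move: (\sum_rs _) => S h; apply: (mulfI (_ : 2 * (2 * eta t) != 0)).
  have n2 : 2 != 0 :> C by rewrite pnatr_eq0.
  exact: mulf_neq0 n2 (mulf_neq0 n2 e0).
by rewrite mulr1 -h.
Qed.

End ConstantInSpan.

Theorem theorem1p2 (R : realType) (p p' : nat)
  (hp : (2 <= p)%N) (hp' : (2 <= p')%N) (hpp' : coprime p p')
  (f : 'I_((p.-1 * p'.-1)./2) -> Cplx R -> Cplx R)
  (hf : basis_of_span (@minimal_chars R p p') f) :
  holomorphic_modular_form (wronskian_quotient f) /\
  ((forall tau : Cplx R, uhp tau -> wronskian_quotient f tau = 0) <->
   exists a b : nat, [/\ (0 < a)%N, (0 < b)%N &
     (p = 2 * a ^ 2 /\ p' = 3 * b ^ 2)%N \/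
     (p' = 2 * a ^ 2 /\ p = 3 * b ^ 2)%N]).
Proof.
have [f_indep f_span _] := hf.
have [idx [idx_inj idx_onto idx_pos idx_sum]] := pos_index R hp hp' hpp'.
(* The analysis is carried out for these characters, whose leading exponents are distinct; the given
   basis [f] is reached through the matrix [A]. *)
pose e i := @minimal_chars R p p' (idx i).
pose h i : R := hpow R p p' (idx i).1.+1 (idx i).2.+1 - 24^-1.
have he i : isQS (h i) 1 (e i) by exact: isQS_minimal_chars.
have h_inj : injective h.
  by move=> i j /addIr /(hpow_inj hp hp' hpp' (idx_pos i) (idx_pos j)) /idx_inj.
have [P hP] := basis_modS R hp hp' hpp' idx_onto.
have h_sum : \sum_i h i = (wronskian_weight (p.-1 * p'.-1)./2)%:R / 12.
  rewrite -(sum_hpow R hp hp' hpp').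
  exact: (idx_sum (fun rs => hpow R p p' rs.1.+1 rs.2.+1 - 24^-1)).
have hA i : exists b, forall t, uhp t -> f i t = \sum_j b j * e j t.
  by have [a ha] := f_span i; exact: (@span_reduce R p p' hp hp' hpp' idx idx_onto _ a ha).
pose A : 'M[Cplx R]_((p.-1 * p'.-1)./2) := \matrix_(i, j) projT1 (cid (hA i)) j.
have fA i t : uhp t -> f i t = \sum_j A i j * e j t.
  move=> ht; rewrite (projT2 (cid (hA i)) t ht).
  by apply: eq_bigr => j _; rewrite mxE.
split.
  by eexists; exact: (wronskian_quotient_modular he h_inj hP h_sum fA f_indep).
(* The product is positive and, by [card_doubleE], even, so its half is not rounded down to 0. *)
have m0 : (0 < (p.-1 * p'.-1)./2)%N.
  rewrite -double_gt0 (card_doubleE hp hp' hpp') muln_gt0.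
  by move: hp hp'; clear; lia.
have iff0 := wronskian_quotient_eq0 he h_inj hP h_sum fA f_indep m0.
split=> [/iff0[c hc]|hab].
  apply: (one_in_span_square_form (b := fun rs => \sum_(j | idx j == rs) c j) hp hp' hpp') => t ht.
  by rewrite -span_expand; exact: hc.
apply/iff0; have [b hb] := square_form_one_in_span R hp hp' hpp' hab.
have [c hc] := @span_reduce R p p' hp hp' hpp' idx idx_onto (fun=> 1) b (fun t ht => esym (hb t ht)).
by exists c => t ht; rewrite -hc.
Qed.
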